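(* Let $\mu$ be a permuton and, for each $n$, let $\mathcal P^n_\mu$ be a set of $n$ i.i.d. random points with distribution $\mu$. (1) Suppose there exists a probability measure $\mu_0$ on $[0,1]$ without atoms such that $$\frac1x\,\mu\big([0,x]\times\cdot\big)\longrightarrow\mu_0\qquad\text{weakly as }x\to0^+ .$$ Then, as $n\to\infty$, $\mathcal T\langle\mathcal P^n_\mu\rangle$ converges in distribution, for the subtree size topology, to the random function $\psi_{\mu_0}$. (2) Conversely, if $\mathcal T\langle\mathcal P^n_\mu\rangle$ converges in distribution for the subtree size topology as $n\to\infty$, then there exists a probability measure $\mu_0$ on $[0,1]$ (possibly with atoms) such that $\frac1x\,\mu\big([0,x]\times\cdot\big)\to\mu_0$ weakly as $x\to0^+$.
   Context: A permuton is a probability measure $\mu$ on $[0,1]^2$ with uniform marginals: $\mu(A\times[0,1])=\mu([0,1]\times A)=\mathrm{Leb}(A)$. Binary search trees: nodes of binary trees are identified with finite words in $\mathbb V=\{0,1\}^*$ (the empty word $\varnothing$ is the root; $w0$, $w1$ are the left and right children of $w$). A labeled tree is a function $\mathcal T$ from a subset of $\mathbb V$ (its set of nodes) to $\mathbb R$; $\mathcal T(v)$ is the label of $v$ and $|\mathcal T|$ the number of nodes. For a finite or infinite sequence $y=(y_1,y_2,\dots)$ of distinct reals, $\mathcal T\langle y\rangle$ is the tree obtained by inserting $y_1,y_2,\dots$ successively into the empty tree: to insert a value, start at the root, move to the left child if the value is smaller than the label of the current node and to the right child if it is larger, until an empty position is reached, where a new node with this label is created. For a finite point set $\mathcal P\subset\mathbb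 R^2$ with distinct $x$- and distinct $y$-coordinates, $\mathcal T\langle\mathcal P\rangle:=\mathcal T\langle y_{(1)},\dots,y_{(n)}\rangle$, where the points $(x_{(i)},y_{(i)})$ of $\mathcal P$ are ordered so that $x_{(1)}<\dots<x_{(n)}$. Subtree size convergence: for a finite tree $\mathcal T$ and $v\in\mathbb V$, let $t(\mathcal T,v)=\frac1{|\mathcal T|}\,|\{u\in\mathcal T: v\text{ is a prefix of }u\}|$. Let $\Psi$ be the set of functions $\psi:\mathbb V\to[0,1]$ with $\psi(\varnothing)=1$ and $\psi(v)=\psi(v0)+\psi(v1)$ for all $v$. Trees $\mathcal T^n$ converge to $\psi\in\Psi$ in the subtree size topology if $t(\mathcal T^n,v)\to\psi(v)$ for every $v\in\mathbb V$. Convergence in distribution of random trees $\mathcal T^n$ for this topology to a random element $\psi$ of $\Psi$ means that $(t(\mathcal T^n,v))_{v\in\mathbb V}$ converges in distribution to $(\psi(v))_{v\in\mathbb V}$ in $[0,1]^{\mathbb V}$ with the product topology (i.e. convergence of finite-dimensional distributions). The random function $\psi_m$: for a complete infinite binary search tree $\mathcal T:\mathbb V\to(0,1)$, define $\mathcal T_{\mathrm{left}}(v)=0$ if $v$ consists only of zeros, and $\mathcal T_{\mathrm{left}}(v)=\mathcal T(v')$ if $v=v'10^k$ for some $k\ge0$; define $\mathcal T_{\mathrm{right}}(v)=1$ if $v$ consists only of ones, and $\mathcal T_{\mathrm{right}}(v)=\mathcal T(v')$ if $v=v'01^k$ for some $k\ge0$. (The empty word consists both only of zeros and only of ones.) For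 an atomless probability measure $m$ on $[0,1]$, let $Y_1,Y_2,\dots$ be i.i.d. with law $m$ and $\mathcal T^m=\mathcal T\langle Y_1,Y_2,\dots\rangle$, which almost surely is complete (every $v\in\mathbb V$ is a node); then $\psi_m:=\mathcal T^m_{\mathrm{right}}-\mathcal T^m_{\mathrm{left}}$, a random element of $\Psi$. *)

(* Defs.v *)
From HB Require Import structures.
From mathcomp Require Import all_boot all_order all_algebra finmap.
From mathcomp Require Import all_classical all_reals all_analysis.

Set Implicit Arguments.
Unset Strict Implicit.
Unset Printing Implicit Defensive.

Import Order.TTheory GRing.Theory Num.Theory.
Import numFieldNormedType.Exports.

Local Open Scope classical_set_scope.
Local Open Scope ring_scope.

(* Words over {0,1}, read from the root: [false] is a step to the left child
   and [true] a step to the right child, so the children of [v] are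
   [rcons v false] and [rcons v true]. *)
Definition word := seq bool.

(* A labeled tree is a partial function on words; [None] marks non-nodes. *)
Definition ltree (R : Type) := word -> option R.

Definition nodes (R : Type) (T : ltree R) : set word := [set v | T v <> None].

Inductive btree (R : Type) : Type :=
| Empty : btree R
| Node : btree R -> R -> btree R -> btree R.

Arguments Empty {R}.

Fixpoint label (R : Type) (t : btree R) (v : word) : option R :=
  match t, v with
  | Empty, _ => None
  | Node _ a _, [::] => Some a
  | Node l a r, b :: v' => label (if b then r else l) v'
  end.

(* Only sequences of distinct values matter; a value that is already present
   is ignored. *)
Fixpoint insert (R : realType) (t : btree R) (y : R) : btree R :=
  match t with
  | Empty => Node Empty y Empty
  | Node l a r =>
      if y < a then Node (insert l y) a r
      else if a < y then Node l a (insert r y)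
      else t
  end.

Definition bst (R : realType) (ys : seq R) : ltree R :=
  label (foldl (@insert R) Empty ys).

(* A node never moves nor changes label, so the tree of an infinite sequence is
   the union of the increasing sequence of trees of its finite prefixes. *)
Definition bst_stream (R : realType) (y : nat -> R) : ltree R := fun v =>
  xget None [set o | exists n a, o = Some a /\ bst (mkseq y n) v = Some a].

(* The order of the [x]-coordinates. Ties, which are irrelevant for sets of
   points with distinct [x]-coordinates, are broken by the [y]-coordinates so
   that the sorted sequence depends on nothing but the set of points. *)
Definition le_x (R : realType) (p q : R * R) : bool :=
  (p.1 < q.1) || ((p.1 == q.1) && (p.2 <= q.2)).

Definition bst_points (R : realType) (P : {fset R * R}) : ltree R :=
  bst [seq p.2 | p <- sort (@le_x R) (enum_fset P)].

Definition tree_size (R : realType) (T : ltree R) : nat :=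
  #|` fset_set (nodes T)|.

Definition subtree_ratio (R : realType) (T : ltree R) (v : word) : R :=
  (#|` fset_set [set u | nodes T u /\ prefix v u]|)%:R / (tree_size T)%:R.

Definition Psi (R : realType) : set (word -> R) :=
  [set psi | [/\ forall v, 0 <= psi v <= 1,
                 psi [::] = 1
               & forall v, psi v = psi (rcons v false) + psi (rcons v true)]].

(* If the letter [b] occurs in [v], then [v] is uniquely v' b c ... c with c the
   other letter, and [last_turn] returns [T v'] (v' being [v] minus its
   trailing c's and one [b]); otherwise it returns [d]. *)
Definition last_turn (R : Type) (b : bool) (T : word -> R) (d : R) (v : word)
    : R :=
  if b \in v then T (take (size v - (index b (rev v)).+1) v) else d.

Definition tree_left (R : realType) (T : word -> R) : word -> R :=
  last_turn true T 0.

Definition tree_right (R : realType) (T : word -> R) : word -> R :=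
  last_turn false T 1.

(* Only complete trees matter: the default label 0 is then never used. *)
Definition tree_gap (R : realType) (T : ltree R) (v : word) : R :=
  let lab := fun u => odflt 0 (T u) in tree_right lab v - tree_left lab v.

Definition permuton (R : realType) (mu : probability (R * R)%type R) : Prop :=
  mu (`[0, 1] `*` `[0, 1]) = 1%E /\
  forall A : set R, measurable A -> A `<=` `[0, 1] ->
    mu (A `*` `[0, 1]) = lebesgue_measure A /\
    mu (`[0, 1] `*` A) = lebesgue_measure A.

Definition on_unit (R : realType) (m : probability R R) : Prop :=
  m (`[0, 1]%classic : set R) = 1%E.

Definition atomless (R : realType) (m : probability R R) : Prop :=
  forall y : R, m [set y] = 0%E.

Definition mutually_independent (R : realType) (d d' : measure_display)
    (T : measurableType d) (U : measurableType d') (P : probability T R)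
    (I : choiceType) (X : I -> {RV P >-> U}) : Prop :=
  forall (J : {fset I}) (A : I -> set U),
    (forall i, measurable (A i)) ->
    P (\bigcap_(i in [set` J]) (X i @^-1` A i))
      = (\prod_(i <- enum_fset J) P (X i @^-1` A i))%E.

Definition iid (R : realType) (d d' : measure_display)
    (T : measurableType d) (U : measurableType d') (P : probability T R)
    (I : choiceType) (X : I -> {RV P >-> U}) (m : probability U R) : Prop :=
  mutually_independent X /\
  forall i (A : set U), measurable A -> distribution P (X i) A = m A.

Definition random_points (R : realType) (d : measure_display)
    (T : measurableType d) (P : probability T R) (n : nat)
    (Z : 'I_n -> {RV P >-> (R * R)%type}) (w : T) : {fset R * R} :=
  [fset Z i w | i in 'I_n]%fset.

(* The measure (1/x) mu([0,x] x .). Only x > 0 matters; the absolute value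
   makes the formula a measure for every real x. *)
Definition strip (R : realType) (mu : probability (R * R)%type R) (x : R)
    (A : set R) : \bar R :=
  ((`|x|^-1)%:E * mu (`[0%R, x] `*` A))%E.

Section strip_measure.
Local Open Scope ereal_scope.
Context (R : realType) (mu : probability (R * R)%type R) (x : R).

Let strip0 : strip mu x set0 = 0.
Proof. by rewrite /strip setX0 measure0 mule0. Qed.

Let strip_ge0 A : 0 <= strip mu x A.
Proof. by rewrite /strip mule_ge0// lee_fin invr_ge0. Qed.

Let strip_sigma_additive : semi_sigma_additive (strip mu x).
Proof.
move=> F mF tF mUF; rewrite /strip setX_bigcupr.
rewrite [X in X @ _ --> _](_ : _ = (fun n => (`|x|^-1)%:E *
  \sum_(0 <= i < n) mu (`[0%R, x] `*` F i))); last first.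
  by apply/funext => n; rewrite ge0_sume_distrr.
apply: cvgeZl => //; apply: measure_semi_sigma_additive.
- by move=> i; apply: measurableX.
- apply/trivIsetP => i j _ _ ij; rewrite -setXI setIid.
  by move/trivIsetP : tF => /(_ i j Logic.I Logic.I ij) ->; rewrite setX0.
- by rewrite -setX_bigcupr; apply: measurableX.
Qed.

HB.instance Definition _ := isMeasure.Build _ _ _ (strip mu x)
  strip0 strip_ge0 strip_sigma_additive.

End strip_measure.

(* Weak convergence of measures on [0,1]: test functions are the elements of
   C([0,1]). *)
Definition strip_cvg (R : realType)
    (mu : probability (R * R)%type R)
    (m : probability R R) : Prop :=
  forall g : R -> R, {within `[0, 1], continuous g} ->
    (\int[strip mu x]_(y in `[0%R, 1%R]) (g y)%:E)%E @[x --> 0^'+]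
      --> (\int[m]_(y in `[0%R, 1%R]) (g y)%:E)%E.

(* Random elements of Psi; as usual, membership is only required almost
   surely. *)
Definition random_Psi (R : realType) (d : measure_display)
    (T : measurableType d) (P : probability T R) (psi : T -> word -> R)
    : Prop :=
  (forall v, measurable_fun setT (psi ^~ v)) /\
  {ae P, forall w, Psi (psi w)}.

(* The trees Tn and the limit may live on different probability spaces. *)
Definition cvg_subtree_size (R : realType) (d : nat -> measure_display)
    (T : forall n, measurableType (d n)) (P : forall n, probability (T n) R)
    (Tn : forall n, T n -> ltree R)
    (d' : measure_display) (T' : measurableType d') (P' : probability T' R)
    (psi : T' -> word -> R) : Prop :=
  random_Psi P' psi /\
  forall (k : nat) (v : 'I_k -> word) (f : 'rV[R]_k -> R),
    continuous f -> bounded_fun f ->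
    'E_(P n)[fun w => f (\row_(i < k) subtree_ratio (Tn n w) (v i))]%E
        @[n --> \oo]
      --> 'E_P'[fun w => f (\row_(i < k) psi w (v i))]%E.

(* Main.v *)
(** As soon as all proper prefixes of a word [v] are nodes, the subtree of [v]
    collects the values lying strictly between the two labels that bound [v].
    In a large sample the second coordinates are nearly uniform, so the
    proportion of these values is close to the gap between the two labels, and
    the subtree sizes are governed by the second coordinates of the [K] leftmost
    points.  For the direct part, these points lie in a strip of width of
    order [1 / n]; cutting it into cells narrow enough to separate them shows that
    their second coordinates are nearly i.i.d. with law [mu0].

    For the converse, the subtree ratio at the left child of the root is close
    to the second coordinate of the leftmost point, so that, writing [(t, y)]
    for a point of law [mu], [n E ((1 - t) ^ (n - 1) g y)] converges to the
    integral of [g] against the law [mu0] of [psi 0].  As in Karamata's Tauberian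
    theorem, approximating the indicator of [t <= x] by polynomials in
    [(1 - t) ^ n], with [n] of order [1 / x], turns this into the convergence of
    [x^-1 E (g y; t <= x)]. *)

Require Import Defs.
From HB Require Import structures.
From mathcomp Require Import all_boot all_order all_algebra finmap.
From mathcomp Require Import all_classical all_reals all_analysis.
From mathcomp Require Import measurable_realfun.
From mathcomp Require Import lra ring.

Set Implicit Arguments.
Unset Strict Implicit.
Unset Printing Implicit Defensive.

Import Order.TTheory GRing.Theory Num.Theory.
Import numFieldNormedType.Exports.

Local Open Scope classical_set_scope.
Local Open Scope ring_scope.

(** * Binary search trees as iterated filters *)

(** No conditional law is ever formed. Finitely many disjoint events nearly exhaust the probability
    space; each is a finite union of cylinders prescribing a box for every point, so independence
    turns its probability into sums of products. Lower bounds on these probabilities suffice: once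
    they add up to nearly 1, the missing mass contributes little to the mean of a bounded function
    ([step_expectation]). One finite sum then approximates both the mean over the sample and the
    mean over the i.i.d. sequence, so the two are never coupled.

    The discrete data of an event are the cells of a regular grid of [0,1] that contain the first
    [K] values. When these cells are distinct, rounding to the grid preserves the order of the
    values, hence the shape of the tree, and moves each label by at most the mesh. Atomlessness of
    [mu0] makes two values in one cell unlikely, and lets weak convergence be applied to the cells.
    The converse follows a single label through continuous test functions, so atoms do no harm
    there.

    In the Tauberian argument the test function is centred at its limit mean; what remains is to
    show that an error vanishes. *)

Section branch.
Context {R : realType}.
Implicit Types (s : seq R) (v : word).

Definition on_side (b : bool) (a y : R) := if b then a < y else y < a.

(** The values that are inserted at or below [v], in order of insertion: the head becomes the label,
    the others go left or right. The comparisons are strict, so repetitions of the head disappear,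
    as they do with [insert]. *)
Fixpoint branch v s : seq R :=
  if v is b :: v' then
    if s is a :: s' then branch v' [seq y <- s' | on_side b a y] else [::]
  else s.

Lemma foldl_insert_Node s l (a : R) r :
  foldl (@insert R) (Node l a r) s =
  Node (foldl (@insert R) l [seq y <- s | on_side false a y]) a
       (foldl (@insert R) r [seq y <- s | on_side true a y]).
Proof.
elim: s l r => //= y s IH l r.
by case: (ltgtP y a) => /= h; rewrite IH.
Qed.

Lemma branch_nil v : branch v [::] = [::].
Proof. by case: v. Qed.

Lemma bst_branch s v : bst s v = ohead (branch v s).
Proof.
rewrite /bst; elim: v s => [|b v IH] [|a s] //=; rewrite foldl_insert_Node//=.
by case: b; rewrite IH.
Qed.

Lemma branch_cat v1 v2 s : branch (v1 ++ v2) s = branch v2 (branch v1 s).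
Proof. by elim: v1 s => [|b v1 IH] [|a s] //=; rewrite branch_nil. Qed.

Lemma branch_subset v s : {subset branch v s <= s}.
Proof.
elim: v s => [|b v IH] [|a s] //= y /IH.
by rewrite mem_filter inE => /andP[_ ->]; rewrite orbT.
Qed.

Lemma branch_uniq v s : uniq s -> uniq (branch v s).
Proof.
by elim: v s => [|b v IH] [|a s] //= /andP[_ us]; apply/IH/filter_uniq.
Qed.

(** Insertion only compares values. Monotonicity is asked on [s] alone because [phi] will be
    rounding to a grid, which is strictly increasing only on separated values. *)
Lemma branch_map (phi : R -> R) v s : {in s &, {mono phi : x y / x < y}} ->
  branch v [seq phi y | y <- s] = [seq phi y | y <- branch v s].
Proof.
elim: v s => [|b v IH] [|a s] //= mphi; rewrite -IH; last first.
  move=> x y; rewrite !mem_filter => /andP[_ xs] /andP[_ ys].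
  by apply: mphi; rewrite inE ?xs ?ys orbT.
rewrite filter_map; congr (branch _ (map _ _)); apply: eq_in_filter => y ys /=.
by case: b; rewrite /= mphi ?mem_head// inE ys orbT.
Qed.

Lemma branch_prefix v s1 s2 : exists s3, branch v (s1 ++ s2) = branch v s1 ++ s3.
Proof.
elim: v s1 s2 => [|b v IH] [|a s1] s2 /=; try by exists s2.
  by eexists.
by rewrite filter_cat; apply: IH.
Qed.

Lemma bst_prefix v s1 s2 a : bst s1 v = Some a -> bst (s1 ++ s2) v = Some a.
Proof.
by rewrite !bst_branch; have [s3 ->] := branch_prefix v s1 s2; case: branch.
Qed.

Lemma bst_mem v s a : bst s v = Some a -> a \in s.
Proof.
rewrite bst_branch; have := @branch_subset v s; case: branch => //= c t h [<-].
by apply: h; rewrite mem_head.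
Qed.

(** The filter may run over the whole list instead of its tail, since [a] is on neither side of
    itself. *)
Lemma branch_rcons v b s a t : branch v s = a :: t ->
  branch (rcons v b) s = [seq y <- branch v s | on_side b a y].
Proof.
move=> e; rewrite -cats1 branch_cat e /=.
by rewrite {2}/on_side; case: b; rewrite ltxx.
Qed.

(** The recursive form of [last_turn], on which the inductions from the right end of a word rest: a
    final letter [b] makes the parent the last turn, the other letter inherits the turn of the
    parent. *)
Lemma last_turn_rcons (A : Type) b (T : word -> A) d v c :
  last_turn b T d (rcons v c) = if c == b then T v else last_turn b T d v.
Proof.
rewrite /last_turn mem_rcons inE rev_rcons /= size_rcons (eq_sym b c).
case: (eqVneq c b) => [->|cb] /=.
  by rewrite subSS subn0 -cats1 take_size_cat.
case: ifP => // bv; rewrite subSS -cats1 takel_cat//.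
by rewrite leq_subr.
Qed.

Lemma last_turn_nil (A : Type) b (T : word -> A) d : last_turn b T d [::] = d.
Proof. by []. Qed.

Definition bst_label s v := odflt 0 (bst s v).

Definition bst_left s := tree_left (bst_label s).

Definition bst_right s := tree_right (bst_label s).

Definition unit_seq s := forall y, y \in s -> 0 < y < 1.

(** Exactly the positions whose labels [last_turn] may read at [v]; the position [v] itself may be
    empty. *)
Definition ancestors (T : ltree R) v :=
  forall i, (i < size v)%N -> T (take i v) <> None.

Lemma ancestors_rcons T v b : ancestors T (rcons v b) <-> ancestors T v /\ T v <> None.
Proof.
split=> [h|[h hv]].
  split=> [i iv|]; last first.
    by have := h (size v); rewrite size_rcons -cats1 take_size_cat//; apply.
  have := h i; rewrite size_rcons -cats1 takel_cat ?(ltnW iv)//; apply.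
  exact: ltnW.
move=> i; rewrite size_rcons ltnS leq_eqVlt => /orP[/eqP->|iv].
  by rewrite -cats1 take_size_cat.
by rewrite -cats1 takel_cat ?(ltnW iv)//; apply: h.
Qed.

(** Each step down intersects the current interval with a half-line ending at the label of the node.
    This label lies inside the interval, so one end is replaced and the other kept. *)
Lemma branch_gap s v : unit_seq s -> ancestors (bst s) v ->
  branch v s = [seq y <- s | bst_left s v < y < bst_right s v].
Proof.
move=> us; elim/last_ind: v => [|v b IH].
  move=> _ /=; rewrite /bst_left /bst_right /tree_left /tree_right !last_turn_nil.
  by symmetry; apply/all_filterP/allP.
move=> /ancestors_rcons[/IH e].
rewrite bst_branch; case e' : branch => [|a t] // _.
rewrite (branch_rcons b e') e -filter_predI; apply: eq_filter => y /=.
have : a \in branch v s by rewrite e' mem_head.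
rewrite e mem_filter => /andP[/andP[la ar] _].
rewrite /bst_left /bst_right /tree_left /tree_right !last_turn_rcons.
have -> : bst_label s v = a by rewrite /bst_label bst_branch e'.
rewrite /on_side; case: b => /=.
  by case: (ltP a y) => //= ay; rewrite (lt_trans la ay).
by rewrite andbC; case: (ltP y a) => //= ya; rewrite ?andbF// (lt_trans ya ar) andbT.
Qed.

Lemma bst_gap_ge0 s v : unit_seq s -> ancestors (bst s) v ->
  [/\ 0 <= bst_left s v, bst_left s v < bst_right s v & bst_right s v <= 1].
Proof.
move=> us; elim/last_ind: v => [|v b IH]; first by rewrite /bst_left /bst_right /= ltr01.
move=> /ancestors_rcons[hv nv]; have [l0 lr r1] := IH hv.
move: nv; rewrite bst_branch; case e' : branch => [|a t] // _.
have : a \in branch v s by rewrite e' mem_head.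
rewrite branch_gap// mem_filter => /andP[/andP[la ar] _].
rewrite /bst_left /bst_right /tree_left /tree_right !last_turn_rcons.
have -> : bst_label s v = a by rewrite /bst_label bst_branch e'.
by case: b => /=; split=> //; apply: ltW; [exact: le_lt_trans la | exact: lt_le_trans r1].
Qed.

End branch.

(** * Nodes and subtree sizes *)

Section card_nodes.
Context {R : realType}.

(** A concrete duplicate-free list of the nodes: it turns the cardinals of [fset_set] in [tree_size]
    and [subtree_ratio] into sizes of lists. *)
Fixpoint positions (t : btree R) : seq word :=
  if t is Node l _ r
  then [::] :: map (cons false) (positions l) ++ map (cons true) (positions r)
  else [::].

Lemma mem_positions t u : (u \in positions t) = (label t u != None).
Proof.
elim: t u => [|l IHl a r IHr] [|b u] //=.
rewrite inE /= mem_cat; have inj c : injective (cons (c : bool) : word -> word) by move=> ? ? [].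
have nin c d (s : seq word) : c != d -> (c :: u \in map (cons d) s) = false.
  by move=> cd; apply/negP => /mapP[w _ [e _]]; rewrite e eqxx in cd.
by case: b; rewrite (mem_map (inj _)) ?IHl ?IHr nin ?orbF.
Qed.

Lemma positions_uniq t : uniq (positions t).
Proof.
have inj c : injective (cons (c : bool) : word -> word) by move=> ? ? [].
elim: t => //= l IHl _ r IHr; rewrite mem_cat cat_uniq !(map_inj_uniq (inj _)) IHl IHr /= andbT.
apply/andP; split; first by apply/norP; split; apply/negP => /mapP[].
by apply/hasPn => u /mapP[w _ ->]; apply/negP => /mapP[].
Qed.

Lemma size_positions (s : seq R) : uniq s ->
  size (positions (foldl (@insert R) Defs.Empty s)) = size s.
Proof.
have [n] := ubnP (size s); elim: n s => // n IH [|a s] //= sn /andP[as_ us]; rewrite ltnS in sn.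
rewrite foldl_insert_Node /= size_cat !size_map !IH ?filter_uniq//; last first.
- by rewrite (leq_ltn_trans _ sn)// size_filter count_size.
- by rewrite (leq_ltn_trans _ sn)// size_filter count_size.
rewrite !size_filter -(count_predC (on_side false a) s); congr (_ + _).+1.
apply: eq_in_count => y ys /=; rewrite /on_side -leNgt lt_neqAle.
by case: eqVneq => // e; rewrite -e (negPf as_) in ys *.
Qed.

Lemma card_positions (t : btree R) :
  #|` fset_set (nodes (label t))| = size (positions t).
Proof.
have -> : nodes (label t) = [set` positions t].
  by apply/seteqP; split=> u /=; rewrite mem_positions; [move/eqP | move=> /eqP].
rewrite (_ : fset_set _ = [fset x in positions t]%fset); last first.
  by apply/fsetP => u; rewrite in_fset_set ?inE//=; apply/idP/idP; rewrite inE.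
by rewrite card_fseq undup_id// positions_uniq.
Qed.

Lemma card_nodes (s : seq R) : uniq s -> #|` fset_set (nodes (bst s))| = size s.
Proof. by move=> us; rewrite /bst card_positions size_positions. Qed.

(** By [branch_cat], the nodes with prefix [v] are the words [v ++ w] with [w] a node of the tree of
    [branch v s], and prepending [v] is injective. *)
Lemma subtree_ratio_bst (s : seq R) v : uniq s ->
  subtree_ratio (bst s) v = (size (branch v s))%:R / (size s)%:R.
Proof.
move=> us; rewrite /subtree_ratio /tree_size card_nodes//; congr (_%:R / _).
have -> : [set u | nodes (bst s) u /\ prefix v u] =
    [set v ++ w | w in nodes (bst (branch v s))].
  apply/seteqP; split=> [u [nu /prefixP[w e]]|_ [w nw <-]].
    exists w => //; move: nu; rewrite e /nodes /= !bst_branch branch_cat//.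
  by split; rewrite ?prefix_prefix//; move: nw; rewrite /nodes/= !bst_branch branch_cat.
rewrite -(card_nodes (branch_uniq v us)).
rewrite fset_set_image.
  by rewrite card_imfset// => w1 w2 /eqP; rewrite eqseq_cat// eqxx => /eqP.
suff -> : nodes (bst (branch v s)) =
  [set` positions (foldl (@insert R) Defs.Empty (branch v s))] by exact: finite_seq.
by apply/seteqP; split=> u /=; rewrite mem_positions; [move/eqP | move=> /eqP].
Qed.

End card_nodes.

Section comparison.
Context {R : realType}.
Implicit Types (s : seq R) (v : word).

Lemma tree_gap_bst s v : tree_gap (bst s) v = bst_right s v - bst_left s v.
Proof. by []. Qed.

Lemma last_turn_eq (A : Type) b (T T' : word -> A) d v :
  (forall i, (i < size v)%N -> T (take i v) = T' (take i v)) ->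
  last_turn b T d v = last_turn b T' d v.
Proof.
move=> TT'; rewrite /last_turn; case: ifP => // bv; apply: TT'.
by rewrite ltn_subrL /=; case: v bv.
Qed.

Lemma tree_gap_eq (T T' : ltree R) v :
  (forall i, (i < size v)%N -> T (take i v) = T' (take i v)) ->
  tree_gap T v = tree_gap T' v.
Proof.
move=> TT'; rewrite /tree_gap /tree_left /tree_right.
by congr (_ - _); apply: last_turn_eq => i iv; rewrite TT'.
Qed.

Lemma last_turn_map (A B : Type) (phi : A -> B) b (T : word -> A) d v :
  last_turn b (phi \o T) (phi d) v = phi (last_turn b T d v).
Proof. by rewrite /last_turn; case: ifP. Qed.

Lemma bst_cat_gap s1 s2 v : ancestors (bst s1) v ->
  bst_left (s1 ++ s2) v = bst_left s1 v /\ bst_right (s1 ++ s2) v = bst_right s1 v.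
Proof.
move=> anc; rewrite /bst_left /bst_right /tree_left /tree_right.
split; apply: last_turn_eq => i /anc; rewrite /bst_label.
  by case e : (bst s1 _) => [a|] // _; rewrite (bst_prefix _ e).
by case e : (bst s1 _) => [a|] // _; rewrite (bst_prefix _ e).
Qed.

Lemma ancestors_cat s1 s2 v : ancestors (bst s1) v -> ancestors (bst (s1 ++ s2)) v.
Proof.
move=> anc i /anc.
by case e : (bst s1 _) => [a|] // _; rewrite (bst_prefix _ e).
Qed.

(** This separates two scales: a short initial segment fixes the interval, the whole list fills
    it. *)
Lemma size_branch_cat s1 s2 v : unit_seq (s1 ++ s2) -> ancestors (bst s1) v ->
  size (branch v (s1 ++ s2)) =
  count (fun y => bst_left s1 v < y < bst_right s1 v) (s1 ++ s2).
Proof.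
move=> us anc; rewrite branch_gap//; last exact: ancestors_cat.
by have [-> ->] := bst_cat_gap s2 anc; rewrite size_filter.
Qed.

Lemma bst_map (phi : R -> R) s v : {in s &, {mono phi : x y / x < y}} ->
  bst [seq phi y | y <- s] v = omap phi (bst s v).
Proof. by move=> mphi; rewrite !bst_branch branch_map//; case: branch. Qed.

Lemma ancestors_map (phi : R -> R) s v : {in s &, {mono phi : x y / x < y}} ->
  ancestors (bst [seq phi y | y <- s]) v <-> ancestors (bst s) v.
Proof.
by move=> mphi; split=> anc i /anc; rewrite bst_map//; case: (bst s _).
Qed.

(** The conditions at 0 and 1 handle the default bounds of words that lack one of the two
    letters. *)
Lemma bst_gap_map (phi : R -> R) s v : {in s &, {mono phi : x y / x < y}} ->
  phi 0 = 0 -> phi 1 = 1 ->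
  bst_left [seq phi y | y <- s] v = phi (bst_left s v) /\
  bst_right [seq phi y | y <- s] v = phi (bst_right s v).
Proof.
move=> mphi phi0 phi1; rewrite /bst_left /bst_right /tree_left /tree_right.
have lab b c : last_turn b (bst_label [seq phi y | y <- s]) (phi c) v =
    phi (last_turn b (bst_label s) c v).
  apply: etrans (last_turn_map phi b _ c v); apply: last_turn_eq => i iv /=.
  by rewrite /bst_label bst_map//; case: (bst s _).
by rewrite -!lab phi0 phi1.
Qed.

Lemma bst_stream_Some (y : nat -> R) n v a :
  bst (mkseq y n) v = Some a -> bst_stream y v = Some a.
Proof.
move=> e; rewrite /bst_stream.
have ex : [set o | exists n a, o = Some a /\ bst (mkseq y n) v = Some a] (Some a).
  by exists n, a.
have [m [b [-> e']]] := xgetPex None (ex_intro _ _ ex).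
have mono k l : (k <= l)%N -> exists t, mkseq y l = mkseq y k ++ t.
  by move=> kl; exists (map y (iota k (l - k))); rewrite /mkseq -map_cat -iotaD subnKC.
have [[t et]|[t et]] : (exists t, mkseq y m = mkseq y n ++ t) \/
    (exists t, mkseq y n = mkseq y m ++ t).
- by have [/mono|/ltnW/mono] := leqP n m; [left | right].
- by rewrite -e' et (bst_prefix _ e).
- by rewrite -e et (bst_prefix _ e').
Qed.

Lemma bst_stream_eventually (y : nat -> R) v :
  exists N, forall n, (N <= n)%N -> bst (mkseq y n) v = bst_stream y v.
Proof.
have [[N [a e]]|H] := pselect (exists n a, bst (mkseq y n) v = Some a).
  exists N => n Nn; rewrite (bst_stream_Some e) -e.
  have -> : mkseq y n = mkseq y N ++ map y (iota N (n - N)).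
    by rewrite /mkseq -map_cat -iotaD subnKC.
  by rewrite e (bst_prefix _ e).
exists 0%N => n _; have en m : bst (mkseq y m) v = None.
  by case e : (bst _ _) => [a|] //; case: H; exists m, a.
rewrite en /bst_stream; symmetry.
apply: xgetPN => x [m [a [_]]]; by rewrite en.
Qed.

(** This covers incomplete trees too, a position that is never filled being [None] at all stages.
    The gap is thus a pointwise limit everywhere, which gives its measurability. *)
Lemma tree_gap_stream_eventually (y : nat -> R) v :
  exists N, forall n, (N <= n)%N ->
    tree_gap (bst_stream y) v = tree_gap (bst (mkseq y n)) v.
Proof.
suff [N HN] : exists N, forall n i, (N <= n)%N -> (i < size v)%N ->
    bst (mkseq y n) (take i v) = bst_stream y (take i v).
  by exists N => n Nn; apply: tree_gap_eq => i iv; rewrite HN.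
have [N HN] := choice (fun i => bst_stream_eventually y (take i v)).
exists (\max_(i < size v) N i) => n i mn iv; apply: HN.
by apply: leq_trans mn; apply: (leq_bigmax (Ordinal iv)).
Qed.

Lemma tree_gap_stream (y : nat -> R) n v : ancestors (bst (mkseq y n)) v ->
  tree_gap (bst_stream y) v = tree_gap (bst (mkseq y n)) v.
Proof.
move=> anc; apply: tree_gap_eq => i /anc.
by case e : (bst _ _) => [a|] // _; rewrite (bst_stream_Some e).
Qed.

Lemma ancestors_stream (y : nat -> R) v : ancestors (bst_stream y) v ->
  exists N, forall n, (N <= n)%N -> ancestors (bst (mkseq y n)) v.
Proof.
have [N HN] := choice (fun i => bst_stream_eventually y (take i v)).
move=> anc; exists (\max_(i < size v) N i) => n mn i iv; rewrite HN; first exact: anc.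
by apply: leq_trans mn; apply: (leq_bigmax (Ordinal iv)).
Qed.

Lemma Psi_tree_gap (y : nat -> R) : (forall n, 0 < y n < 1) ->
  (forall v, bst_stream y v <> None) -> Psi (tree_gap (bst_stream y)).
Proof.
move=> y01 full; split.
- move=> v; have [N HN] := ancestors_stream (fun i (_ : (i < size v)%N) => full (take i v)).
  have anc := HN _ (leqnn N); rewrite (tree_gap_stream anc) tree_gap_bst.
  have us : unit_seq (mkseq y N) by move=> x /mapP[i _ ->].
  by have [l0 lr r1] := bst_gap_ge0 us anc; apply/andP; split; lra.
- by rewrite /tree_gap /tree_right /tree_left !last_turn_nil subr0.
(* The label of [v] is the right bound of one child and the left bound of the other, and cancels. *)
- move=> v; rewrite /tree_gap /tree_right /tree_left !last_turn_rcons /=.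
  lra.
Qed.

(* Between the two labels bounding [v] there is a value, which lands below [v]. *)
Lemma stream_full (y : nat -> R) : (forall n, 0 < y n < 1) ->
  (forall i, exists2 m, 0 < y m & y m < y i) ->
  (forall i, exists2 m, y i < y m & y m < 1) ->
  (forall i j, y i < y j -> exists2 m, y i < y m & y m < y j) ->
  forall v, bst_stream y v <> None.
Proof.
move=> y01 lo hi mid v.
have full : forall v, ancestors (bst_stream y) v -> bst_stream y v <> None.
  move=> {}v /ancestors_stream[N HN].
  have us n : unit_seq (mkseq y n) by move=> x /mapP[i _ ->].
  have memy n a u : bst (mkseq y n) u = Some a -> exists i, a = y i.
    by move/bst_mem/mapP => [i _ ->]; exists i.
  (* Each bound of [v] is a default (0 or 1) or a value of the sequence; the four combinations are
     met by [y01], [lo], [hi] and [mid]. *)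
  have lab b c : last_turn b (bst_label (mkseq y N)) c v = c \/
      exists i, last_turn b (bst_label (mkseq y N)) c v = y i.
    rewrite /last_turn; case: ifP => bv; last by left.
    right; rewrite /bst_label; set k := (size v - _)%N.
    have := HN _ (leqnn N) k; rewrite /k ltn_subrL /=.
    have sv : (0 < size v)%N by case: (v) bv.
    move=> /(_ sv); case e : (bst _ _) => [a|] // _; exact: memy e.
  have left_lab : bst_left (mkseq y N) v = 0 \/ exists i, bst_left (mkseq y N) v = y i := lab true 0.
  have right_lab : bst_right (mkseq y N) v = 1 \/ exists i, bst_right (mkseq y N) v = y i := lab false 1.
  have [_ lr _] := bst_gap_ge0 (us N) (HN _ (leqnn N)).
  have [m ym] : exists m, bst_left (mkseq y N) v < y m < bst_right (mkseq y N) v.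
    move: lr; case: left_lab => [->|[i ->]]; case: right_lab => [->|[j ->]] lr.
    - by exists 0%N; exact: y01.
    - by have [m a b] := lo j; exists m; rewrite a.
    - by have [m a b] := hi i; exists m; rewrite a.
    - by have [m a b] := mid _ _ lr; exists m; rewrite a.
  set n := (N + m.+1)%N.
  have Nn : (N <= n)%N by rewrite leq_addr.
  suff : bst (mkseq y n) v <> None.
    by case e : (bst _ _) => [a|] // _; rewrite (bst_stream_Some e).
  have : y m \in branch v (mkseq y n).
    rewrite branch_gap ?mem_filter; [| exact: us | exact: HN].
    rewrite map_f ?andbT ?mem_iota ?add0n; last by rewrite /n addnS ltnS leq_addl.
    have -> : mkseq y n = mkseq y N ++ map y (iota N (n - N)).
      by rewrite /mkseq -map_cat -iotaD subnKC.
    by have [-> ->] := bst_cat_gap (map y (iota N (n - N))) (HN _ (leqnn N)).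
  by rewrite bst_branch; case: branch.
have anc : ancestors (bst_stream y) v.
  elim/last_ind: v => // v b anc; apply/ancestors_rcons; split => //; exact: full.
exact: full.
Qed.

End comparison.

(** * Measurability of labels and gaps *)

Section measurability.
Context d (T : measurableType d) {R : realType}.
Implicit Types fs : seq (T -> R).

Definition eval_seq fs w := [seq f w | f <- fs].

Lemma measurable_bst_label fs v : (forall i, measurable_fun setT (nth (cst 0) fs i)) ->
  measurable_fun setT (fun w => bst_label (eval_seq fs w) v).
Proof.
elim: v fs => [|b v IH] fs mfs.
  case: fs mfs => [|f fs] mfs; [exact: measurable_cst |].
  rewrite (_ : (fun _ => _) = f); first exact: (mfs 0%N).
  by apply/funext => w; rewrite /bst_label bst_branch.
case: fs mfs => [|f fs] mfs; first exact: measurable_cst.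
have mf : measurable_fun setT f := mfs 0%N.
have {}mfs i : measurable_fun setT (nth (cst 0) fs i) := mfs i.+1.
(* The list handed to the child depends on [w] through the filter. Splitting it into a part [pre]
   already accepted and a part [l] still to be filtered makes each comparison a single measurable
   [if]. *)
pose G (pre : seq (T -> R)) (l : seq (T -> R)) w :=
  bst_label (eval_seq pre w ++ [seq y <- eval_seq l w | on_side b (f w) y]) v.
suff mG : forall l pre : seq (T -> R), (forall i, measurable_fun setT (nth (cst 0) pre i)) ->
    (forall i, measurable_fun setT (nth (cst 0) l i)) -> measurable_fun setT (G pre l).
  apply: (eq_measurable_fun (G [::] fs)) => [w _|].
    by rewrite /G /bst_label !bst_branch.
  by apply: mG => // i; rewrite nth_nil; exact: measurable_cst.
elim=> [|g l IHl] pre mpre ml.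
  rewrite (_ : G _ _ = fun w => bst_label (eval_seq pre w) v); first exact: IH.
  by apply/funext => w; rewrite /G /= cats0.
have mg : measurable_fun setT g := ml 0%N.
have {}ml i : measurable_fun setT (nth (cst 0) l i) := ml i.+1.
rewrite (_ : G _ _ = fun w => if on_side b (f w) (g w) then G (rcons pre g) l w else G pre l w).
  apply: measurable_fun_ifT.
  - rewrite /on_side; case: b {IH G IHl}; apply: measurable_fun_ltr => //.
  - apply: IHl => // i; rewrite nth_rcons.
    by case: ifP => // _; case: ifP => // _; exact: measurable_cst.
  - exact: IHl.
apply/funext => w; rewrite /G /=; case: ifP => //.
by rewrite /eval_seq map_rcons cat_rcons.
Qed.

Lemma measurable_bst_label_mkseq (Y : nat -> T -> R) n v :
  (forall i, measurable_fun setT (Y i)) ->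
  measurable_fun setT (fun w => bst_label (mkseq (Y ^~ w) n) v).
Proof.
move=> mY; have -> : (fun w => bst_label (mkseq (Y ^~ w) n) v) =
    (fun w => bst_label (eval_seq (mkseq Y n) w) v).
  by apply/funext => w; rewrite /eval_seq /mkseq -map_comp.
apply: measurable_bst_label => i.
have [ni|ni] := ltnP i n; first by rewrite nth_mkseq.
by rewrite nth_default ?size_mkseq//; exact: measurable_cst.
Qed.

Lemma measurable_tree_gap_stream (Y : nat -> T -> R) v :
  (forall i, measurable_fun setT (Y i)) ->
  measurable_fun setT (fun w => tree_gap (bst_stream (Y ^~ w)) v).
Proof.
move=> mY.
have mn n b c : measurable_fun setT
    (fun w => last_turn b (bst_label (mkseq (Y ^~ w) n)) c v).
  rewrite /last_turn; case: (b \in v); last exact: measurable_cst.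
  exact: measurable_bst_label_mkseq.
apply: (@measurable_fun_cvg _ _ _ _ (fun n w => tree_gap (bst (mkseq (Y ^~ w) n)) v)).
  by move=> n; apply: measurable_funB; exact: mn.
move=> w _; have [N HN] := tree_gap_stream_eventually (Y ^~ w) v.
apply: cvg_near_cst; exists N => // n /= /HN ->.
by [].
Qed.

End measurability.

(** * Samples sorted from left to right *)

Section sorted_points.
Context {R : realType}.

Lemma le_x_total : total (@le_x R).
Proof.
move=> p q; rewrite /le_x; case: (ltgtP p.1 q.1) => //= _; exact: le_total.
Qed.

Lemma le_x_trans : transitive (@le_x R).
Proof.
move=> q p r; rewrite /le_x => /orP[pq|/andP[/eqP -> pq]] /orP[qr|/andP[/eqP qr qr']].
- by rewrite (lt_trans pq qr).
- by rewrite -qr pq.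
- by rewrite qr.
- by rewrite qr eqxx (le_trans pq qr') orbT.
Qed.

Lemma le_x_antisym : antisymmetric (@le_x R).
Proof.
move=> [p p'] [q q']; rewrite /le_x /=; case: (ltgtP p q) => //= <-.
by move=> /le_anti ->.
Qed.

(** [le_x] is antisymmetric, so a sorted list is determined by its elements: it is enough to exhibit
    one sorted arrangement, [idx] followed by the other indices in sorted order. *)
Lemma sort_points n (p : 'I_n -> R * R) (idx : seq 'I_n) :
  injective (fst \o p) ->
  sorted (fun i j => (p i).1 < (p j).1) idx ->
  (forall i j, i \notin idx -> j \in idx -> (p j).1 < (p i).1) ->
  exists2 rest, sort (@le_x R) (enum_fset [fset p i | i in 'I_n]%fset) =
      [seq p i | i <- idx ++ rest] & perm_eq (idx ++ rest) (enum 'I_n).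
Proof.
move=> injx sidx gap.
have trx : transitive (fun i j => (p i).1 < (p j).1) by move=> ? ? ?; exact: lt_trans.
have uidx : uniq idx.
  by apply: sorted_uniq sidx => // i; rewrite ltxx.
have injp : injective p by move=> i j e; apply: injx; rewrite /= e.
pose rest := sort (relpre p (@le_x R)) [seq i <- enum 'I_n | i \notin idx].
have perm : perm_eq (idx ++ rest) (enum 'I_n).
  apply: uniq_perm; rewrite ?enum_uniq//.
    rewrite cat_uniq uidx /= sort_uniq filter_uniq ?enum_uniq// andbT.
    by apply/hasPn => i; rewrite mem_sort mem_filter => /andP[].
  move=> i; rewrite mem_cat mem_sort mem_filter mem_enum.
  by case: (i \in idx).
exists rest => //.
apply: (sorted_eq le_x_trans le_x_antisym).
- exact: (sort_sorted le_x_total).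
- rewrite sorted_map sorted_pairwise; last by move=> ? ? ?; exact: le_x_trans.
  rewrite pairwise_cat; apply/and3P; split.
  + apply/allrelP => i j ii; rewrite mem_sort mem_filter => /andP[jn _].
    by rewrite /= /le_x gap.
  + rewrite -sorted_pairwise; last by move=> ? ? ?; exact: le_x_trans.
    by apply: sub_sorted sidx => i j /= ij; rewrite /le_x ij.
  + rewrite -sorted_pairwise; last by move=> ? ? ?; exact: le_x_trans.
    by apply: sort_sorted => i j; exact: le_x_total.
- apply: (@perm_trans _ (enum_fset [fset p i | i in 'I_n]%fset)).
    by rewrite perm_sort.
  apply: (@perm_trans _ [seq p i | i <- enum 'I_n]); last first.
    by apply: perm_map; rewrite perm_sym.
  apply: uniq_perm; [exact: fset_uniq | by rewrite map_inj_uniq// enum_uniq | move=> q].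
  apply/idP/idP.
    by move=> /imfsetP[i _ ->]; rewrite map_f// mem_enum.
  by move=> /mapP[i _ ->]; apply: in_imfset.
Qed.

(** Only the leftmost points [idx] need to be known in order. The others enter through a count,
    which is invariant under permutation. *)
Lemma subtree_ratio_points n (p : 'I_n -> R * R) (idx : seq 'I_n) v :
  injective (fst \o p) -> injective (snd \o p) ->
  (forall i, 0 < (p i).2 < 1) ->
  sorted (fun i j => (p i).1 < (p j).1) idx ->
  (forall i j, i \notin idx -> j \in idx -> (p j).1 < (p i).1) ->
  let s := [seq (p i).2 | i <- idx] in
  ancestors (bst s) v ->
  subtree_ratio (bst_points [fset p i | i in 'I_n]%fset) v =
  #|[pred i | bst_left s v < (p i).2 < bst_right s v]|%:R / n%:R.
Proof.
move=> injx injy y01 sidx gap s anc.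
have [rest e perm] := sort_points injx sidx gap.
rewrite /bst_points e -map_comp map_cat -/s.
have us : uniq (s ++ [seq (snd \o p) i | i <- rest]).
  by rewrite -map_cat map_inj_uniq// (perm_uniq perm) enum_uniq.
rewrite (subtree_ratio_bst _ us) size_branch_cat//; last first.
  by move=> y; rewrite -map_cat => /mapP[i _ ->]; exact: y01.
rewrite -map_cat size_map (perm_size perm) size_enum_ord count_map.
rewrite (permP perm); congr (_%:R / _).
by rewrite -sum1_count -sum1_card big_enum_cond /=; apply: eq_bigl => i; rewrite inE.
Qed.

End sorted_points.

(** * Expectations of step functions *)

Section pr.
Context d (T : measurableType d) {R : realType} (P : probability T R).

Definition pr (A : set T) : R := fine (P A).

Lemma prE A : measurable A -> P A = (pr A)%:E.
Proof. by move=> mA; rewrite /pr fineK// fin_num_measure. Qed.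

Lemma pr_ge0 A : 0 <= pr A.
Proof. by rewrite /pr fine_ge0. Qed.

Lemma prT : pr setT = 1.
Proof. by rewrite /pr probability_setT. Qed.

Lemma pr_le A B : measurable A -> measurable B -> A `<=` B -> pr A <= pr B.
Proof. by move=> mA mB AB; rewrite -lee_fin -!prE// le_measure// inE. Qed.

Lemma pr_le1 A : measurable A -> pr A <= 1.
Proof. by move=> mA; rewrite -prT; apply: pr_le. Qed.

(* No measurability is needed: the integral of a nonnegative function is a
   supremum over the simple functions below it. *)
Lemma le_integral_any (f g : T -> \bar R) : (forall w, (f w <= g w)%E) ->
  (\int[P]_w f w <= \int[P]_w g w)%E.
Proof.
move=> fg; have fg' w : ((f \_ setT) w <= (g \_ setT) w)%E by rewrite !patchT ?inE.
rewrite /integral; apply: leeB; apply: le_ereal_sup => _ [h hf <-]; exists h => //= w.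
- by apply: le_trans (hf w) _; rewrite !funeposE ge_max !le_max fg' lexx /= orbT.
- apply: le_trans (hf w) _; rewrite !funenegE ge_max !le_max lexx orbT andbT.
  by rewrite leeN2 fg'.
Qed.

Section simple.
Context (I : finType) (Q : pred I) (c : I -> R) (A : I -> set T).
Hypothesis mA : forall i, measurable (A i).

(** The set [N] is meant as an exceptional event and the [A i] as the pieces on which the integrand
    is nearly constant. *)
Definition affine_step a b N w := a + b * \1_N w + \sum_(i | Q i) c i * \1_(A i) w.

Let integrable_scale (k : R) (B : set T) : measurable B ->
  P.-integrable setT (EFin \o (fun w => k * \1_B w)).
Proof.
move=> mB; have -> : EFin \o (fun w => k * \1_B w) = (fun w => k%:E * (\1_B w)%:E)%E.
  by apply/funext => w.
by apply: integrableZl => //; apply: integrable_indic.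
Qed.

Lemma integral_affine_step a b N : measurable N ->
  (\int[P]_w (affine_step a b N w)%:E)%E =
  (a + b * pr N + \sum_(i | Q i) c i * pr (A i))%:E.
Proof.
move=> mN.
have ind k B : measurable B -> (\int[P]_w (k * \1_B w)%:E)%E = (k * pr B)%:E.
  move=> mB; rewrite (eq_integral (fun w => k%:E * (\1_B w)%:E)%E)//.
  rewrite integralZl//; last exact: integrable_indic.
  rewrite integral_indic// setIT EFinM; congr (_ * _)%E; exact: prE.
have ia : P.-integrable setT (EFin \o (cst a)) by exact: finite_measure_integrable_cst.
have iN := integrable_scale b mN.
have iS : P.-integrable setT (fun w => \sum_(i | Q i) (c i * \1_(A i) w)%:E)%E.
  by apply: integrable_sum => // i _; exact: integrable_scale.
rewrite (eq_integral (fun w => (a%:E + (b * \1_N w)%:E) +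
   \sum_(i | Q i) (c i * \1_(A i) w)%:E)%E); last first.
  by move=> w _; rewrite /affine_step !EFinD sumEFin.
rewrite integralD//; last exact: integrableD.
have Ia : (\int[P]_x a%:E)%E = a%:E.
  rewrite (@integral_cst _ _ _ P setT measurableT) -[RHS]mule1; congr (_ * _)%E.
  exact: probability_setT.
rewrite integralD// Ia ind// !EFinD; congr (_ + _)%E.
rewrite integral_sum//; last by move=> i; exact: integrable_scale.
by rewrite -sumEFin; apply: eq_bigr => i _; rewrite ind.
Qed.

(** Linear inequalities between probabilities follow from pointwise ones between indicators: the
    union bound, the bound for disjoint events and Chebyshev's inequality are all instances. *)
Lemma pr_step_ge0 a b N : measurable N -> (forall w, 0 <= affine_step a b N w) ->
  0 <= a + b * pr N + \sum_(i | Q i) c i * pr (A i).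
Proof.
move=> mN h; rewrite -lee_fin -integral_affine_step//.
by apply: integral_ge0 => w _; rewrite lee_fin.
Qed.

(** In the applications [h] is a function of a random tree whose measurability is not established;
    squeezing it between step functions still bounds its mean. *)
Lemma expectation_le_step (h : T -> R) a b N : measurable N ->
  (forall w, h w <= affine_step a b N w) ->
  ('E_P[h] <= (a + b * pr N + \sum_(i | Q i) c i * pr (A i))%:E)%E.
Proof.
move=> mN hs; rewrite -integral_affine_step// unlock.
by apply: le_integral_any => w; rewrite lee_fin.
Qed.

Lemma expectation_ge_step (h : T -> R) a b N : measurable N ->
  (forall w, affine_step a b N w <= h w) ->
  ((a + b * pr N + \sum_(i | Q i) c i * pr (A i))%:E <= 'E_P[h])%E.
Proof.
move=> mN hs; rewrite -integral_affine_step// unlock.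
by apply: le_integral_any => w; rewrite lee_fin.
Qed.

End simple.

Lemma indic_ge0 (A : set T) w : 0 <= \1_A w :> R.
Proof. by rewrite indicE ler0n. Qed.

Lemma indic1 (A : set T) w : A w -> \1_A w = 1 :> R.
Proof. by move=> Aw; rewrite indicE mem_set. Qed.

Lemma indic0 (A : set T) w : ~ A w -> \1_A w = 0 :> R.
Proof. by move=> Aw; rewrite indicE memNset. Qed.

Lemma pr_bigU (I : finType) (Q : pred I) (A : I -> set T) (N : set T) :
  (forall i, measurable (A i)) -> measurable N ->
  (forall w, N w -> exists2 i, Q i & A i w) -> pr N <= \sum_(i | Q i) pr (A i).
Proof.
move=> mA mN NA.
have := @pr_step_ge0 I Q (fun=> 1) A mA 0 (-1) N mN.
under eq_bigr do rewrite mul1r.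
rewrite add0r mulN1r addrC subr_ge0; apply => w; rewrite /affine_step add0r mulN1r.
have [Nw|nNw] := pselect (N w); last first.
  by rewrite indic0// oppr0 add0r sumr_ge0// => i _; rewrite mul1r indic_ge0.
have [i Qi Ai] := NA w Nw; rewrite indic1// (bigD1 i)//= indic1// mul1r addrA addNr add0r.
by rewrite sumr_ge0// => j _; rewrite mul1r indic_ge0.
Qed.

Lemma pr_setC A : measurable A -> pr (~` A) = 1 - pr A.
Proof.
move=> mA; apply: EFin_inj; rewrite EFinB -(prE mA) -(prE (measurableC mA)).
exact: probability_setC.
Qed.

Lemma pr_setU_le A B : measurable A -> measurable B -> pr (A `|` B) <= pr A + pr B.
Proof.
move=> mA mB; have := @pr_bigU bool predT (fun b => if b then A else B) (A `|` B).
rewrite big_bool; apply.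
- by case.
- exact: measurableU.
- by move=> w [Aw|Bw]; [exists true | exists false].
Qed.

Section disjoint.
Context (I : finType) (Q : pred I) (A : I -> set T).
Hypothesis mA : forall i, measurable (A i).
Hypothesis dA : forall w i j, Q i -> Q j -> A i w -> A j w -> i = j.

Lemma sum_indic (c : I -> R) w i : Q i -> A i w ->
  \sum_(j | Q j) c j * \1_(A j) w = c i.
Proof.
move=> Qi Ai; rewrite (bigD1 i)//= indic1// mulr1 big1 ?addr0// => j /andP[Qj ji].
by rewrite indic0 ?mulr0// => Aj; move/eqP: ji; apply; exact: dA Aj Ai.
Qed.

Lemma sum_indic0 (c : I -> R) w : (forall i, Q i -> ~ A i w) ->
  \sum_(j | Q j) c j * \1_(A j) w = 0.
Proof. by move=> nA; rewrite big1// => j Qj; rewrite indic0 ?mulr0//; exact: nA. Qed.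

Lemma sum_pr_le (N : set T) : measurable N -> (forall i w, Q i -> A i w -> N w) ->
  \sum_(i | Q i) pr (A i) <= pr N.
Proof.
move=> mN AN.
have := @pr_step_ge0 I Q (fun=> -1) A mA 0 1 N mN.
rewrite add0r mul1r; under eq_bigr do rewrite mulN1r.
rewrite sumrN subr_ge0; apply => w; rewrite /affine_step add0r mul1r.
have [[i [Qi Ai]]|nA] := pselect (exists i, Q i /\ A i w).
  by rewrite (sum_indic _ Qi Ai) indic1 ?subrr//; exact: AN Ai.
rewrite sum_indic0 ?addr0 ?indic_ge0// => i Qi Ai; apply: nA; by exists i.
Qed.

(** From above, [h] is at most [C + e + 2 * C * \1_N] plus the sum of [(F i - C) * \1_(A i)]. The
    coefficients [F i - C] are nonpositive, so replacing the probability of [A i] by the smaller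
    [q i] only raises the bound. The lower bound is the mirror image, with [F i + C]. *)
Lemma step_expectation (h : T -> R) (F q : I -> R) (N : set T) (C e : R) :
  measurable N -> 0 <= e ->
  (forall w, `|h w| <= C) -> (forall i, Q i -> `|F i| <= C) ->
  (forall i, Q i -> 0 <= q i <= pr (A i)) ->
  (forall i w, Q i -> A i w -> ~ N w -> `|h w - F i| <= e) ->
  exists2 x, ('E_P[h] = x%:E)%E &
    `|x - \sum_(i | Q i) F i * q i| <=
      e + C * (1 - \sum_(i | Q i) q i) + 2 * C * pr N.
Proof.
move=> mN e0 hC FC qA hF.
have C0 : 0 <= C by apply: le_trans (hC point).
have up : ('E_P[h] <= (e + C * (1 - \sum_(i | Q i) q i) + 2 * C * pr N +
    \sum_(i | Q i) F i * q i)%:E)%E.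
  have := @expectation_le_step I Q (fun i => F i - C) A mA h (C + e) (2 * C) N mN.
  move=> /(_ _)/le_trans; apply.
    move=> w; rewrite /affine_step.
    have [[i [Qi Ai]]|nA] := pselect (exists i, Q i /\ A i w).
      rewrite (sum_indic _ Qi Ai).
      move: (hC w) (FC i Qi); rewrite !ler_norml => /andP[? ?] /andP[? ?].
      have [Nw|nNw] := pselect (N w); first by rewrite indic1//; lra.
      by move: (hF i w Qi Ai nNw); rewrite indic0// ler_norml => /andP[? ?]; lra.
    rewrite sum_indic0; last by move=> i Qi Ai; apply: nA; exists i.
    move: (hC w) (indic_ge0 N w); rewrite ler_norml => /andP[? ?] ?.
    by rewrite addr0 -addrA ler_wpDr// addr_ge0// mulr_ge0// mulr_ge0.
  rewrite lee_fin.
  have -> : e + C * (1 - \sum_(i | Q i) q i) + 2 * C * pr N + \sum_(i | Q i) F i * q i =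
      C + e + 2 * C * pr N + \sum_(i | Q i) (F i - C) * q i.
    under [in RHS]eq_bigr do rewrite mulrBl.
    by rewrite sumrB -mulr_sumr; ring.
  rewrite lerD2l; apply: ler_sum => i Qi; have /andP[_ qi] := qA i Qi.
  by rewrite ler_wnM2l// subr_le0; move: (FC i Qi); rewrite ler_norml => /andP[].
have down : ((\sum_(i | Q i) F i * q i -
    (e + C * (1 - \sum_(i | Q i) q i) + 2 * C * pr N))%:E <= 'E_P[h])%E.
  have := @expectation_ge_step I Q (fun i => F i + C) A mA h (- C - e) (- 2 * C) N mN.
  move=> h1; apply: le_trans (h1 _); last first.
    move=> w; rewrite /affine_step.
    have [[i [Qi Ai]]|nA] := pselect (exists i, Q i /\ A i w).
      rewrite (sum_indic _ Qi Ai).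
      move: (hC w) (FC i Qi); rewrite !ler_norml => /andP[? ?] /andP[? ?].
      have [Nw|nNw] := pselect (N w); first by rewrite indic1//; lra.
      by move: (hF i w Qi Ai nNw); rewrite indic0// ler_norml => /andP[? ?]; lra.
    rewrite sum_indic0; last by move=> i Qi Ai; apply: nA; exists i.
    move: (hC w) (indic_ge0 N w); rewrite ler_norml => /andP[? ?] ?.
    have : 0 <= C * \1_N w by rewrite mulr_ge0.
    by rewrite addr0; lra.
  rewrite lee_fin.
  have -> : \sum_(i | Q i) F i * q i -
    (e + C * (1 - \sum_(i | Q i) q i) + 2 * C * pr N) =
      - C - e + - 2 * C * pr N + \sum_(i | Q i) (F i + C) * q i.
    under [in RHS]eq_bigr do rewrite mulrDl.
    by rewrite big_split /= -mulr_sumr; ring.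
  rewrite lerD2l; apply: ler_sum => i Qi; have /andP[_ qi] := qA i Qi.
  by rewrite ler_wpM2l//; move: (FC i Qi); rewrite ler_norml => /andP[]; lra.
case: ('E_P[h])%E up down => [x| |]; rewrite ?lee_fin ?leNgt ?ltry ?ltNyr//= => up down.
exists x => //; rewrite ler_norml; apply/andP; split; lra.
Qed.

End disjoint.

Section independent_count.
Context (n : nat) (E : 'I_n -> set T) (p : R).
Hypothesis mE : forall i, measurable (E i).
Hypothesis prp : forall i, pr (E i) = p.
Hypothesis indep : forall i j, i != j -> pr (E i `&` E j) = p * p.

(** With [S] the number of events that occur, [t ^+ 2 * \1_N <= (S - n p) ^+ 2] pointwise. The
    square is expanded into indicators, of pairs ([inl]) for [S ^+ 2] and of single events ([inr])
    for [S]; the variance [n p (1 - p)] is then bounded by [n p]. *)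
Lemma chebyshev_count (t : R) (N : set T) : measurable N -> 0 < t ->
  (forall w, N w -> t <= `|\sum_i \1_(E i) w - n%:R * p|) ->
  pr N <= n%:R * p / t ^+ 2.
Proof.
move=> mN t0 Nt.
pose A (k : 'I_n * 'I_n + 'I_n) := match k with inl ij => E ij.1 `&` E ij.2 | inr i => E i end.
pose c (k : 'I_n * 'I_n + 'I_n) := if k is inr _ then - 2 * n%:R * p else 1.
have mA k : measurable (A k) by case: k => [ij|i] //=; exact: measurableI.
have := @pr_step_ge0 _ predT c A mA (n%:R ^+ 2 * p ^+ 2) (- t ^+ 2) N mN.
have -> : \sum_k c k * pr (A k) = n%:R * p + (n%:R ^+ 2 - n%:R) * p ^+ 2 - 2 * n%:R ^+ 2 * p ^+ 2.
  rewrite big_sumType /= [X in X + _](eq_bigr (fun ij => pr (E ij.1 `&` E ij.2))); last first.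
    by move=> ij _; rewrite mul1r.
  rewrite -(pair_big predT predT (fun i j => pr (E i `&` E j))) /=.
  rewrite (eq_bigr (fun=> p + (n%:R - 1) * p ^+ 2)); last first.
    move=> i _; rewrite (bigD1 i)//= setIid prp; congr (_ + _).
    rewrite (eq_bigr (fun=> p * p)); last by move=> j ji; rewrite indep// eq_sym.
    rewrite (eq_bigl (fun j => j \in predC1 i)) // sumr_const cardC1 card_ord -[LHS]mulr_natl expr2; congr (_ * _).
    by case: (n) i => [[]//|m] i /=; rewrite -natr1 addrK.
  rewrite [X in _ + X](eq_bigr (fun=> - 2 * n%:R * p * p)); last by move=> i _; rewrite prp.
  by rewrite !sumr_const card_ord -[X in X + _]mulr_natl -[X in _ + X]mulr_natl; ring.
move=> /(_ _) h.
have : 0 <= n%:R * p - t ^+ 2 * pr N.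
  have : 0 <= n%:R * p ^+ 2 by rewrite mulr_ge0// sqr_ge0.
  suff : 0 <= n%:R ^+ 2 * p ^+ 2 + - t ^+ 2 * pr N + (n%:R * p + (n%:R ^+ 2 - n%:R) * p ^+ 2 - 2 * n%:R ^+ 2 * p ^+ 2) by lra.
  apply: h => w; rewrite /affine_step big_sumType /=.
  rewrite [X in _ + (X + _)](eq_bigr (fun ij => \1_(E ij.1) w * \1_(E ij.2) w)); last first.
    by move=> ij _; rewrite mul1r indicI.
  rewrite -(pair_big predT predT (fun i j => \1_(E i) w * \1_(E j) w)) /=.
  rewrite -mulr_sumr; set S := \sum_(i < n) \1_(E i) w.
  rewrite [X in _ + (X + _)](_ : _ = S ^+ 2); last first.
    under eq_bigr do rewrite -mulr_sumr.
    by rewrite -mulr_suml expr2.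
  have -> : n%:R ^+ 2 * p ^+ 2 + - t ^+ 2 * \1_N w + (S ^+ 2 + - 2 * n%:R * p * S) =
    (S - n%:R * p) ^+ 2 - t ^+ 2 * \1_N w by ring.
  have [Nw|nNw] := pselect (N w); last by rewrite indic0// mulr0 subr0 sqr_ge0.
  rewrite indic1// mulr1 subr_ge0 -[leRHS]real_normK ?num_real//.
  by rewrite ler_sqr ?nnegrE ?normr_ge0 ?(ltW t0)//; exact: Nt.
by rewrite subr_ge0 ler_pdivlMr ?exprn_gt0// mulrC.
Qed.

End independent_count.

End pr.

Section count_deviation.
Context d (T : measurableType d) {R : realType} (n : nat) (E : 'I_n -> set T).

Lemma measurable_count_deviation (c t : R) : (forall i, measurable (E i)) ->
  measurable [set w | t <= `|\sum_i \1_(E i) w - c|].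
Proof.
move=> mE; rewrite (_ : [set _ | _] = (fun w => `|\sum_i \1_(E i) w - c|) @^-1` `[t, +oo[); last first.
  by apply/seteqP; split=> w; rewrite /= in_itv /= andbT.
rewrite -[X in measurable X]setTI.
suff : measurable_fun setT (fun w => `|\sum_i \1_(E i) w - c|) by apply=> //; exact: measurable_itv.
apply: measurableT_comp => //; apply: measurable_funB => //.
by apply: measurable_sum => i; exact: measurable_indic.
Qed.

Lemma sum_indic_card (w : T) (D : pred 'I_n) : (forall i, D i <-> E i w) ->
  \sum_i \1_(E i) w = #|D|%:R :> R.
Proof.
move=> DE; rewrite -sum1_card natr_sum [RHS]big_mkcond /=; apply: eq_bigr => i _.
rewrite indicE; have -> : (w \in E i) = (i \in D).
  by apply/idP/idP; rewrite inE => /DE.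
by case: (i \in D).
Qed.

End count_deviation.

(** * Independent samples *)

Section iid.
Context d (T : measurableType d) d' (U : measurableType d') {R : realType}.
Context (P : probability T R) (I : choiceType) (X : I -> {RV P >-> U}).
Context (m : probability U R).
Hypothesis iidX : iid X m.

Definition cylinder (s : seq I) (B : I -> set U) : set T :=
  [set w | forall i, i \in s -> B i (X i w)].

Lemma measurable_preimage i (B : set U) : measurable B -> measurable (X i @^-1` B).
Proof. exact: measurable_funPTI. Qed.

Lemma cylinderE s B : cylinder s B =
  \bigcap_(i in [set` [fset i in s]%fset]) (X i @^-1` B i).
Proof.
apply/seteqP; split=> w h i; first by move=> /=; rewrite inE; exact: h.
by move=> si; apply: (h i); rewrite /= inE.
Qed.

Lemma measurable_cylinder s B : (forall i, measurable (B i)) -> measurable (cylinder s B).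
Proof.
move=> mB; rewrite cylinderE; apply: fin_bigcap_measurable => // i _.
exact: measurable_preimage.
Qed.

Lemma pr_preimage i (B : set U) : measurable B -> pr P (X i @^-1` B) = pr m B.
Proof. by move=> mB; rewrite /pr -(iidX.2 i B mB). Qed.

Lemma pr_cylinder s B : uniq s -> (forall i, measurable (B i)) ->
  pr P (cylinder s B) = \prod_(i <- s) pr m (B i).
Proof.
move=> us mB; apply: EFin_inj; rewrite -prE; last exact: measurable_cylinder.
rewrite cylinderE iidX.1// -prodEFin.
rewrite [LHS](eq_bigr (fun i => (pr m (B i))%:E)); last first.
  move=> i _; rewrite -(pr_preimage i (mB i)); apply: prE; exact: measurable_preimage.
apply: perm_big; apply: uniq_perm => // i.
by rewrite !inE.
Qed.

Lemma pr_pair i j (A B : set U) : i != j -> measurable A -> measurable B ->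
  pr P (X i @^-1` A `&` X j @^-1` B) = pr m A * pr m B.
Proof.
move=> ij mA mB; pose C k := if k == i then A else B.
have := @pr_cylinder [:: i; j] C; rewrite /= inE andbT => /(_ ij) h.
have {}h := h (fun k => ltac:(rewrite /C; case: ifP => _; assumption)).
rewrite !big_cons big_nil mulr1 /C eqxx eq_sym (negPf ij) in h.
rewrite -h; congr (pr P _); apply/seteqP; split=> w.
  move=> [Aw Bw] k; rewrite !inE => /orP[/eqP ->|/eqP ->]; first by rewrite eqxx.
  by rewrite eq_sym (negPf ij).
move=> h'; split.
  by have := h' i; rewrite mem_head eqxx; apply.
by have := h' j; rewrite !inE eqxx orbT eq_sym (negPf ij); apply.
Qed.

(** Two independent points share a cell with probability the sum of the squared cell masses, which
    is at most the largest mass times the total mass. *)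
Lemma tie_small (L : finType) (C : L -> set U) (S : set U) i j (eta : R) (N : set T) :
  i != j -> 0 <= eta -> (forall l, measurable (C l)) -> measurable S -> measurable N ->
  (forall x k l, C k x -> C l x -> k = l) ->
  (forall l, C l `<=` S) ->
  (forall l, pr m (C l) <= eta) ->
  (forall w, N w -> exists2 l, C l (X i w) & C l (X j w)) ->
  pr P N <= pr m S * eta.
Proof.
move=> ij eta0 mC mS mN dC CS Ceta NC.
apply: (@le_trans _ _ (\sum_l pr P (X i @^-1` C l `&` X j @^-1` C l))).
  apply: pr_bigU => //.
    by move=> l; apply: measurableI; exact: measurable_preimage.
  by move=> w /NC[l ? ?]; exists l.
rewrite (eq_bigr (fun l => pr m (C l) * pr m (C l))); last by move=> l _; rewrite pr_pair.
apply: (@le_trans _ _ (\sum_l pr m (C l) * eta)).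
  by apply: ler_sum => l _; rewrite ler_wpM2l// pr_ge0.
rewrite -mulr_suml ler_wpM2r//.
by apply: sum_pr_le => // [w k l _ _|l x _]; [exact: dC|exact: CS].
Qed.

Section shared.
Context (n : nat) (f : 'I_n -> I) (L : finType) (C : L -> set U).
Hypothesis f_inj : injective f.
Hypothesis mC : forall l, measurable (C l).
Hypothesis C_inj : forall x k l, C k x -> C l x -> k = l.

Definition shared : set T :=
  [set w | exists i j l, [/\ i != j, C l (X (f i) w) & C l (X (f j) w)]].

Lemma measurable_shared : measurable shared.
Proof.
rewrite (_ : shared = \bigcup_(ij in [set ij : 'I_n * 'I_n | ij.1 != ij.2])
    \bigcup_l (X (f ij.1) @^-1` C l `&` X (f ij.2) @^-1` C l)); last first.
  apply/seteqP; split=> w; first by move=> [i [j [l [ij wi wj]]]]; exists (i, j) => //; exists l.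
  by move=> [[i j] ij [l _ [wi wj]]]; exists i, j, l.
apply: fin_bigcup_measurable; first exact: finite_finset.
move=> ij _; apply: fin_bigcup_measurable => // l _.
by apply: measurableI; apply: measurable_preimage.
Qed.

Lemma pr_shared (S : set U) (eta : R) : 0 <= eta -> measurable S ->
  (forall l, C l `<=` S) -> (forall l, pr m (C l) <= eta) ->
  pr P shared <= n%:R ^+ 2 * (pr m S * eta).
Proof.
move=> eta0 mS CS Ceta.
pose E (ij : 'I_n * 'I_n) := \bigcup_l (X (f ij.1) @^-1` C l `&` X (f ij.2) @^-1` C l).
have mE ij : measurable (E ij).
  apply: fin_bigcup_measurable => // l _.
  by apply: measurableI; apply: measurable_preimage.
apply: (@le_trans _ _ (\sum_(ij | ij.1 != ij.2) pr P (E ij))).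
  apply: pr_bigU => //; first exact: measurable_shared.
  by move=> w [i [j [l [ij wi wj]]]]; exists (i, j) => //; exists l.
apply: (@le_trans _ _ (\sum_(ij : 'I_n * 'I_n | ij.1 != ij.2) (pr m S * eta))).
  apply: ler_sum => -[i j] /= ij; apply: (@tie_small L C S (f i) (f j)) => //.
    by rewrite (inj_eq f_inj).
  by move=> w [l _ [wi wj]]; exists l.
rewrite sumr_const -[leLHS]mulr_natl ler_wpM2r ?mulr_ge0 ?pr_ge0//.
by rewrite -natrX ler_nat (leq_trans (max_card _))// card_prod card_ord expnS expn1.
Qed.

End shared.

Lemma ae_notin i (S : set U) : m.-negligible S -> {ae P, forall w, ~ S (X i w)}.
Proof.
move=> [B [mB B0 SB]]; exists (X i @^-1` B); split.
- exact: measurable_preimage.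
- by rewrite -B0 -(iidX.2 i B mB).
- by move=> w /= /contrapT /SB.
Qed.

End iid.

Section almost_everywhere.
Context d (T : measurableType d) {R : realType} (P : probability T R).

Lemma pr0_negligible (N : set T) : measurable N -> pr P N <= 0 -> P.-negligible N.
Proof.
move=> mN N0; apply/negligibleP => //; apply: etrans (prE P mN) _.
by congr _%:E; apply/eqP; rewrite eq_le N0 pr_ge0.
Qed.

Lemma pr_nonincreasing_small (V : nat -> set T) (eps : R) : 0 < eps ->
  (forall n, measurable (V n)) -> (forall n k, (n <= k)%N -> V k `<=` V n) ->
  P.-negligible (\bigcap_n V n) ->
  exists N, forall n, (N <= n)%N -> pr P (V n) <= eps.
Proof.
move=> eps0 mV decV V0.
have mI : measurable (\bigcap_n V n) by exact: bigcapT_measurable.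
have cvgV : P (V n) @[n --> \oo] --> P (\bigcap_n V n).
  apply: nonincreasing_cvg_mu => //.
  - by apply: le_lt_trans (probability_le1 P (mV 0%N)) (ltry _).
  - by move=> n k nk; apply/subsetPset; exact: decV.
move/negligibleP: V0 => /(_ mI) V0; rewrite [X in _ --> X]V0 in cvgV.
have /cvgrPdist_le/(_ eps eps0)[N _ HN] : pr P (V n) @[n --> \oo] --> (0 : R).
  exact: (fine_cvg cvgV).
exists N => n /HN /=; rewrite sub0r normrN; apply: le_trans; exact: ler_norm.
Qed.

(** Turns a random threshold into a deterministic one: the unions of all later [U k] decrease to the
    event that infinitely many occur, which is null. *)
Lemma pr_eventually_small (U : nat -> set T) (eps : R) : 0 < eps ->
  (forall n, measurable (U n)) ->
  {ae P, forall w, exists N, forall n, (N <= n)%N -> ~ U n w} ->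
  exists N, forall n, (N <= n)%N -> pr P (U n) <= eps.
Proof.
move=> eps0 mU aeU; pose V n := \bigcup_k U (n + k)%N.
have mV n : measurable (V n) by exact: bigcupT_measurable.
have [||N HN] := pr_nonincreasing_small eps0 mV.
- move=> n k nk w [l _ Uw]; exists (k - n + l)%N => //.
  by rewrite addnA subnKC.
- apply: negligibleS aeU => w VI [N HN].
  by have [k _ Uw] := VI N Logic.I; apply: (HN _ _ Uw); rewrite leq_addr.
exists N => n Nn; apply: le_trans (HN n Nn); apply: pr_le => // w Uw.
by exists 0%N; rewrite ?addn0.
Qed.

End almost_everywhere.

(** Never hitting [B] implies missing it [N] times, an event of probability [(1 - pr m B) ^+ N]. *)
Lemma ae_hit d (T : measurableType d) d' (U : measurableType d') (R : realType)
    (P : probability T R) (m : probability U R) (Y : nat -> {RV P >-> U}) (B : set U) :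
  iid Y m -> measurable B -> 0 < pr m B -> {ae P, forall w, exists n, B (Y n w)}.
Proof.
move=> iidY mB B0; pose N0 := \bigcap_n (Y n @^-1` (~` B)).
have mBC := measurableC mB.
have mN0 : measurable N0.
  by apply: bigcapT_measurable => n; exact: measurable_preimage.
suff : P.-negligible N0.
  apply: negligibleS => w nB n _ Bn; apply: nB; by exists n.
apply: pr0_negligible => //; apply/ler_addgt0Pl => eps eps0; rewrite addr0.
pose q := 1 - pr m B.
have q0 : 0 <= q by rewrite subr_ge0 pr_le1.
have /cvgrPdist_le/(_ eps eps0)[N _ HN] : q ^+ n @[n --> \oo] --> (0 : R).
  by apply: cvg_expr; rewrite ger0_norm// /q gtrBl.
have := HN N (leqnn N); rewrite /= sub0r normrN ger0_norm ?exprn_ge0//.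
apply: le_trans; have -> : q ^+ N = \prod_(i <- iota 0 N) pr m (~` B).
  by rewrite pr_setC// big_const_seq count_predT size_iota iter_mulr_1.
rewrite -(pr_cylinder iidY) ?iota_uniq//; apply: pr_le => //.
  exact: measurable_cylinder.
by move=> w N0w i _; exact: N0w.
Qed.

Lemma natr_above (R : realType) (x : R) : exists n : nat, forall k : nat, (n <= k)%N -> x < k%:R.
Proof.
exists (Num.truncn x).+1 => k; rewrite -(ler_nat R); apply: lt_le_trans.
exact: truncnS_gt.
Qed.

(** * Uniformity by compactness *)

Section compactness.
Context {R : realType}.

(** A Lebesgue number argument for an arbitrary property of a point and a radius; it serves both for
    uniform continuity and for the mass of short intervals. *)
Lemma compact_uniform (X : pseudoMetricType R) (K : set X) (Q : X -> R -> Prop) :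
  compact K ->
  (forall x, K x -> exists2 r, 0 < r &
     forall z delta, ball x r z -> 0 < delta -> delta < r -> Q z delta) ->
  exists2 delta, 0 < delta & forall x, K x -> Q x delta.
Proof.
move=> /compact_near_coveringP cK H.
have : \forall delta \near (0 : R)^'+, 0 < delta /\ K `<=` [set x | Q x delta].
  apply: filterI; first exact: nbhs_right_gt.
  apply: (cK R (0 : R)^'+ (fun delta x => Q x delta)) => x Kx; have [r r0 Hr] := H x Kx.
  exists (ball x r, [set delta | 0 < delta < r]) => /=.
    split; first exact: nbhsx_ballx.
    near=> delta; apply/andP; split; near: delta.
      exact: nbhs_right_gt.
    exact: nbhs_right_lt.
  by move=> [z delta] /= [xz /andP[? ?]]; exact: Hr.
by case/filter_ex => delta [delta0 Hd]; exists delta.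
Unshelve. all: end_near. Qed.

(** Only [x] is confined to the cube, so it can be the gaps of a rounded tree while [y] is a vector
    of subtree ratios, whose range is never computed. *)
Lemma heine k (f : 'rV[R]_k -> R) (eps : R) : continuous f -> 0 < eps ->
  exists2 delta, 0 < delta & forall x y : 'rV[R]_k,
    (forall i, 0 <= x ord0 i <= 1) -> (forall i, `|x ord0 i - y ord0 i| < delta) ->
    `|f x - f y| <= eps.
Proof.
move=> cf eps0; pose K := [set x : 'rV[R]_k | forall i, `[0%R, 1%R]%classic (x ord0 i)].
have cK : compact K by apply: (@rV_compact R k (fun=> `[0%R, 1%R]%classic)) => i; exact: segment_compact.
pose Q (x : 'rV[R]_k) (delta : R) := forall y, ball x delta y -> `|f x - f y| <= eps.
have [|delta delta0 Hd] := @compact_uniform _ K Q cK.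
  move=> x Kx.
  have /cvgrPdist_le/(_ (eps / 2)) := cf x; rewrite divr_gt0// => /(_ isT).
  move=> /nbhs_ballP[r /= r0 Hr]; exists (r / 2); first by rewrite divr_gt0.
  move=> z delta xz delta0 dr y zy.
  have fz : `|f x - f z| <= eps / 2.
    by apply: Hr; apply: le_ball xz; lra.
  have fy : `|f x - f y| <= eps / 2.
    apply: Hr; rewrite /= [r]splitr; apply: ball_triangle xz _.
    by apply: le_ball zy; exact: ltW.
  by rewrite (le_trans (ler_distD (f x) _ _))// [eps]splitr lerD// distrC.
exists delta => // x y x01 xy; apply: Hd.
  by move=> i; rewrite /= in_itv; exact: x01.
by split => // i j; rewrite ord1; exact: xy.
Qed.

(** Intervals shrinking to a fixed [x] decrease to the null set [[set x]]; compactness makes the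
    radius uniform. *)
Lemma atomless_small (m : probability R R) (eps : R) : atomless m -> 0 < eps ->
  exists2 delta, 0 < delta & forall x : R, 0 <= x <= 1 ->
    pr m `](x - delta), (x + delta)[%classic <= eps.
Proof.
move=> am eps0.
pose Q (x : R) (delta : R) := pr m `](x - delta), (x + delta)[%classic <= eps.
have [|delta delta0 Hd] := @compact_uniform R `[0%R, 1%R]%classic Q (@segment_compact _ _ _).
  move=> x _.
  pose V (n : nat) : set R := `](x - n.+1%:R^-1), (x + n.+1%:R^-1)[%classic.
  have [|n k nk y| |N HN] := @pr_nonincreasing_small _ _ _ m V eps eps0.
  - by move=> n; exact: measurable_itv.
  - rewrite /V /= !in_itv /= => /andP[xy yx].
    have : (k.+1%:R^-1 : R) <= n.+1%:R^-1 by rewrite lef_pV2 ?posrE// ler_nat.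
    by move: (k.+1%:R^-1) (n.+1%:R^-1) xy yx => a b xy yx ?; apply/andP; split; lra.
  - apply: (@negligibleS _ _ _ _ [set x]); last by apply/negligibleP => //; exact: am.
    move=> y Vy /=; apply/eqP; rewrite -subr_eq0 -normr_le0; apply/ler_addgt0Pl => e e0.
    rewrite addr0; have := Vy (Num.truncn e^-1) Logic.I; rewrite /V /= in_itv /= => h.
    have : (Num.truncn e^-1).+1%:R^-1 <= e.
      rewrite invf_ple ?posrE//; exact/ltW/truncnS_gt.
    by rewrite ler_norml; move: (_.+1%:R^-1) h => u /andP[? ?] ?; apply/andP; split; lra.
  exists (N.+1%:R^-1 / 2); first by rewrite divr_gt0.
  move=> z delta; rewrite /ball /= => xz delta0 dn; apply: le_trans (HN N (leqnn N)).
  apply: pr_le; [exact: measurable_itv|exact: measurable_itv|].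
  move=> y; rewrite /V /= !in_itv /=; move: xz; rewrite ltr_norml.
  move: (N.+1%:R^-1) dn => u dn /andP[? ?] /andP[? ?]; apply/andP; split; lra.
by exists delta => // x x01; apply: Hd; rewrite /= in_itv.
Qed.

End compactness.

(** * Almost sure completeness of the tree of an i.i.d. sequence *)

Section dense_labels.
Context {R : realType} (m : probability R R).
Hypothesis m_atomless : atomless m.

(** Rationals indexed by natural numbers, the form that [ae_foralln] and [negligible_bigcup]
    take. *)
Let q (k : nat) : R := ratr (odflt (0 : rat) (choice.unpickle k)).

Let q_dense (s t : R) : s < t -> exists k, s < q k < t.
Proof.
move=> st; have [r] := rat_in_itvoo st; rewrite in_itv /= => h.
by exists (choice.pickle r); rewrite /q choice.pickleK.
Qed.

Let negl_bigcup_nat (I : countType) (A : I -> set R) :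
  (forall i, m.-negligible (A i)) -> m.-negligible (\bigcup_i A i).
Proof.
move=> nA; apply: (@negligibleS _ _ _ _ (\bigcup_k (if choice.unpickle k is Some i then A i else set0))).
  by move=> x [i _ Ai]; exists (choice.pickle i) => //; rewrite choice.pickleK.
apply: negligible_bigcup => k; case: choice.unpickle => // *; exact: negligible_set0.
Qed.

(* A point of [S] that is neither its least nor its greatest element lies in a
   null open interval with rational endpoints. *)
Lemma negligible_gapless (S : set R) :
  (forall s t, S s -> S t -> s < t -> m.-negligible `]s, t[%classic) ->
  m.-negligible S.
Proof.
move=> nS.
pose A (kl : nat * nat) : set R :=
  if `[< m.-negligible `]q kl.1, q kl.2[%classic >] then `]q kl.1, q kl.2[%classic else set0.
have n1 (x : R) : m.-negligible [set x].
  by apply/negligibleP => //; exact: m_atomless.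
pose B (b : bool) := [set x | S x /\ forall y, S y -> if b then y <= x else x <= y].
have nB b : m.-negligible (B b).
  have [[x [Sx Bx]]|nx] := pselect (exists x, B b x).
    apply: negligibleS (n1 x) => y [Sy By] /=; apply/eqP; rewrite eq_le.
    by have := Bx y Sy; have := By x Sx; case: b {Bx By} => -> ->.
  apply: negligibleS (negligible_set0 m) => x Bx; apply: nx; by exists x.
apply: (@negligibleS _ _ _ _ ((\bigcup_kl A kl) `|` (B true `|` B false))); last first.
  apply: negligibleU; last by apply: negligibleU; exact: nB.
  apply: negl_bigcup_nat => kl; rewrite /A; case: asboolP => // _; exact: negligible_set0.
move=> x Sx.
have [Bt|nBt] := pselect (B true x); first by right; left.
have [Bf|nBf] := pselect (B false x); first by right; right.
have [u [Su xu]] : exists u, S u /\ x < u.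
  apply: contrapT => nu; apply: nBt; split => // y Sy; rewrite leNgt; apply/negP => xy.
  by apply: nu; exists y.
have [s [Ss sx]] : exists s, S s /\ s < x.
  apply: contrapT => nu; apply: nBf; split => // y Sy; rewrite leNgt; apply/negP => xy.
  by apply: nu; exists y.
have [k /andP[sk kx]] := q_dense sx; have [l /andP[xl lu]] := q_dense xu.
left; exists (k, l) => //; rewrite /A /=; case: asboolP => [_|].
  by rewrite /= in_itv /= kx.
case; apply: (@negligibleS _ _ _ _ (`]s, x[%classic `|` ([set x] `|` `]x, u[%classic))).
  move=> y; rewrite /= !in_itv /= => /andP[ky yl].
  by case: (ltgtP y x) => [yx|xy|->]; [left; rewrite (lt_trans sk)
    | right; right; rewrite (lt_trans yl) | right; left].
by apply: negligibleU; [exact: nS|apply: negligibleU; [exact: n1|exact: nS]].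
Qed.

Context d (T : measurableType d) (P : probability T R) (Y : nat -> {RV P >-> R}).
Hypothesis Y_iid : iid Y m.
Hypothesis m_unit : on_unit m.

Lemma ae_unit : {ae P, forall w, forall n, 0 < Y n w < 1}.
Proof.
apply: ae_foralln => n.
have : m.-negligible (~` `]0%R, 1%R[%classic).
  apply: (@negligibleS _ _ _ _ ((~` `[0%R, 1%R]%classic `|` ([set (0 : R)] `|` [set (1 : R)])) : set R)).
    move=> y; rewrite /= !in_itv /= => h; apply: contrapT => /not_orP[/contrapT].
    move=> /andP[y0 y1] /not_orP[/eqP n0 /eqP n1]; apply: h.
    by rewrite !lt_neqAle y0 y1 n1 eq_sym n0.
  apply: negligibleU; last first.
    by apply: negligibleU; apply/negligibleP => //; exact: m_atomless.
  apply/negligibleP; first exact: measurableC.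
  by apply: etrans (probability_setC m _) _ => //; rewrite m_unit subee.
move/(ae_notin Y_iid n); apply: filterS => w /contrapT; by rewrite /= in_itv.
Qed.

(** The values need not be dense in [0,1], since [m] may vanish on intervals. Almost surely,
    however, every rational interval of positive mass is hit, and no value bounds a nondegenerate
    null interval whose other end is rational. So there is mass, hence a further value, between any
    two distinct values and between a value and 0 or 1. *)
Lemma ae_stream_full :
  {ae P, forall w, (forall n, 0 < Y n w < 1) /\ forall v, bst_stream (Y ^~ w) v <> None}.
Proof.
have hit : {ae P, forall w, forall k l, ~ m.-negligible `]q k, q l[%classic ->
    exists n, `]q k, q l[%classic (Y n w)}.
  apply: ae_foralln => k; apply: ae_foralln => l.
  have [neg|nneg] := pselect (m.-negligible `]q k, q l[%classic).
    by apply: filterE => w /(_ neg).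
  have := @ae_hit _ _ _ _ _ _ _ Y `]q k, q l[%classic Y_iid (measurable_itv _).
  move=> /(_ _)H; apply: filterS (H _) => [w [n Yn] _|]; first by exists n.
  by rewrite ltNge; apply/negP => /pr0_negligible; apply: contra_not nneg; apply; exact: measurable_itv.
have right_ok : {ae P, forall w, forall n l, Y n w < q l -> ~ m.-negligible `]Y n w, q l[%classic}.
  apply: ae_foralln => n; apply: ae_foralln => l.
  (* If [s < t] both belong to this set, then []s, t[] is part of the null interval []s, q l[], so
     [negligible_gapless] applies. *)
  have : m.-negligible [set t | t < q l /\ m.-negligible `]t, q l[%classic].
    apply: negligible_gapless => s t [sq ns] [tq nt] st.
    apply: negligibleS ns => y; rewrite /= !in_itv /= => /andP[-> yt]; exact: lt_trans yt tq.
  by move/(ae_notin Y_iid n); apply: filterS => w h Yq nY; apply: h.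
have left_ok : {ae P, forall w, forall n l, q l < Y n w -> ~ m.-negligible `]q l, Y n w[%classic}.
  apply: ae_foralln => n; apply: ae_foralln => l.
  have : m.-negligible [set t | q l < t /\ m.-negligible `]q l, t[%classic].
    apply: negligible_gapless => s t [sq ns] [tq nt] st.
    apply: negligibleS nt => y; rewrite /= !in_itv /= => /andP[sy ->]; rewrite andbT; exact: lt_trans sy.
  by move/(ae_notin Y_iid n); apply: filterS => w h Yq nY; apply: h.
(* An open interval is a countable union of rational ones; if it is not null, one of these is not
   null either and is therefore hit. *)
have rat_cover (s t : R) (hits : set R) : ~ m.-negligible `]s, t[%classic ->
    (forall k l, ~ m.-negligible `]q k, q l[%classic -> (hits `&` `]q k, q l[) !=set0) ->
    exists2 y, hits y & s < y < t.
  move=> nn hit_hits; apply: contrapT => H; apply: nn.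
  apply: (@negligibleS _ _ _ _ (\bigcup_(kl : nat * nat)
      (if (s < q kl.1) && (q kl.2 < t) then `]q kl.1, q kl.2[%classic else set0))).
    move=> y; rewrite /= in_itv /= => /andP[/q_dense[k /andP[sk ky]] /q_dense[l /andP[yl lt]]].
    by exists (k, l) => //; rewrite /= sk lt /= in_itv /= ky.
  apply: negl_bigcup_nat => -[k l]; case: ifP => [/andP[/= sk lt]|_]; last exact: negligible_set0.
  apply: contrapT => /hit_hits[y []]; rewrite /= in_itv /= => hy /andP[ky yl].
  by apply: H; exists y; rewrite // (lt_trans sk ky) (lt_trans yl lt).
have q_rat (r : rat) : exists k, q k = ratr r by exists (choice.pickle r); rewrite /q choice.pickleK.
have [k0 qk0] := q_rat 0; have [k1 qk1] := q_rat 1.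
rewrite rmorph0 in qk0; rewrite rmorph1 in qk1.
apply: filterS2 (filterI ae_unit hit) (filterI right_ok left_ok).
move=> w [Yw hitw] [rw lw].
have between s t : ~ m.-negligible `]s, t[%classic -> exists n, s < Y n w < t.
  move=> /(@rat_cover _ _ (range (Y ^~ w)))[k l /hitw[n Yn]|_ [n _ <-] h]; last by exists n.
  by exists (Y n w); split=> //; exists n.
split => //; apply: stream_full => //.
- move=> i; have /andP[Y0 _] := Yw i.
  have [|n /andP[? ?]] := between 0 (Y i w); last by exists n.
  by rewrite -qk0; apply: lw; rewrite qk0.
- move=> i; have /andP[_ Y1] := Yw i.
  have [|n /andP[? ?]] := between (Y i w) 1; last by exists n.
  by rewrite -qk1; apply: rw; rewrite qk1.
- move=> i j /q_dense[l /andP[il lj]].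
  have [|n /andP[? ?]] := between (Y i w) (q l); first exact: rw.
  by exists n => //; exact: lt_trans lj.
Qed.

End dense_labels.

(** * Permutons and their strips *)

Section grid.
Context {R : realType}.

Definition gridcell (M j : nat) : set R := `[(j%:R / M%:R), (j.+1%:R / M%:R)[%classic.

Definition gridpos (M : nat) (y : R) : nat := Num.truncn (M%:R * y).

Definition grid (M : nat) (y : R) : R := (gridpos M y)%:R / M%:R.

Lemma measurable_gridcell M j : measurable (gridcell M j).
Proof. exact: measurable_itv. Qed.

Lemma gridcellP M j y : (0 < M)%N -> gridcell M j y -> gridpos M y = j.
Proof.
move=> M0; rewrite /gridcell /= in_itv /= ler_pdivrMr ?ltr0n// ltr_pdivlMr ?ltr0n// mulrC.
move=> /andP[jy yj]; apply: truncn_def; by rewrite jy yj.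
Qed.

Lemma gridcell_pos M y : (0 < M)%N -> 0 <= y -> gridcell M (gridpos M y) y.
Proof.
move=> M0 y0; rewrite /gridcell /= in_itv /= ler_pdivrMr ?ltr0n// ltr_pdivlMr ?ltr0n// mulrC.
by have /truncn_itv := mulr_ge0 (ler0n _ M) y0.
Qed.

Lemma grid_itv M y : (0 < M)%N -> 0 <= y -> grid M y <= y < grid M y + M%:R^-1.
Proof.
move=> M0 y0; have := gridcell_pos M0 y0.
by rewrite /gridcell /= in_itv /= /grid -natr1 mulrDl mul1r.
Qed.

Lemma gridpos_le M x y : x <= y -> (gridpos M x <= gridpos M y)%N.
Proof. by move=> xy; apply: le_truncn; rewrite ler_wpM2l. Qed.

Lemma gridpos_lt M y : (0 < M)%N -> 0 <= y < 1 -> (gridpos M y < M)%N.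
Proof.
move=> M0 /andP[y0 y1]; rewrite -(ltr_nat R).
have /truncn_itv/andP[h _] := mulr_ge0 (ler0n _ M) y0.
by apply: le_lt_trans h _; rewrite -[ltRHS]mulr1 ltr_pM2l ?ltr0n.
Qed.

Lemma grid0 M : grid M 0 = 0.
Proof. by rewrite /grid /gridpos mulr0 truncn0 mul0r. Qed.

Lemma grid1 M : (0 < M)%N -> grid M 1 = 1.
Proof.
by move=> M0; rewrite /grid /gridpos mulr1 natrK divff// pnatr_eq0 -lt0n.
Qed.

(** Rounding is monotone in the weak sense everywhere; it is strict once no two elements of [s]
    share a cell. *)
Lemma grid_mono M (s : seq R) : (0 < M)%N -> {in s &, injective (gridpos M)} ->
  {in s &, {mono grid M : x y / x < y}}.
Proof.
move=> M0 inj x y xs ys; rewrite /grid ltr_pM2r ?invr_gt0 ?ltr0n// ltr_nat.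
apply/idP/idP => [|xy]; first by apply: contraLR; rewrite -leqNgt -leNgt; exact: gridpos_le.
rewrite ltn_neqAle gridpos_le ?(ltW xy)// andbT; apply/negP => /eqP /inj e.
by move: xy; rewrite e// ltxx.
Qed.

Lemma grid_gap M (s : seq R) v : (0 < M)%N -> unit_seq s ->
  {in s &, injective (gridpos M)} -> ancestors (bst s) v ->
  tree_gap (bst [seq grid M y | y <- s]) v =
  grid M (bst_right s v) - grid M (bst_left s v).
Proof.
move=> M0 us inj anc; rewrite tree_gap_bst.
by have [-> ->] := bst_gap_map v (grid_mono M0 inj) (grid0 M) (grid1 M0).
Qed.

(** Both bounds are rounded down, by less than the mesh, so the two errors have opposite effects and
    do not add up. *)
Lemma tree_gap_grid_dist M (s : seq R) v : (0 < M)%N -> unit_seq s ->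
  {in s &, injective (gridpos M)} -> ancestors (bst s) v ->
  `|tree_gap (bst s) v - tree_gap (bst [seq grid M y | y <- s]) v| <= M%:R^-1.
Proof.
move=> M0 us inj anc; rewrite grid_gap// tree_gap_bst.
have [l0 lr r1] := bst_gap_ge0 us anc.
have /andP[h1 h2] := grid_itv M0 l0.
have /andP[h3 h4] := grid_itv M0 (le_trans l0 (ltW lr)).
move: (M%:R^-1) h1 h2 h3 h4 => u h1 h2 h3 h4.
by rewrite ler_norml; apply/andP; split; lra.
Qed.

(* [c t] counts the points below [t]; knowing it on the grid determines every
   interval count up to the mesh. *)
Lemma count_gap_grid_dist n (y : 'I_n -> R) M (delta a b : R) :
  (0 < M)%N -> (0 < n)%N -> 0 <= delta -> (forall i, 0 < y i < 1) ->
  (forall j, (j <= M)%N ->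
     `|#|[pred i | y i < j%:R / M%:R]|%:R - n%:R * (j%:R / M%:R)| <= delta * n%:R) ->
  0 <= a -> a < b -> b <= 1 ->
  `|#|[pred i | a < y i < b]|%:R / n%:R - (grid M b - grid M a)| <=
    M%:R^-1 + 2 * delta.
Proof.
move=> M0 n0 delta0 y01 Hc a0 ab b1.
have M0R : 0 < M%:R :> R by rewrite ltr0n.
have n0R : 0 < n%:R :> R by rewrite ltr0n.
pose c (t : R) : R := #|[pred i | y i < t]|%:R.
have c_le s t : s <= t -> c s <= c t.
  by move=> st; rewrite ler_nat; apply/subset_leq_card/fintype.subsetP => i;
    rewrite !inE => /lt_le_trans; apply.
(* Extended to [j > M] because the cell of [b = 1] ends at [M.+1]. *)
have c_up j : c (j%:R / M%:R) <= n%:R * (j%:R / M%:R) + delta * n%:R.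
  have [/Hc|Mj] := leqP j M; first by rewrite ler_norml lerBlDl addrC => /andP[].
  apply: (@le_trans _ _ n%:R).
    by rewrite ler_nat (leq_trans (max_card _))// card_ord.
  rewrite -[leLHS]addr0 lerD// ?mulr_ge0 ?ler0n//.
  by rewrite ler_peMr// ler_pdivlMr// mul1r ler_nat ltnW.
have c_dn j : (j <= M)%N -> n%:R * (j%:R / M%:R) - delta * n%:R <= c (j%:R / M%:R).
  by move=> /Hc; rewrite ler_norml lerBrDl => /andP[+ _]; rewrite -/(c _); lra.
have /andP[ga ga'] := grid_itv M0 a0.
have b0 : 0 <= b by rewrite (le_trans a0)// ltW.
have /andP[gb gb'] := grid_itv M0 b0.
have S j : j.+1%:R / M%:R = j%:R / M%:R + M%:R^-1 :> R by rewrite -natr1 mulrDl mul1r.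
pose N : R := #|[pred i | a < y i < b]|%:R.
have N_up : N <= c b - c a.
  rewrite lerBrDr -natrD ler_nat -[X in (X <= _)%N](cardUI) /=.
  rewrite [X in (_ + X)%N]eq_card0 ?addn0; last first.
    by move=> i; rewrite !inE; case: (ltgtP a (y i)) => //; rewrite ?andbF.
  apply/subset_leq_card/fintype.subsetP => i; rewrite !inE => /orP[/andP[_ ->]//|].
  by move=> /lt_trans; apply.
(* Points equal to [a] are counted neither in [N] nor in [c a]; subtracting at the next grid point
   avoids them. *)
have N_dn : c b - c (grid M a + M%:R^-1) <= N.
  rewrite lerBlDr -natrD ler_nat -[X in (_ <= X)%N](cardUI) /=.
  apply: (leq_trans _ (leq_addr _ _)).
  apply/subset_leq_card/fintype.subsetP => i; rewrite !inE => ->; rewrite andbT.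
  by case: (ltP a (y i)) => //= ya; exact: le_lt_trans ga'.
have posb : (gridpos M b <= M)%N.
  have e : gridpos M (1 : R) = M by rewrite /gridpos mulr1 natrK.
  by rewrite -[X in (_ <= X)%N]e; exact: gridpos_le.
have posa : (gridpos M a < M)%N by rewrite gridpos_lt// a0 (lt_le_trans ab).
have u1 : c b <= n%:R * (grid M b + M%:R^-1) + delta * n%:R.
  by apply: le_trans (c_le _ _ (ltW gb')) _; rewrite /grid -S; exact: c_up.
have u2 : n%:R * grid M a - delta * n%:R <= c a.
  by apply: le_trans (c_le _ _ ga); apply: c_dn; exact: ltnW.
have u3 : n%:R * grid M b - delta * n%:R <= c b.
  by apply: le_trans (c_le _ _ gb); exact: c_dn.
have u4 : c (grid M a + M%:R^-1) <= n%:R * (grid M a + M%:R^-1) + delta * n%:R.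
  by rewrite /grid -S; exact: c_up.
rewrite -/N.
have -> : N / n%:R - (grid M b - grid M a) = (N - n%:R * (grid M b - grid M a)) / n%:R.
  by rewrite mulrBl [n%:R * _]mulrC mulfK// gt_eqF.
rewrite normrM (@gtr0_norm _ n%:R^-1) ?invr_gt0// ler_pdivrMr//.
move: (M%:R^-1) u1 u2 u3 u4 N_up N_dn {S gb' ga' c_dn c_up Hc} => u *.
by rewrite ler_norml; apply/andP; split; lra.
Qed.

End grid.

Section permuton.
Context {R : realType} (mu : probability (R * R)%type R).
Hypothesis mu_permuton : permuton mu.

Let mI : measurable (`[0%R, 1%R]%classic : set R).
Proof. exact: measurable_itv. Qed.

Lemma pr_permuton_unit (A : set (R * R)) : measurable A ->
  pr mu A = pr mu (A `&` (`[0%R, 1%R] `*` `[0%R, 1%R])).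
Proof.
move=> mA; have mQ : measurable ((`[0%R, 1%R] `*` `[0%R, 1%R]) : set (R * R)) by exact: measurableX.
apply/eqP; rewrite eq_le; apply/andP; split; last first.
  by apply: pr_le => //; exact: measurableI.
have /(pr_setU_le mu)h := measurableI _ _ mA mQ.
have := h _ (measurableC mQ); rewrite pr_setC//.
have -> : pr mu (`[0%R, 1%R] `*` `[0%R, 1%R]) = 1 by rewrite /pr mu_permuton.1.
rewrite subrr addr0; apply: le_trans; apply: pr_le => //.
  by apply: measurableU; [exact: measurableI|exact: measurableC].
by move=> p Ap; have [Qp|nQ] := pselect ((`[0%R, 1%R] `*` `[0%R, 1%R]) p); [left|right].
Qed.

Lemma pr_permuton_fst (A : set R) : measurable A -> A `<=` `[0%R, 1%R] ->
  pr mu (A `*` setT) = fine (lebesgue_measure A).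
Proof.
move=> mA A01; rewrite pr_permuton_unit; last exact: measurableX.
rewrite -setXI setTI setIidl// /pr.
by have [-> _] := mu_permuton.2 A mA A01.
Qed.

Lemma pr_permuton_snd (A : set R) : measurable A -> A `<=` `[0%R, 1%R] ->
  pr mu (setT `*` A) = fine (lebesgue_measure A).
Proof.
move=> mA A01; rewrite pr_permuton_unit; last exact: measurableX.
rewrite -setXI setTI setIidl// /pr.
by have [_ ->] := mu_permuton.2 A mA A01.
Qed.

Lemma lebesgue_itv_fine (i : interval R) (a b : R) (bl br : bool) :
  i = Interval (BSide bl a) (BSide br b) -> a <= b ->
  fine (lebesgue_measure [set` i]) = b - a.
Proof.
move=> -> ab; rewrite lebesgue_measure_itv /= lte_fin; case: ltP => //= ba.
by have -> : a = b; [apply/eqP; rewrite eq_le ab ba|rewrite subrr].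
Qed.

Lemma pr_permuton_itv_fst (a b : R) (bl br : bool) : 0 <= a -> a <= b -> b <= 1 ->
  pr mu ([set` Interval (BSide bl a) (BSide br b)] `*` setT) = b - a.
Proof.
move=> a0 ab b1; rewrite pr_permuton_fst; last 2 first.
- exact: measurable_itv.
- move=> x; rewrite /= !itv_boundlr /= => /andP[+ +]; rewrite /Order.le /=.
  by case: (bl) (br) => [] [] /=; rewrite ?in_itv /= => ? ?; apply/andP; split; lra.
exact: (@lebesgue_itv_fine _ a b bl br).
Qed.

Lemma pr_permuton_itv_snd (a b : R) (bl br : bool) : 0 <= a -> a <= b -> b <= 1 ->
  pr mu (setT `*` [set` Interval (BSide bl a) (BSide br b)]) = b - a.
Proof.
move=> a0 ab b1; rewrite pr_permuton_snd; last 2 first.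
- exact: measurable_itv.
- move=> x; rewrite /= !itv_boundlr /= => /andP[+ +]; rewrite /Order.le /=.
  by case: (bl) (br) => [] [] /=; rewrite ?in_itv /= => ? ?; apply/andP; split; lra.
exact: (@lebesgue_itv_fine _ a b bl br).
Qed.

Lemma pr_permuton_square (bl br : bool) :
  pr mu (~` ([set` Interval (BSide bl 0%R) (BSide br 1%R)] `*`
             [set` Interval (BSide bl 0%R) (BSide br 1%R)])) = 0.
Proof.
have h1 := pr_permuton_itv_fst bl br (lexx 0) ler01 (lexx 1).
have h2 := pr_permuton_itv_snd bl br (lexx 0) ler01 (lexx 1).
set Q : set R := [set` _] in h1 h2 *.
have mQ : measurable Q by exact: measurable_itv.
have m1 : measurable (Q `*` setT : set (R * R)) by exact: measurableX.
have m2 : measurable (setT `*` Q : set (R * R)) by exact: measurableX.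
have h := pr_setU_le mu (measurableC m1) (measurableC m2).
rewrite !pr_setC// h1 h2 subr0 !subrr addr0 in h.
apply/eqP; rewrite eq_le pr_ge0 andbT; apply: le_trans h; apply: pr_le.
- by apply: measurableC; exact: measurableX.
- by apply: measurableU; exact: measurableC.
- move=> [x y] nxy; apply: contrapT => /not_orP[/contrapT[/= xx _] /contrapT[/= _ yy]].
  exact: nxy.
Qed.

End permuton.

(** * From weak convergence of strips to masses of cells *)

Section strip_limit.
Context {R : realType}.

Lemma at_right0 (Q : R -> Prop) : (\forall x \near 0^'+, Q x) ->
  exists2 e, 0 < e & forall x, 0 < x -> x < e -> Q x.
Proof.
move=> /nbhs_ballP[e /= e0 H]; exists e => // x x0 xe; apply: H => //=.
by rewrite /ball /= sub0r normrN gtr0_norm.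
Qed.

(** A continuous minorant of the indicator of [[s, t[], with a slope of width [k] at each end. *)
Definition trapezoid (s t k y : R) : R :=
  Num.min 1 (Num.max 0 (Num.min ((y - s) / k) ((t - y) / k))).

Lemma trapezoid_continuous s t k : continuous (trapezoid s t k).
Proof.
have c1 : continuous (fun y : R => (y - s) / k).
  by move=> y; apply: cvgMl; apply: cvgB; [exact: cvg_id|exact: cvg_cst].
have c2 : continuous (fun y : R => (t - y) / k).
  by move=> y; apply: cvgMl; apply: cvgB; [exact: cvg_cst|exact: cvg_id].
have c3 := min_fun_continuous c1 c2.
have c4 := max_fun_continuous (@cst_continuous R R 0) c3.
exact: (min_fun_continuous (@cst_continuous R R 1) c4).
Qed.

Lemma trapezoid_itv s t k y : 0 <= trapezoid s t k y <= 1.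
Proof.
rewrite /trapezoid ge_min lexx andbT le_min ler01 /=.
by rewrite le_max lexx.
Qed.

Lemma trapezoid_out s t k y : 0 < k -> ~~ (s < y < t) -> trapezoid s t k y = 0.
Proof.
move=> k0 h; rewrite /trapezoid; set u := Num.min ((y - s) / k) _.
have u0 : u <= 0.
  rewrite /u ge_min !pmulr_lle0 ?invr_gt0// !subr_le0.
  by move: h; rewrite negb_and -!leNgt.
by rewrite max_l// min_r.
Qed.

Lemma trapezoid_in s t k y : 0 < k -> s + k <= y -> y <= t - k -> trapezoid s t k y = 1.
Proof.
move=> k0 sy yt; rewrite /trapezoid min_l//.
by rewrite le_max le_min !ler_pdivlMr// !mul1r; apply/orP; right; apply/andP; split; lra.
Qed.

Context (mu : probability (R * R)%type R) (mu0 : probability R R).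
Hypothesis mu_permuton : permuton mu.
Hypothesis mu0_unit : on_unit mu0.
Hypothesis mu0_atomless : atomless mu0.
Hypothesis mu_strip : strip_cvg mu mu0.

(** The trapezoid lies below the indicator, and [mu0] has little mass on its slopes since it has no
    atom at [s] or [t]. Upper bounds will come from complements, in [strip_gridcell]. *)
Lemma strip_lower (s t eta : R) : 0 <= s -> s < t -> t <= 1 -> 0 < eta ->
  \forall x \near 0^'+,
    x * (pr mu0 `[s, t[%classic - eta) <= pr mu (`[0%R, x] `*` `[s, t[).
Proof.
move=> s0 st t1 eta0.
(* Two neighbourhoods of mass at most [eta / 3] leave room for a strict inequality. *)
have [k0 k00 Hk] := atomless_small mu0_atomless (divr_gt0 eta0 (ltr0n R 3)).
have [k kgt [kk0 kst]] : exists2 k, 0 < k & k < k0 /\ k < (t - s) / 2.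
  exists (Num.min k0 ((t - s) / 2) / 2).
    by rewrite divr_gt0// lt_min k00 divr_gt0// subr_gt0.
  have h : Num.min k0 ((t - s) / 2) / 2 < Num.min k0 ((t - s) / 2).
    have : 0 < Num.min k0 ((t - s) / 2) by rewrite lt_min k00 divr_gt0// subr_gt0.
    lra.
  by split; apply: lt_le_trans h _; rewrite ge_min lexx ?orbT.
pose g := trapezoid s t k.
have mI : measurable (`[0%R, 1%R]%classic : set R) by exact: measurable_itv.
have mg : measurable_fun (`[0%R, 1%R]%classic : set R) g.
  apply: measurable_funTS.
  by apply: continuous_measurable_fun; exact: trapezoid_continuous.
have g0 y : 0 <= g y by have /andP[] := trapezoid_itv s t k y.
have g1 y : g y <= 1 by have /andP[] := trapezoid_itv s t k y.
have lowJ : ((pr mu0 `[s, t[%classic - eta)%:E < \int[mu0]_(y in `[0%R, 1%R]) (g y)%:E)%E.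
  apply: (@lt_le_trans _ _ (\int[mu0]_(y in `[(s + k)%R, (t - k)%R]) (g y)%:E)%E); last first.
    apply: ge0_subset_integral => //.
    - exact/measurable_EFinP.
    - by move=> y _; rewrite lee_fin.
    by move=> y; rewrite /= !in_itv /= => /andP[? ?]; apply/andP; split; lra.
  rewrite (eq_integral (cst 1%E)); last first.
    move=> y; rewrite inE /= in_itv /= => /andP[? ?].
    by congr _%:E; apply: trapezoid_in.
  rewrite integral_cst// mul1e.
  have E := prE mu0 (measurable_itv `[(s + k), (t - k)]).
  rewrite -[X in (_ < X)%E]/(mu0 `[(s + k), (t - k)]%classic) E lte_fin ltrBlDr.
  have h1 := Hk s; have h2 := Hk t.
  have {}h1 : pr mu0 `](s - k0), (s + k0)[%classic <= eta / 3 by apply: h1; lra.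
  have {}h2 : pr mu0 `](t - k0), (t + k0)[%classic <= eta / 3 by apply: h2; lra.
  have mU := @measurableU _ R _ _ (measurable_itv `](s - k0), (s + k0)[)
     (measurable_itv `](t - k0), (t + k0)[).
  have h3 := pr_setU_le mu0 (measurable_itv `](s - k0), (s + k0)[)
     (measurable_itv `](t - k0), (t + k0)[).
  have h4 := pr_setU_le mu0 (measurable_itv `[(s + k), (t - k)]) mU.
  have : pr mu0 `[s, t[%classic <= pr mu0 (`[(s + k), (t - k)] `|`
     (`](s - k0), (s + k0)[ `|` `](t - k0), (t + k0)[)).
    apply: pr_le => //; first exact: measurableU.
    move=> y; rewrite /= !in_itv /= => /andP[sy yt].
    have [ys|ys] := ltP y (s + k); first by right; left; apply/andP; split; lra.
    have [yt'|yt'] := leP y (t - k); first by left.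
    by right; right; apply/andP; split; lra.
  lra.
have := mu_strip (continuous_subspaceT (@trapezoid_continuous s t k)).
have : nbhs (\int[mu0]_(y in `[0%R, 1%R]) (g y)%:E)%E
    [set z | ((pr mu0 `[s, t[%classic - eta)%:E < z)%E].
  by apply: open_nbhs_nbhs; split => //; exact: open_ereal_gt_ereal.
move=> /[swap] /[apply]; rewrite nbhs_filterE /= => cv.
near=> x.
have x0 : 0 < x by [].
have : ((pr mu0 `[s, t[%classic - eta)%:E < \int[strip mu x]_(y in `[0%R, 1%R]) (g y)%:E)%E.
  by near: x; exact: cv.
move=> /ltW h.
have mst : measurable (`[0%R, x]%classic `*` `[s, t[%classic : set (R * R)) by exact: measurableX.
have : (\int[strip mu x]_(y in `[0%R, 1%R]) (g y)%:E <= strip mu x `[s, t[%classic)%E.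
  apply: (@le_trans _ _ (\int[strip mu x]_(y in `[0%R, 1%R]) (\1_(`[s, t[%classic : set R) y)%:E)%E).
    apply: ge0_le_integral => //.
    - by move=> y _; rewrite lee_fin.
    - exact/measurable_EFinP.
    - by apply/measurable_EFinP; apply: measurable_funTS; exact: measurable_indic.
    - move=> y _; rewrite lee_fin.
      have [sty|nst] := pselect (`[s, t[%classic y); first by rewrite indic1.
      rewrite /g trapezoid_out ?indic_ge0//; apply/negP => /andP[sy yt].
      by apply: nst; rewrite /= in_itv /= (ltW sy).
  rewrite integral_indic//; apply: le_measure; rewrite ?inE//.
  by apply: measurableI => //; exact: measurable_itv.
move=> /(le_trans h); rewrite /strip (gtr0_norm x0) (prE mu mst) -EFinM lee_fin.
by rewrite mulrC ler_pdivlMr// mulrC.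
Unshelve. all: by end_near. Qed.

(** The cells have total mass at most [x] in the strip and at least 1 under [mu0], so lower bounds
    on all other cells give the upper bound on one. Their errors accumulate over the [M] cells,
    whence [e = eta / M]. *)
Lemma strip_gridcell (M : nat) (eta : R) : (0 < M)%N -> 0 < eta ->
  exists2 x0, 0 < x0 & forall x, 0 < x -> x < x0 -> forall j, (j < M)%N ->
    `|pr mu (`[0%R, x] `*` gridcell M j) - x * pr mu0 (gridcell M j)| <= eta * x.
Proof.
move=> M0 eta0; have M0R : 0 < M%:R :> R by rewrite ltr0n.
pose e := eta / M%:R; have e0 : 0 < e by rewrite divr_gt0.
have eM : e * M%:R = eta by rewrite /e divfK// gt_eqF.
have le1 (j : nat) : (j <= M)%N -> (j%:R / M%:R : R) <= 1.
  by move=> jM; rewrite ler_pdivrMr// mul1r ler_nat.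
have low : \forall x \near 0^'+, forall j : 'I_M,
    x * (pr mu0 (gridcell M j) - e) <= pr mu (`[0%R, x] `*` gridcell M j).
  apply: filter_forall => j; apply: strip_lower => //.
  - by rewrite ltr_pM2r ?invr_gt0// ltr_nat.
  - exact: le1.
have [x1 x10 H] := at_right0 low.
exists (Num.min x1 1); first by rewrite lt_min x10 ltr01.
move=> x x0; rewrite lt_min => /andP[/(H x x0) {}H xlt1] j jM.
have sum_mu : \sum_(k < M) pr mu (`[0%R, x] `*` gridcell M k) <= x.
  have xE : pr mu (`[0%R, x] `*` setT) = x.
    by rewrite (pr_permuton_itv_fst mu_permuton) ?subr0 ?lexx// ltW.
  rewrite -[leRHS]xE; apply: sum_pr_le.
  - by move=> k; apply: measurableX => //; exact: measurable_gridcell.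
  - move=> p k l _ _ [_ /(gridcellP M0) kp] [_ /(gridcellP M0) lp].
    by apply: val_inj; rewrite /= -kp -lp.
  - exact: measurableX.
  - by move=> k p _ [].
have sum_mu0 : 1 <= \sum_(k < M) pr mu0 (gridcell M k).
  have mI : measurable (`[0%R, 1%R[%classic : set R) by exact: measurable_itv.
  apply: (@le_trans _ _ (pr mu0 `[0%R, 1%R[%classic)).
    have n1 : pr mu0 [set (1 : R)] = 0 by rewrite /pr mu0_atomless.
    have h := pr_setU_le mu0 mI (measurable_set1 (1 : R)); rewrite n1 addr0 in h.
    apply: (@le_trans _ _ (pr mu0 `[0%R, 1%R]%classic)); first by rewrite /pr mu0_unit.
    apply: le_trans h.
    apply: pr_le => //; first exact: measurableU.
    move=> y; rewrite /= !in_itv /= => /andP[-> y1] /=.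
    by move: y1; rewrite le_eqVlt => /orP[/eqP|]; [right|left].
  apply: pr_bigU => //; first by move=> k; exact: measurable_gridcell.
  move=> y; rewrite /= in_itv /= => /andP[y0 y1].
  have yM : (gridpos M y < M)%N by rewrite gridpos_lt// y0.
  by exists (Ordinal yM) => //; exact: gridcell_pos.
have Hj := H (Ordinal jM); rewrite /= in Hj.
have rest : \sum_(k < M | k != Ordinal jM) x * (pr mu0 (gridcell M k) - e) <=
    \sum_(k < M | k != Ordinal jM) pr mu (`[0%R, x] `*` gridcell M k).
  by apply: ler_sum => k _; exact: H.
have eqx : \sum_(k < M) x * (pr mu0 (gridcell M k) - e) =
    x * (\sum_(k < M) pr mu0 (gridcell M k)) - x * eta.
  by rewrite -mulr_sumr sumrB sumr_const card_ord -[e *+ M]mulr_natr eM mulrBr.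
rewrite (bigD1 (Ordinal jM))//= in eqx; rewrite (bigD1 (Ordinal jM))//= in sum_mu.
have xe0 : 0 <= x * e by rewrite mulr_ge0// ltW.
have xe : x * e <= eta * x.
  have eeta : e <= eta by rewrite -[leRHS]eM ler_peMr ?ler1n// ltW.
  by rewrite mulrC ler_wpM2r// ltW.
have x1' : x <= x * (\sum_(k < M) pr mu0 (gridcell M k)) by rewrite ler_peMr// ltW.
by rewrite ler_norml; apply/andP; split; lra.
Qed.

End strip_limit.

(** * The types of the leftmost points *)

Section firsts.
Context (n L K : nat).
Implicit Types c : {ffun 'I_n -> 'I_L.+1}.

(* [c] assigns to each point one of [L] narrow cells, numbered from left to
   right, or the value [L] standing for the rest of the square. *)
Definition inside c (i : 'I_n) : bool := (c i < L)%N.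

Definition by_cell c : seq 'I_n :=
  sort (fun i j => c i <= c j)%N [seq i <- enum 'I_n | inside c i].

Definition firsts c : seq 'I_n := take K (by_cell c).

(** The condition under which cells alone determine the [K] leftmost points and their order. Several
    points may have the value [L]. *)
Definition good c : bool :=
  (K <= #|[pred i | inside c i]|)%N &&
  [forall i, forall j, (c i == c j) && inside c i ==> (i == j)].

Lemma firsts_uniq c : uniq (firsts c).
Proof. by rewrite take_uniq// sort_uniq filter_uniq// enum_uniq. Qed.

Lemma size_firsts c : good c -> size (firsts c) = K.
Proof.
move=> /andP[Kc _]; rewrite size_takel// size_sort.
rewrite size_filter -sum1_count big_enum_cond /=.
by rewrite -sum1_card in Kc.
Qed.

Lemma by_cell_sorted c : good c -> pairwise (fun i j => c i < c j)%N (by_cell c).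
Proof.
move=> /andP[_ /forallP inj].
have : pairwise (fun i j => c i <= c j)%N (by_cell c).
  rewrite -sorted_pairwise; last by move=> ? ? ?; exact: leq_trans.
  by apply: sort_sorted => i j; exact: leq_total.
have u : uniq (by_cell c) by rewrite sort_uniq filter_uniq// enum_uniq.
have ins i : i \in by_cell c -> inside c i by rewrite mem_sort mem_filter => /andP[].
elim: (by_cell c) u ins => //= i s IH /andP[is_ us] ins /andP[/allP ci ps].
rewrite IH ?andbT//; last by move=> j js; apply: ins; rewrite inE js orbT.
apply/allP => j js; rewrite ltn_neqAle ci// andbT; apply/negP => e.
have /forallP/(_ j)/implyP := inj i; rewrite ins ?mem_head// andbT => /(_ e) /eqP ij.
by rewrite ij js in is_.
Qed.

Lemma firsts_sorted c : good c -> pairwise (fun i j => c i < c j)%N (firsts c).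
Proof.
by move=> /by_cell_sorted; rewrite -{1}(cat_take_drop K (by_cell c)) pairwise_cat => /and3P[].
Qed.

Lemma firsts_gap c i j : good c -> i \notin firsts c -> j \in firsts c -> (c j < c i)%N.
Proof.
move=> gc ni jf.
have jL : inside c j.
  by move: (mem_take jf); rewrite mem_sort mem_filter => /andP[].
have [ii|ni'] := boolP (inside c i); last first.
  by apply: leq_trans jL _; rewrite leqNgt.
have : i \in drop K (by_cell c).
  have : i \in by_cell c by rewrite mem_sort mem_filter ii mem_enum.
  by rewrite -{1}(cat_take_drop K (by_cell c)) mem_cat (negPf ni).
move: (by_cell_sorted gc); rewrite -{1}(cat_take_drop K (by_cell c)) pairwise_cat.
by move=> /and3P[/allrelP h _ _] id; apply: h.
Qed.

End firsts.

Section leftmost_types.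
Context {R : realType} (mu : probability (R * R)%type R).
Context d (T : measurableType d) (P : probability T R) (n : nat).
Context (Z : 'I_n -> {RV P >-> (R * R)%type}).
Hypothesis Z_iid : iid Z mu.
Context (L K M : nat) (X : 'I_L.+1 -> set R) (C : 'I_M -> set R) (r : 'I_M -> R).
Hypothesis mX : forall l, measurable (X l).
Hypothesis mC : forall j, measurable (C j).
Hypothesis X_lt : forall (l l' : 'I_L.+1) x x', (l < l')%N -> X l x -> X l' x' -> x < x'.
Hypothesis r0 : forall j, 0 <= r j.
Hypothesis XC : forall (l : 'I_L.+1) j, (l < L)%N ->
  pr mu (X l `*` setT) * r j <= pr mu (X l `*` C j).

(** The intersection has at most one factor. For a good [c], it is [C (a k)] if [i] is the [k]-th
    point of [firsts K c], and everything if [i] is not in that list, as its index is then [K]. *)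
Definition typed_box (c : {ffun 'I_n -> 'I_L.+1}) (a : {ffun 'I_K -> 'I_M}) (i : 'I_n) : set (R * R) :=
  X (c i) `*` \bigcap_(k in [set k : 'I_K | index i (firsts K c) = k]) C (a k).

Definition leftmost_event (a : {ffun 'I_K -> 'I_M}) : set T :=
  \bigcup_(c in [set c | good K c]) cylinder Z (enum 'I_n) (typed_box c a).

Lemma measurable_typed_box c a i : measurable (typed_box c a i).
Proof.
by apply: measurableX => //; apply: fin_bigcap_measurable => //; exact: finite_finset.
Qed.

Lemma measurable_leftmost_event a : measurable (leftmost_event a).
Proof.
apply: fin_bigcup_measurable; first exact: finite_finset.
by move=> c _; apply: measurable_cylinder; exact: measurable_typed_box.
Qed.

Let cells (c : {ffun 'I_n -> 'I_L.+1}) := cylinder Z (enum 'I_n) (fun i => X (c i) `*` setT).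

Lemma X_inj l l' x : X l x -> X l' x -> l = l'.
Proof.
move=> Xl Xl'; apply: val_inj => /=.
by case: (ltngtP l l') => // lt; [have := X_lt lt Xl Xl'|have := X_lt lt Xl' Xl]; rewrite ltxx.
Qed.

Lemma cells_inj w c c' : cells c w -> cells c' w -> c = c'.
Proof.
move=> cw cw'; apply/ffunP => i.
have [h _] := cw i (mem_enum _ i); have [h' _] := cw' i (mem_enum _ i).
exact: X_inj h h'.
Qed.

Lemma typed_box_cells c a : cylinder Z (enum 'I_n) (typed_box c a) `<=` cells c.
Proof. by move=> w h i /h[]. Qed.

(** Each rank is held by exactly one point, so exchanging the products leaves one factor per
    rank. *)
Lemma prod_firsts (c : {ffun 'I_n -> 'I_L.+1}) (a : {ffun 'I_K -> 'I_M}) : good K c ->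
  \prod_i \prod_(k < K | index i (firsts K c) == k) r (a k) = \prod_k r (a k).
Proof.
move=> gc; rewrite (exchange_big_dep predT)//=; apply: eq_bigr => k _.
have kf : (k < size (firsts K c))%N by rewrite size_firsts.
have [i0 _] : exists i0 : 'I_n, True.
  by case: (firsts K c) kf => // i *; exists i.
rewrite (big_pred1 (nth i0 (firsts K c) k))// => i /=.
apply/eqP/eqP => [e|->]; last by rewrite index_uniq// firsts_uniq.
by rewrite -e nth_index// -index_mem e.
Qed.

Lemma typed_box_ge c (a : {ffun 'I_K -> 'I_M}) i : good K c ->
  pr mu (X (c i) `*` setT) * \prod_(k < K | index i (firsts K c) == k) r (a k) <=
  pr mu (typed_box c a i).
Proof.
move=> gc; have [fi|nfi] := boolP (i \in firsts K c); last first.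
  have ni (k : 'I_K) : (index i (firsts K c) == k) = false.
    apply/negP => /eqP e; move: nfi; rewrite -index_mem e size_firsts//.
    by rewrite ltn_ord.
  rewrite big_pred0// mulr1 /typed_box.
  rewrite (_ : \bigcap_(k in _) _ = setT) ?lexx//.
  by apply/seteqP; split=> // y _ k /= /eqP; rewrite ni.
have iK : (index i (firsts K c) < K)%N by rewrite -[X in (_ < X)%N](size_firsts gc) index_mem.
have -> : typed_box c a i = X (c i) `*` C (a (Ordinal iK)).
  rewrite /typed_box; congr (_ `*` _); apply/seteqP; split=> y.
    by move=> h; apply: h.
  move=> h k /= e; have -> : k = Ordinal iK by apply: val_inj; rewrite /= -e.
  by [].
rewrite (big_pred1 (Ordinal iK)) => [|k /=]; last first.
  by apply/eqP/eqP => [e|->//]; apply: val_inj; rewrite /= e.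
apply: XC; move: (mem_take fi); rewrite mem_sort mem_filter => /andP[+ _].
by [].
Qed.

(** For each good [c], independence and [XC] bound the typed box below by the cells of [c] times the
    product of the [r (a k)]. That product does not depend on [c], so summing over [c] leaves the
    probability of a good assignment. *)
Lemma pr_leftmost_event (a : {ffun 'I_K -> 'I_M}) (N : set T) :
  measurable N ->
  (forall w, ~ N w -> exists2 c : {ffun 'I_n -> 'I_L.+1}, good K c & forall i, X (c i) (Z i w).1) ->
  (1 - pr P N) * \prod_k r (a k) <= pr P (leftmost_event a).
Proof.
move=> mN cover.
have mcells c : measurable (cells c).
  by apply: measurable_cylinder => i; apply: measurableX.
have mass : 1 - pr P N <= \sum_(c | good K c) pr P (cells c).
  rewrite -pr_setC//; apply: pr_bigU => //; first exact: measurableC.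
  by move=> w /cover[c gc h]; exists c => // i _; split => //; exact: h.
have pr0 : 0 <= \prod_k r (a k) by apply: prodr_ge0.
apply: (le_trans (ler_wpM2r pr0 mass)); rewrite mulr_suml.
apply: (@le_trans _ _ (\sum_(c | good K c) pr P (cylinder Z (enum 'I_n) (typed_box c a)))).
  apply: ler_sum => c gc; rewrite -(prod_firsts a gc).
  rewrite !(pr_cylinder Z_iid) ?enum_uniq//; last 2 first.
  - by move=> i; apply: measurableX.
  - by move=> i; exact: measurable_typed_box.
  rewrite !big_enum /= -big_split /=; apply: ler_prod => i _.
  rewrite typed_box_ge// andbT mulr_ge0 ?pr_ge0//; apply: prodr_ge0 => k _; exact: r0.
apply: sum_pr_le.
- by move=> c; apply: measurable_cylinder; exact: measurable_typed_box.
- by move=> w c c' _ _ /typed_box_cells cw /typed_box_cells cw'; exact: cells_inj cw cw'.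
- exact: measurable_leftmost_event.
- by move=> c w gc cw; exists c.
Qed.

Lemma leftmost_event_inj w a b : (forall y i j, C i y -> C j y -> i = j) ->
  leftmost_event a w -> leftmost_event b w -> a = b.
Proof.
move=> C_inj [c gc cw] [c' gc' cw'].
have ec := cells_inj (typed_box_cells cw) (typed_box_cells cw'); rewrite -{}ec in cw'.
apply/ffunP => k; have kf : (k < size (firsts K c))%N by rewrite size_firsts.
have [i0 _] : exists i0 : 'I_n, True by case: (firsts K c) kf => // i *; exists i.
have ik : index (nth i0 (firsts K c) k) (firsts K c) = k.
  by rewrite index_uniq// firsts_uniq.
have [_ /= /(_ k ik) h] := cw (nth i0 (firsts K c) k) (mem_enum _ _).
have [_ /= /(_ k ik) h'] := cw' (nth i0 (firsts K c) k) (mem_enum _ _).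
exact: C_inj h h'.
Qed.

(* The [K] leftmost points, listed from left to right, have types [a]. *)
Lemma leftmost_eventP a w : leftmost_event a w ->
  exists idx : seq 'I_n,
    [/\ size idx = K,
        sorted (fun i j => (Z i w).1 < (Z j w).1) idx,
        forall i j, i \notin idx -> j \in idx -> (Z j w).1 < (Z i w).1
      & forall i0 (k : 'I_K), C (a k) (Z (nth i0 idx k) w).2].
Proof.
move=> [c gc cw]; exists (firsts K c).
have Xc i : X (c i) (Z i w).1 by have [] := cw i (mem_enum _ i).
split.
- exact: size_firsts.
- apply: pairwise_sorted; apply: sub_pairwise (firsts_sorted gc) => i j cij.
  exact: X_lt cij (Xc i) (Xc j).
- by move=> i j ni jf; apply: X_lt (firsts_gap gc ni jf) (Xc j) (Xc i).
- move=> i0 k; have [_ /=] := cw (nth i0 (firsts K c) k) (mem_enum _ _).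
  by apply; rewrite /= index_uniq ?size_firsts// firsts_uniq.
Qed.

End leftmost_types.

Section leftmost_types_strip.
Context {R : realType} (mu : probability (R * R)%type R) (mu0 : probability R R).
Hypothesis mu_permuton : permuton mu.
Hypothesis mu0_unit : on_unit mu0.
Hypothesis mu0_atomless : atomless mu0.
Hypothesis mu_strip : strip_cvg mu mu0.

Definition strip_cell (L : nat) (h : R) (l : 'I_L.+1) : set R :=
  if (l < L)%N then `[(l%:R * h), (l.+1%:R * h)[%classic else `[(L%:R * h), 1%R[%classic.

Lemma measurable_strip_cell L h l : measurable (@strip_cell L h l).
Proof. by rewrite /strip_cell; case: ifP => _; exact: measurable_itv. Qed.

Lemma strip_cell_lt L h (l l' : 'I_L.+1) x x' : 0 < h -> (l < l')%N ->
  strip_cell h l x -> strip_cell h l' x' -> x < x'.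
Proof.
move=> h0 ll'; have lL : (l < L)%N by rewrite (leq_trans ll')// -ltnS.
rewrite /strip_cell lL /= in_itv /= => /andP[_ xl].
have le1 (k : nat) : (l < k)%N -> l.+1%:R * h <= k%:R * h by move=> lk; rewrite ler_wpM2r ?ler_nat// ltW.
case: ifP => _; rewrite /= in_itv /= => /andP[lx _]; apply: lt_le_trans xl (le_trans _ lx).
  exact: le1.
exact: le1.
Qed.

Lemma strip_cell_cover L h x : 0 < h -> 0 <= x < 1 -> exists l, @strip_cell L h l x.
Proof.
move=> h0 /andP[x0 x1]; have [xL|Lx] := ltP x (L%:R * h); last first.
  by exists ord_max; rewrite /strip_cell ltnn /= in_itv /= Lx.
have /truncn_itv/andP[h1 h2] : 0 <= x / h by rewrite divr_ge0// ltW.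
have tL : (Num.truncn (x / h) < L)%N.
  by rewrite -(ltr_nat R); apply: le_lt_trans h1 _; rewrite ltr_pdivrMr.
exists (Ordinal (ltnW tL : (_ < L.+1)%N)); rewrite /strip_cell /= tL /= in_itv /=.
by rewrite -ler_pdivlMr// h1 -ltr_pdivrMr.
Qed.

Lemma pr_strip_cell_fst L h (l : 'I_L.+1) : 0 < h -> L%:R * h <= 1 -> (l < L)%N ->
  pr mu (strip_cell h l `*` setT) = h.
Proof.
move=> h0 Lh lL; rewrite /strip_cell lL (pr_permuton_itv_fst mu_permuton).
- by rewrite -natr1; ring.
- by rewrite mulr_ge0// ltW.
- by rewrite ler_pM2r// ler_nat.
- by apply: le_trans Lh; rewrite ler_pM2r// ler_nat.
Qed.

(** A cell is the difference of two strips starting at 0, whose errors are proportional to their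
    widths [l h] and [(l + 1) h]. They sum to [e (2 l + 1) h], and [2 l + 1 <= 2 L] dictates [e]; so
    [L] is fixed before [h] tends to 0. *)
Lemma strip_cell_types L M (eta : R) : (0 < M)%N -> (0 < L)%N -> 0 < eta ->
  exists2 x0, 0 < x0 & forall h, 0 < h -> L%:R * h < x0 ->
    forall (l : 'I_L.+1) (j : 'I_M), (l < L)%N ->
    h * Num.max 0 (pr mu0 (gridcell M j) - eta) <= pr mu (strip_cell h l `*` gridcell M j).
Proof.
move=> M0 L0 eta0; have L0R : 0 < L%:R :> R by rewrite ltr0n.
pose e := eta / (2 * L%:R); have e0 : 0 < e by rewrite divr_gt0// mulr_gt0.
have eE : e * (2 * L%:R) = eta by rewrite /e divfK// gt_eqF// mulr_gt0.
have [x0 x00 H] := strip_gridcell mu_permuton mu0_unit mu0_atomless mu_strip M0 e0.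
exists (Num.min x0 1); first by rewrite lt_min x00 ltr01.
move=> h h0; rewrite lt_min => /andP[Lh Lh1] l j lL.
have [|] := leP 0 (pr mu0 (gridcell M j) - eta); last by rewrite mulr0 pr_ge0.
move=> _.
have lh0 : 0 <= l%:R * h by rewrite mulr_ge0// ltW.
have lh1 : l.+1%:R * h <= L%:R * h by rewrite ler_pM2r// ler_nat.
have Sh : l.+1%:R * h = l%:R * h + h by rewrite -natr1 mulrDl mul1r.
have mg := measurable_gridcell (R := R) M j.
have up : pr mu (`[0%R, (l%:R * h)] `*` gridcell M j) <=
    l%:R * h * pr mu0 (gridcell M j) + e * (l%:R * h).
  (* A strip of width 0 is out of reach of the limit, but it is null. *)
  have [l0|l0] := posnP (l : nat).
    rewrite l0 !mul0r mulr0 addr0.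
    apply: (@le_trans _ _ (pr mu (`[0%R, 0%R] `*` setT))).
      by apply: pr_le; [exact: measurableX|exact: measurableX|move=> p []].
    by rewrite (pr_permuton_itv_fst mu_permuton)// subrr.
  have lh0' : 0 < l%:R * h by rewrite mulr_gt0// ltr0n.
  have lx0 : l%:R * h < x0 by apply: le_lt_trans Lh; rewrite ler_pM2r// ler_nat ltnW.
  by have := H _ lh0' lx0 j (ltn_ord j); rewrite ler_norml => /andP[_]; lra.
have dn : l.+1%:R * h * pr mu0 (gridcell M j) - e * (l.+1%:R * h) <=
    pr mu (`[0%R, (l.+1%:R * h)] `*` gridcell M j).
  have lh0' : 0 < l.+1%:R * h by rewrite mulr_gt0.
  by have := H _ lh0' (le_lt_trans lh1 Lh) j (ltn_ord j); rewrite ler_norml => /andP[+ _]; lra.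
(* The strips are closed and the cells half-open; they differ by a null vertical segment. *)
have point : pr mu (`[(l.+1%:R * h), (l.+1%:R * h)] `*` setT) = 0.
  by rewrite (pr_permuton_itv_fst mu_permuton) ?subrr// ?Sh; lra.
have m1 : measurable (`[0%R, (l%:R * h)] `*` gridcell M j : set (R * R)) by exact: measurableX.
have m2 : measurable (strip_cell h l `*` gridcell M j : set (R * R)).
  by apply: measurableX => //; exact: measurable_strip_cell.
have m3 : measurable (`[(l.+1%:R * h), (l.+1%:R * h)] `*` setT : set (R * R)) by exact: measurableX.
have u1 := pr_setU_le mu m1 (measurableU _ _ m2 m3).
have u2 := pr_setU_le mu m2 m3.
have u3 : pr mu (`[0%R, (l.+1%:R * h)] `*` gridcell M j) <=
  pr mu ((`[0%R, (l%:R * h)] `*` gridcell M j) `|`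
    ((strip_cell h l `*` gridcell M j) `|` (`[(l.+1%:R * h), (l.+1%:R * h)] `*` setT))).
  apply: pr_le; [exact: measurableX|by apply: measurableU => //; exact: measurableU|].
  move=> [x y] [/=]; rewrite in_itv /= => /andP[x0' xl] gy.
  have [xh|xh] := leP x (l%:R * h); first by left; split => //=; rewrite in_itv /= x0'.
  have [xh'|xh'] := ltP x (l.+1%:R * h).
    by right; left; split => //=; rewrite /strip_cell lL /= in_itv /= xh' (ltW xh).
  by right; right; split => //=; rewrite in_itv /= xl xh'.
have : e * (2 * l%:R + 1) <= eta.
  rewrite -eE ler_pM2l//.
  have : l%:R + 1 <= L%:R :> R by rewrite natr1 ler_nat.
  have : 0 <= (l%:R : R) by [].
  lra.
move=> /(ler_wpM2r (ltW h0)).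
have {}dn : (l%:R * h + h) * pr mu0 (gridcell M j) - e * (l%:R * h + h) <=
    pr mu (`[0%R, (l.+1%:R * h)] `*` gridcell M j) by rewrite -Sh.
have := le_trans u3 (le_trans u1 (lerD (lexx _) u2)).
rewrite point addr0 => /(le_trans dn) {dn u1 u2 u3} ? ?; lra.
Qed.

Section bad_set.
Context d (T : measurableType d) (P : probability T R) (n : nat).
Context (Z : 'I_n -> {RV P >-> (R * R)%type}).
Hypothesis Z_iid : iid Z mu.

(** Three things can go wrong: a point outside the square, which is null; two points in one cell, at
    most [n ^+ 2] pairs times strip width times cell width; fewer than [K] points in the strip, a
    deviation of at least [t] from their mean number. *)
Lemma strip_good (L K : nat) (h t : R) : 0 < h -> L%:R * h <= 1 ->
  0 < t -> K%:R + t <= n%:R * (L%:R * h) ->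
  exists2 N : set T, measurable N /\
     pr P N <= n%:R ^+ 2 * (L%:R * h * h) + n%:R * (L%:R * h) / t ^+ 2 &
  forall w, ~ N w -> exists2 c : {ffun 'I_n -> 'I_L.+1}, good K c &
      forall i, strip_cell h (c i) (Z i w).1.
Proof.
move=> h0 Lh1 t0 Kt.
have Lh0 : 0 <= L%:R * h by rewrite mulr_ge0// ltW.
pose out : set (R * R) := ~` (`[0%R, 1%R[ `*` `[0%R, 1%R[).
have mout : measurable out by apply: measurableC; apply: measurableX; exact: measurable_itv.
pose N1 i := Z i @^-1` out.
pose C (l : 'I_L) : set (R * R) := strip_cell h (widen_ord (leqnSn L) l) `*` setT.
pose U2 := shared Z id C.
pose S : set (R * R) := `[0%R, (L%:R * h)[ `*` setT.
have mS : measurable S by apply: measurableX => //; exact: measurable_itv.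
pose cnt w := \sum_i \1_(Z i @^-1` S) w - n%:R * (L%:R * h).
pose N3 := [set w | t <= `|cnt w|].
have mZ i A : measurable A -> measurable (Z i @^-1` A) by exact: measurable_preimage.
have mbox l : measurable (strip_cell h l `*` setT : set (R * R)).
  by apply: measurableX => //; exact: measurable_strip_cell.
have mN1 i : measurable (N1 i) by exact: mZ.
have mN3 : measurable N3 by apply: measurable_count_deviation => i; exact: mZ.
pose U1 := \bigcup_i N1 i.
have mU1 : measurable U1 by apply: fin_bigcup_measurable => //; exact: finite_finset.
have mC l : measurable (C l) by exact: mbox.
have mU2 : measurable U2 by exact: measurable_shared.
have prS : pr mu S = L%:R * h by rewrite /S (pr_permuton_itv_fst mu_permuton)// subr0.
have pU1 : pr P U1 <= 0.
  apply: (@le_trans _ _ (\sum_i pr P (N1 i))).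
    by apply: pr_bigU => // w [i _ ?]; exists i.
  by rewrite big1// => i _; rewrite /N1 (pr_preimage Z_iid)// /out (pr_permuton_square mu_permuton).
have pU2 : pr P U2 <= n%:R ^+ 2 * (L%:R * h * h).
  rewrite -{1}prS; apply: (pr_shared Z_iid) => //.
  - move=> [x y] k l [/= Ck _] [/= Cl _]; apply: val_inj.
    have [kl|lk|//] := ltngtP k l.
      by have := strip_cell_lt h0 (kl : (widen_ord (leqnSn L) k < widen_ord (leqnSn L) l)%N) Ck Cl; rewrite ltxx.
    by have := strip_cell_lt h0 (lk : (widen_ord (leqnSn L) l < widen_ord (leqnSn L) k)%N) Cl Ck; rewrite ltxx.
  - exact: ltW.
  - move=> l [x y] [/= Cl _]; split => //=; move: Cl; rewrite /strip_cell /= ltn_ord /= !in_itv /=.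
    move=> /andP[lx xl]; apply/andP; split; first by apply: le_trans lx; rewrite mulr_ge0// ltW.
    by apply: lt_le_trans xl _; rewrite ler_pM2r// ler_nat.
  - by move=> l; rewrite /C pr_strip_cell_fst//=.
have pN3 : pr P N3 <= n%:R * (L%:R * h) / t ^+ 2.
  apply: (chebyshev_count (E := fun i => Z i @^-1` S)) => //.
  - by move=> i; exact: mZ.
  - by move=> i; rewrite (pr_preimage Z_iid).
  - by move=> i j ij; rewrite (pr_pair Z_iid)// prS.
exists (U1 `|` (U2 `|` N3)).
  split; first by apply: measurableU => //; exact: measurableU.
  have := pr_setU_le P mU1 (measurableU _ _ mU2 mN3).
  have := pr_setU_le P mU2 mN3.
  lra.
move=> w /not_orP[nU1 /not_orP[nU2 nN3]].
have x01 i : 0 <= (Z i w).1 < 1.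
  apply: contrapT => h'; apply: nU1; exists i => // -[/= + _]; rewrite in_itv /=; exact: h'.
have [c0 Hc] := choice (fun i => strip_cell_cover L h0 (x01 i)).
pose c : {ffun 'I_n -> 'I_L.+1} := [ffun i => c0 i].
have {}Hc i : strip_cell h (c i) (Z i w).1 by rewrite ffunE.
exists c => //.
have insE i : inside c i = (Z i w \in S).
  apply/idP/idP; rewrite inE.
    rewrite /inside => iL; split => //=; have := Hc i; rewrite /strip_cell iL /= !in_itv /=.
    move=> /andP[_ xl]; have /andP[-> _] := x01 i.
    by apply: lt_le_trans xl _; rewrite ler_pM2r// ler_nat.
  move=> [/= + _]; have := Hc i; rewrite /strip_cell /inside; case: ifP => // _.
  by rewrite /= !in_itv /= => /andP[Lx _] /andP[_]; rewrite ltNge Lx.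
apply/andP; split.
  rewrite -(ler_nat R).
  have <- : \sum_i \1_(Z i @^-1` S) w = #|[pred i | inside c i]|%:R :> R.
    by apply: sum_indic_card => i; rewrite /= insE inE.
  move: nN3; rewrite /N3 /cnt /= => /negP; rewrite -ltNge ltr_norml => /andP[+ _]; lra.
apply/forallP => i; apply/forallP => j; apply/implyP => /andP[/eqP cij ii].
apply/eqP; apply: contrapT => /eqP ij; apply: nU2; exists i, j, (Ordinal ii).
have e : widen_ord (leqnSn L) (Ordinal ii) = c i by exact: val_inj.
by rewrite /C e; split=> //; split=> //=; rewrite ?cij; exact: Hc.
Qed.

End bad_set.

(* In the strip of width [A / n] there are more than [K] points with high
   probability, and cells of width [A / (n L)] separate them. *)
Lemma pr_leftmost_types (K M : nat) (eta eps : R) : (0 < M)%N -> 0 < eta -> 0 < eps ->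
  exists n0 : nat, forall n, (n0 <= n)%N ->
  forall d (T : measurableType d) (P : probability T R) (Z : 'I_n -> {RV P >-> (R * R)%type}),
    iid Z mu ->
  exists E : {ffun 'I_K -> 'I_M} -> set T,
  [/\ forall a, measurable (E a),
      forall w a b, E a w -> E b w -> a = b,
      forall a : {ffun 'I_K -> 'I_M}, (1 - eps) * \prod_k Num.max 0 (pr mu0 (gridcell M (a k)) - eta) <= pr P (E a)
    & forall (a : {ffun 'I_K -> 'I_M}) w, E a w -> exists idx : seq 'I_n,
      [/\ size idx = K,
        sorted (fun i j => (Z i w).1 < (Z j w).1) idx,
        forall i j, i \notin idx -> j \in idx -> (Z j w).1 < (Z i w).1
      & forall i0 (k : 'I_K), gridcell M (a k) (Z (nth i0 idx k) w).2]].
Proof.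
move=> M0 eta0 eps0.
(* The strip contains [A] points on average. With [A >= 2 K] a deviation [t = A / 2] still leaves
   [K] of them, and [A > 8 / eps] bounds Chebyshev's [4 / A] by [eps / 2]. *)
have [A1 HA1] := natr_above (8 / eps); pose A := (2 * K + A1 + 1)%N.
have A0 : 0 < A%:R :> R by rewrite ltr0n /A addn1.
have A8 : 8 / eps < A%:R by apply: HA1; rewrite /A -addnA addnCA leq_addr.
(* The bound on ties becomes [A ^+ 2 / L], independent of [n]. *)
have [L1 HL1] := natr_above (2 * A%:R ^+ 2 / eps); pose L := (L1 + 1)%N.
have L0 : (0 < L)%N by rewrite /L addn1.
have L0R : 0 < L%:R :> R by rewrite ltr0n.
have LA : 2 * A%:R ^+ 2 / eps < L%:R by apply: HL1; rewrite /L leq_addr.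
have [x0 x00 H] := strip_cell_types M0 L0 eta0.
have [n1 Hn1] := natr_above (A%:R / x0); pose n0 := (n1 + A)%N.
exists n0 => n nn0 d T P Z Z_iid.
have nR : A%:R / x0 < n%:R by apply: Hn1; apply: leq_trans nn0; rewrite leq_addr.
have nA : A%:R <= n%:R :> R by rewrite ler_nat; apply: leq_trans nn0; rewrite leq_addl.
have n0R : 0 < n%:R :> R by exact: lt_le_trans nA.
pose h : R := A%:R / (n%:R * L%:R).
have h0 : 0 < h by rewrite divr_gt0// mulr_gt0.
have LhE : L%:R * h = A%:R / n%:R.
  by rewrite /h; field; rewrite !gt_eqF.
have Lh1 : L%:R * h <= 1 by rewrite LhE ler_pdivrMr// mul1r.
have Lhx0 : L%:R * h < x0 by rewrite LhE ltr_pdivrMr// mulrC -ltr_pdivrMr.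
pose t : R := A%:R / 2.
have t0 : 0 < t by rewrite divr_gt0.
have nLh : n%:R * (L%:R * h) = A%:R by rewrite LhE mulrC divfK// gt_eqF.
have Kt : K%:R + t <= n%:R * (L%:R * h).
  have : 2 * K%:R <= A%:R :> R by rewrite -natrM ler_nat /A -addnA leq_addr.
  by rewrite nLh /t; lra.
have [N [mN pN] cover] := strip_good Z_iid h0 Lh1 t0 Kt.
have {}pN : pr P N <= eps.
  apply: (le_trans pN); rewrite nLh.
  have -> : n%:R ^+ 2 * (L%:R * h * h) = A%:R ^+ 2 / L%:R.
    by rewrite /h; field; rewrite !gt_eqF.
  have -> : A%:R / t ^+ 2 = 4 / A%:R :> R by rewrite /t; field; rewrite gt_eqF.
  have u1 : A%:R ^+ 2 / L%:R <= eps / 2.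
    rewrite ler_pdivrMr//; move: LA; rewrite ltr_pdivrMr//; lra.
  have u2 : 4 / A%:R <= eps / 2.
    by rewrite ler_pdivrMr//; move: A8; rewrite ltr_pdivrMr//; lra.
  lra.
pose X := @strip_cell L h; pose C (j : 'I_M) := gridcell (R := R) M j.
pose r (j : 'I_M) := Num.max 0 (pr mu0 (gridcell M j) - eta).
have mX l : measurable (X l) by exact: measurable_strip_cell.
have mC j : measurable (C j) by exact: measurable_gridcell.
have Xlt (l l' : 'I_L.+1) x x' : (l < l')%N -> X l x -> X l' x' -> x < x' by exact: strip_cell_lt.
have r0 j : 0 <= r j by rewrite /r le_max lexx.
have XC (l : 'I_L.+1) j : (l < L)%N -> pr mu (X l `*` setT) * r j <= pr mu (X l `*` C j).
  by move=> lL; rewrite pr_strip_cell_fst//; exact: H.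
exists (leftmost_event Z X C); split.
- by move=> a; exact: measurable_leftmost_event.
- move=> w a b; apply: leftmost_event_inj => // y i j yi yj; apply: val_inj.
  by rewrite /= -(gridcellP M0 yi) -(gridcellP M0 yj).
- move=> a; apply: le_trans (pr_leftmost_event Z_iid mX mC Xlt r0 XC a mN cover).
  by rewrite ler_wpM2r ?lerB// prodr_ge0// => k _; exact: r0.
- by move=> a w /(leftmost_eventP Xlt).
Qed.

End leftmost_types_strip.

(** * Regularity of large samples *)

Section regular_sample.
Context {R : realType} (mu : probability (R * R)%type R).
Hypothesis mu_permuton : permuton mu.
Context d (T : measurableType d) (P : probability T R) (n : nat).
Context (Z : 'I_n -> {RV P >-> (R * R)%type}).
Hypothesis Z_iid : iid Z mu.

Section coordinate.
Context (p : R * R -> R).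
Hypothesis mp : measurable_fun setT p.
Hypothesis p_uniform : forall a b, 0 <= a -> a <= b -> b <= 1 ->
  pr mu (p @^-1` `[a, b[) = b - a.

Let mpre (A : set R) : measurable A -> measurable (p @^-1` A).
Proof. by move=> mA; rewrite -[X in measurable X]setTI; exact: mp. Qed.

(** Equal coordinates share a cell in the grid of every mesh, while sharing at mesh [1 / L.+1] has
    probability at most [n ^+ 2 / L.+1]. The intersection over all meshes is a measurable null set
    containing all coincidences. *)
Definition ties : set T :=
  \bigcap_L shared Z id (fun l : 'I_L.+1 => p @^-1` gridcell L.+1 l).

Lemma measurable_ties : measurable ties.
Proof.
apply: bigcapT_measurable => L; apply: measurable_shared => l.
by apply: mpre; exact: measurable_gridcell.
Qed.

Lemma pr_ties : pr P ties <= 0.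
Proof.
apply/ler_addgt0Pl => eps eps0; rewrite addr0.
have [L HL] := natr_above (n%:R ^+ 2 / eps).
have mC (l : 'I_L.+1) : measurable (p @^-1` gridcell L.+1 l).
  by apply: mpre; exact: measurable_gridcell.
apply: (@le_trans _ _ (n%:R ^+ 2 * (pr mu setT * L.+1%:R^-1))); last first.
  have := HL _ (leqnSn L); rewrite prT mul1r ltr_pdivrMr// => h.
  by rewrite ler_pdivrMr// mulrC ltW.
apply: (@le_trans _ _ (pr P (shared Z id (fun l : 'I_L.+1 => p @^-1` gridcell L.+1 l)))).
  apply: pr_le; [exact: measurable_ties|exact: measurable_shared|exact: bigcap_inf].
apply: (pr_shared Z_iid) => //.
- by move=> x k l /(gridcellP (ltn0Sn L)) kx /(gridcellP (ltn0Sn L)) lx; apply: val_inj; rewrite /= -kx -lx.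
- move=> l; rewrite /gridcell p_uniform.
  + by rewrite -natr1 mulrDl mul1r addrAC subrr add0r.
  + by rewrite divr_ge0.
  + by rewrite ler_pM2r ?invr_gt0// ler_nat.
  + by rewrite ler_pdivrMr// mul1r ler_nat.
Qed.

Lemma not_ties_inj w : ~ ties w -> (forall i, 0 < p (Z i w) < 1) ->
  injective (fun i => p (Z i w)).
Proof.
move=> nt p01 i j e; apply: contrapT => /eqP ij; apply: nt => L _.
have /andP[y0 y1] := p01 i.
have yL : (gridpos L.+1 (p (Z i w)) < L.+1)%N by rewrite gridpos_lt// ltW.
exists i, j, (Ordinal yL); split=> //=; first exact/gridcell_pos/ltW.
by rewrite e; apply/gridcell_pos; rewrite // -e ltW.
Qed.

End coordinate.

Lemma fst_uniform a b : 0 <= a -> a <= b -> b <= 1 ->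
  pr mu (fst @^-1` `[a, b[) = b - a.
Proof.
move=> a0 ab b1; rewrite -(pr_permuton_itv_fst mu_permuton true true a0 ab b1).
by congr (pr mu _); apply/seteqP; split=> p; [move=> ?; split|case].
Qed.

Lemma snd_uniform a b : 0 <= a -> a <= b -> b <= 1 ->
  pr mu (snd @^-1` `[a, b[) = b - a.
Proof.
move=> a0 ab b1; rewrite -(pr_permuton_itv_snd mu_permuton true true a0 ab b1).
by congr (pr mu _); apply/seteqP; split=> p; [move=> ?; split|case].
Qed.

Definition regular (M : nat) (delta : R) (z : 'I_n -> R * R) : Prop :=
  [/\ injective (fst \o z), injective (snd \o z),
      forall i, 0 < (z i).1 < 1, forall i, 0 < (z i).2 < 1
    & forall j, (j <= M)%N ->
       `|#|[pred i | (z i).2 < j%:R / M%:R]|%:R - n%:R * (j%:R / M%:R)| <= delta * n%:R].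

(** The empirical distribution function is controlled at the [M.+1] grid points only, by a union
    bound over Chebyshev's inequality. The other clauses of [regular] fail with probability 0. *)
Lemma pr_irregular (M : nat) (delta : R) : (0 < M)%N -> (0 < n)%N -> 0 < delta ->
  exists2 N : set T, measurable N /\ pr P N <= M.+1%:R / (delta ^+ 2 * n%:R) &
    forall w, ~ N w -> regular M delta (fun i => Z i w).
Proof.
move=> M0 n0 delta0; have M0R : 0 < M%:R :> R by rewrite ltr0n.
have n0R : 0 < n%:R :> R by rewrite ltr0n.
have mitv : measurable (`]0%R, 1%R[%classic : set R) by exact: measurable_itv.
pose out : set (R * R) := ~` (`]0%R, 1%R[ `*` `]0%R, 1%R[).
have mout : measurable out by apply: measurableC; exact: measurableX.
have out0 : pr mu out = 0 by exact: (pr_permuton_square mu_permuton false true).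
pose N1 i := Z i @^-1` out.
pose E (j : 'I_M.+1) i := Z i @^-1` (snd @^-1` `[0%R, j%:R / M%:R[).
pose N3 (j : 'I_M.+1) := [set w | delta * n%:R <= `|\sum_i \1_(E j i) w - n%:R * (j%:R / M%:R)|].
have msnd (A : set R) : measurable A -> measurable (snd @^-1` A : set (R * R)).
  by move=> mA; rewrite -[X in measurable X]setTI; exact: measurable_snd.
have mE j i : measurable (E j i).
  by apply: measurable_preimage; apply: msnd; exact: measurable_itv.
have mN1 i : measurable (N1 i) by exact: measurable_preimage.
have mN3 j : measurable (N3 j) by exact: measurable_count_deviation.
pose U1 := \bigcup_i N1 i; pose U2 := ties fst `|` ties snd; pose U3 := \bigcup_j N3 j.
have mU1 : measurable U1 by apply: fin_bigcup_measurable => //; exact: finite_finset.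
have m1 := measurable_ties measurable_fst.
have m2 := measurable_ties measurable_snd.
have mU2 : measurable U2 by exact: measurableU.
have mU3 : measurable U3 by apply: fin_bigcup_measurable => //; exact: finite_finset.
have pU1 : pr P U1 <= 0.
  apply: (@le_trans _ _ (\sum_i pr P (N1 i))).
    by apply: pr_bigU => // w [i _ ?]; exists i.
  by rewrite big1// => i _; rewrite /N1 (pr_preimage Z_iid).
have pU2 : pr P U2 <= 0.
  apply: le_trans (pr_setU_le P m1 m2) _.
  by rewrite -[leRHS]addr0 lerD ?(pr_ties measurable_fst fst_uniform) ?(pr_ties measurable_snd snd_uniform).
have pU3 : pr P U3 <= M.+1%:R / (delta ^+ 2 * n%:R).
  apply: (@le_trans _ _ (\sum_j pr P (N3 j))).
    by apply: pr_bigU => // w [i _ ?]; exists i.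
  apply: (@le_trans _ _ (\sum_(j < M.+1) (delta ^+ 2 * n%:R)^-1)); last first.
    by rewrite sumr_const card_ord -[leLHS]mulr_natl.
  apply: ler_sum => j _.
  have jM : j%:R / M%:R <= 1 :> R by rewrite ler_pdivrMr// mul1r ler_nat -ltnS.
  apply: (@le_trans _ _ (n%:R * (j%:R / M%:R) / (delta * n%:R) ^+ 2)).
    apply: (chebyshev_count (E := E j)) => //.
    - by move=> i; rewrite (pr_preimage Z_iid) ?snd_uniform ?subr0 ?divr_ge0//; apply: msnd; exact: measurable_itv.
    - move=> i k ik; rewrite (pr_pair Z_iid)//; try (apply: msnd; exact: measurable_itv).
      by rewrite snd_uniform ?subr0 ?divr_ge0.
    - by rewrite mulr_gt0.
  have -> : n%:R * (j%:R / M%:R) / (delta * n%:R) ^+ 2 = (j%:R / M%:R) * (delta ^+ 2 * n%:R)^-1.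
    by field; rewrite !gt_eqF.
  by rewrite ler_piMl// invr_ge0 mulr_ge0// sqr_ge0.
exists (U1 `|` (U2 `|` U3)).
  split; first by apply: measurableU => //; exact: measurableU.
  have := pr_setU_le P mU1 (measurableU _ _ mU2 mU3).
  have := pr_setU_le P mU2 mU3.
  lra.
move=> w /not_orP[nU1 /not_orP[/not_orP[nt1 nt2] nU3]].
have z01 i : (`]0%R, 1%R[ `*` `]0%R, 1%R[)%classic (Z i w).
  by apply: contrapT => h; apply: nU1; exists i.
have x01 i : 0 < (Z i w).1 < 1 by have [/=] := z01 i; rewrite in_itv.
have y01 i : 0 < (Z i w).2 < 1 by have [/=] := z01 i; rewrite !in_itv.
split => //.
- exact: (not_ties_inj nt1).
- exact: (not_ties_inj nt2).
- move=> j jM; rewrite leNgt; apply/negP => lt; apply: nU3.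
  exists (Ordinal (jM : (j < M.+1)%N)) => //.
  rewrite /N3 /= (@sum_indic_card _ _ _ _ _ w [pred i | (Z i w).2 < j%:R / M%:R]); first exact: ltW.
  move=> i; rewrite /E /= in_itv /=; have /andP[/ltW -> _] := y01 i.
  by split.
Qed.

End regular_sample.

Section type_sequences.
Context {R : realType} (K M : nat).
Hypothesis M0 : (0 < M)%N.
Implicit Types a : {ffun 'I_K -> 'I_M}.

(** A deterministic stand-in for the first [K] values, each moved to the left end of its cell. *)
Definition type_seq a : seq R := [seq (a k)%:R / M%:R | k <- enum 'I_K].

Definition has_types a (s : seq R) :=
  size s = K /\ forall k : 'I_K, gridcell M (a k) (nth 0 s k).

Lemma has_types_grid a s : has_types a s -> [seq grid M y | y <- s] = type_seq a.
Proof.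
move=> [sK h]; apply: (@eq_from_nth _ 0); first by rewrite /type_seq 2!size_map size_enum_ord.
move=> i; rewrite size_map sK => iK.
rewrite (nth_map 0) ?sK// (nth_map (Ordinal iK)) ?size_enum_ord//.
have := h (Ordinal iK) => /= /(gridcellP M0); rewrite /grid => ->.
by congr ((a _)%:R / _); apply: val_inj; rewrite /= nth_enum_ord.
Qed.

Lemma has_types_inj a s : has_types a s -> injective a -> {in s &, injective (gridpos M)}.
Proof.
move=> [sK h] inj x y /(nthP 0)[i iK <-] /(nthP 0)[j jK <-].
rewrite sK in iK jK.
have := h (Ordinal iK) => /(gridcellP M0) /= ->; have := h (Ordinal jK) => /(gridcellP M0) /= ->.
by move=> /val_inj/inj/(congr1 val) /= ->.
Qed.

(** The condition on ancestors bears on the finite data [a] alone; rounding preserves the order of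
    [s], so it passes to the tree of [s]. *)
Lemma tree_gap_types_dist a s v : unit_seq s -> injective a -> has_types a s ->
  ancestors (bst (type_seq a)) v ->
  [/\ ancestors (bst s) v, 0 <= tree_gap (bst (type_seq a)) v <= 1 &
    `|tree_gap (bst s) v - tree_gap (bst (type_seq a)) v| <= M%:R^-1].
Proof.
move=> us inj h anc; have inj' := has_types_inj h inj.
rewrite -(has_types_grid h) in anc *.
have anc' : ancestors (bst s) v by apply/(ancestors_map v (grid_mono M0 inj')).
split => //; last exact: tree_gap_grid_dist.
have [l0 lr r1] := bst_gap_ge0 us anc'.
rewrite grid_gap// subr_ge0 /grid ler_pM2r ?invr_gt0 ?ltr0n// ler_nat gridpos_le ?(ltW lr)//=.
have : grid M (bst_right s v) <= 1.
  by have /andP[h1 _] := grid_itv M0 (le_trans l0 (ltW lr)); exact: le_trans h1 r1.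
have : 0 <= grid M (bst_left s v) by rewrite divr_ge0.
rewrite /grid; lra.
Qed.

Lemma subtree_ratio_types_dist n (z : 'I_n -> R * R) (idx : seq 'I_n) delta a v :
  (0 < n)%N -> 0 <= delta -> regular M delta z ->
  sorted (fun i j => (z i).1 < (z j).1) idx ->
  (forall i j, i \notin idx -> j \in idx -> (z j).1 < (z i).1) ->
  injective a -> has_types a [seq (z i).2 | i <- idx] ->
  ancestors (bst (type_seq a)) v ->
  `|subtree_ratio (bst_points [fset z i | i in 'I_n]%fset) v -
    tree_gap (bst (type_seq a)) v| <= M%:R^-1 + 2 * delta.
Proof.
move=> n0 delta0 [injx injy _ y01 Hc] sidx gap inj h anc; set s := map _ _ in h.
have us : unit_seq s by move=> y /mapP[i _ ->].
have [anc' _ _] := tree_gap_types_dist us inj h anc.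
rewrite (subtree_ratio_points injx injy y01 sidx gap anc') -/s.
rewrite -(has_types_grid h) grid_gap//; last exact: has_types_inj h inj.
have [l0 lr r1] := bst_gap_ge0 us anc'.
exact: count_gap_grid_dist.
Qed.

End type_sequences.

Section stream_types.
Context {R : realType} (mu0 : probability R R).
Hypothesis mu0_unit : on_unit mu0.
Hypothesis mu0_atomless : atomless mu0.
Context d (T : measurableType d) (P : probability T R) (Y : nat -> {RV P >-> R}).
Hypothesis Y_iid : iid Y mu0.

Let mY i : measurable_fun setT (Y i : T -> R).
Proof. by []. Qed.

Lemma gridcell_small (eta : R) : 0 < eta ->
  exists M1 : nat, forall M, (M1 <= M)%N -> (0 < M)%N ->
    forall j, (j < M)%N -> pr mu0 (gridcell M j) <= eta.
Proof.
move=> eta0; have [delta delta0 H] := atomless_small mu0_atomless eta0.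
have [M1 HM1] := natr_above delta^-1; exists M1 => M /HM1 Md M0 j jM.
have M0R : 0 < M%:R :> R by rewrite ltr0n.
apply: le_trans (H (j%:R / M%:R) _); last first.
  by rewrite divr_ge0//= ler_pdivrMr// mul1r ler_nat ltnW.
apply: pr_le; [exact: measurable_gridcell|exact: measurable_itv|].
have Md' : M%:R^-1 < delta by rewrite invf_plt ?posrE.
move=> y; rewrite /gridcell /= !in_itv /= -natr1 mulrDl mul1r.
move: (M%:R^-1) (j%:R / _) Md' => u x ud /andP[? ?]; apply/andP; split; lra.
Qed.

Lemma stream_ancestors_eventually k (vs : 'I_k -> word) (eps : R) : 0 < eps ->
  exists K N, [/\ measurable N, pr P N <= eps &
    forall w, ~ N w -> (forall n, 0 < Y n w < 1) /\
      forall i, ancestors (bst (mkseq (Y ^~ w) K)) (vs i)].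
Proof.
move=> eps0.
(* Labels are almost surely positive, so the default label 0 signals a missing node, through a
   measurable function. *)
pose V n (u : word) := [set w | bst_label (mkseq (Y ^~ w) n) u = 0].
have mV n u : measurable (V n u).
  rewrite (_ : V n u = (fun w => bst_label (mkseq (Y ^~ w) n) u) @^-1` [set 0])//.
  rewrite -[X in measurable X]setTI.
  by apply: (measurable_bst_label_mkseq n u mY) => //; exact: measurable_set1.
pose U n := \bigcup_(i : 'I_k) \bigcup_(j : 'I_(size (vs i))) V n (take j (vs i)).
have mU n : measurable (U n).
  apply: fin_bigcup_measurable; first exact: finite_finset.
  by move=> i _; apply: fin_bigcup_measurable => //; exact: finite_finset.
have lab n w u a : (forall n, 0 < Y n w < 1) -> bst (mkseq (Y ^~ w) n) u = Some a -> 0 < a.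
  by move=> Y01 /bst_mem/mapP[i _ ->]; have /andP[] := Y01 i.
have [N0 [mN0 N00 HN0]] := ae_stream_full mu0_atomless Y_iid mu0_unit.
have aeU : {ae P, forall w, exists N, forall n, (N <= n)%N -> ~ U n w}.
  apply: filterS (ae_stream_full mu0_atomless Y_iid mu0_unit) => w [Y01 full].
  have [N HN] := choice (fun i => ancestors_stream (fun j (_ : (j < size (vs i))%N) => full (take j (vs i)))).
  exists (\max_i N i) => n mn [i _ [j _]]; rewrite /V /= /bst_label.
  have Nn : (N i <= n)%N by apply: leq_trans mn; exact: leq_bigmax.
  have := HN i n Nn j (ltn_ord j); case e : (bst _ _) => [a|] // _ /= a0.
  by have := lab _ _ _ _ Y01 e; rewrite a0 ltxx.
have [K HK] := pr_eventually_small eps0 mU aeU.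
exists K, (U K `|` N0); split; first exact: measurableU.
  apply: le_trans (pr_setU_le P (mU K) mN0) _.
  by rewrite [X in _ + X](_ : _ = 0) ?addr0 ?HK// /pr N00.
move=> w /not_orP[nU nN0].
have [Y01 _] : (forall n, 0 < Y n w < 1) /\ forall v, bst_stream (Y ^~ w) v <> None.
  by apply: contrapT => h; apply: nN0; apply: HN0.
split => // i j jv e; apply: nU; exists i => //; exists (Ordinal jv) => //.
by rewrite /V /= /bst_label e.
Qed.

(** The order of the quantifiers matters: [K] is chosen so that the first [K] values fill all
    ancestors of the words, and only then the mesh so that these values are separated. *)
Lemma stream_types k (vs : 'I_k -> word) (eps : R) : 0 < eps ->
  exists K M1, forall M, (M1 <= M)%N -> (0 < M)%N ->
  exists N, [/\ measurable N, pr P N <= eps & forall w, ~ N w ->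
    [/\ forall n, 0 < Y n w < 1,
        forall i, ancestors (bst (mkseq (Y ^~ w) K)) (vs i)
      & forall i j : 'I_K, gridpos M (Y i w) = gridpos M (Y j w) -> i = j]].
Proof.
move=> eps0; have eps20 : 0 < eps / 2 by rewrite divr_gt0.
have [K [N1 [mN1 pN1 HN1]]] := stream_ancestors_eventually vs eps20.
(* [K * K] bounds the number of pairs; the successor keeps the denominator positive. *)
pose eta := eps / 2 / (K * K).+1%:R.
have eta0 : 0 < eta by rewrite divr_gt0.
have [M1 HM1] := gridcell_small eta0; exists K, M1 => M M1M M0.
pose C (l : 'I_M) := gridcell (R := R) M l.
have mC l : measurable (C l) by exact: measurable_gridcell.
pose U2 := shared Y (val : 'I_K -> nat) C.
have mU2 : measurable U2 by exact: measurable_shared.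
have pU2 : pr P U2 <= eps / 2.
  apply: (@le_trans _ _ (K%:R ^+ 2 * (pr mu0 setT * eta))).
    apply: (pr_shared Y_iid) => //.
    - by move=> x a b /(gridcellP M0) ax /(gridcellP M0) bx; apply: val_inj; rewrite /= -ax -bx.
    - exact: ltW.
    - by move=> l; exact: HM1.
  rewrite prT mul1r -natrX /eta mulrCA ler_piMr ?(ltW eps20)//.
  by rewrite ler_pdivrMr// mul1r ler_nat expnS expn1.
exists (N1 `|` U2); split; first exact: measurableU.
  by apply: le_trans (pr_setU_le P mN1 mU2) _; lra.
move=> w /not_orP[/HN1[Y01 anc] nU2]; split => // i j e.
apply: contrapT => /eqP ij; apply: nU2.
have y0 n : 0 <= Y n w by have /andP[/ltW] := Y01 n.
have yM : (gridpos M (Y i w) < M)%N.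
  by apply: gridpos_lt => //; rewrite y0 /=; have /andP[] := Y01 i.
exists i, j, (Ordinal yM); split; rewrite /C //=; first exact: gridcell_pos.
by rewrite e; exact: gridcell_pos.
Qed.

End stream_types.

(** * Convergence to the limiting tree *)

Section prod_lower.
Context {R : realType}.

(** All factors lie in [0,1], so lowering one of them costs at most [eta]. Truncation at 0 keeps the
    product a valid lower bound for a probability. *)
Lemma prod_max_ge K (p : 'I_K -> R) (eta : R) : 0 <= eta -> (forall k, 0 <= p k <= 1) ->
  \prod_k p k - K%:R * eta <= \prod_k Num.max 0 (p k - eta).
Proof.
move=> eta0; elim: K p => [|K IH] p p01; first by rewrite !big_ord0 mul0r subr0.
rewrite !big_ord_recl -natr1.
have := IH (fun k => p (lift ord0 k)) (fun k => p01 _).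
set A := \prod_(i < K) p _; set B := \prod_(i < K) Num.max _ _ => AB.
have A1 : A <= 1.
  have h := @ler_prod R 'I_K (index_enum _) predT (fun k => p (lift ord0 k)) (fun=> 1) (fun k _ => p01 _).
  by apply: le_trans h _; rewrite big1.
have B0 : 0 <= B by apply: prodr_ge0 => k _; rewrite le_max lexx.
have A0 : 0 <= A by apply: prodr_ge0 => k _; have /andP[] := p01 (lift ord0 k).
have /andP[q0 q1] := p01 ord0; set q := p ord0 in q0 q1 *.
have Keta : 0 <= K%:R * eta by rewrite mulr_ge0.
apply: (@le_trans _ _ (Num.max 0 (q - eta) * (A - K%:R * eta))); last first.
  by rewrite ler_wpM2l// le_max lexx.
have qm : q - eta <= Num.max 0 (q - eta) by rewrite le_max lexx orbT.
have m0 : 0 <= Num.max 0 (q - eta) by rewrite le_max lexx.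
have m1 : Num.max 0 (q - eta) <= 1 by rewrite ge_max ler01 /=; lra.
move: (Num.max 0 (q - eta)) qm m0 m1 => m qm m0 m1; nra.
Qed.

End prod_lower.

Section convergence.
Context {R : realType} (mu : probability (R * R)%type R) (mu0 : probability R R).
Hypothesis mu_permuton : permuton mu.
Hypothesis mu0_unit : on_unit mu0.
Hypothesis mu0_atomless : atomless mu0.
Hypothesis mu_strip : strip_cvg mu mu0.
Context (d' : measure_display) (T' : measurableType d') (P' : probability T' R).
Context (Y : nat -> {RV P' >-> R}).
Hypothesis Y_iid : iid Y mu0.

Definition stream_box K M (a : {ffun 'I_K -> 'I_M}) (i : nat) : set R :=
  if insub i is Some k then gridcell M (a k) else setT.

Lemma measurable_stream_box K M (a : {ffun 'I_K -> 'I_M}) i : measurable (stream_box a i).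
Proof. by rewrite /stream_box; case: insub => // k; exact: measurable_gridcell. Qed.

Definition stream_event K M (a : {ffun 'I_K -> 'I_M}) : set T' :=
  cylinder Y (iota 0 K) (stream_box a).

Lemma stream_eventP K M (a : {ffun 'I_K -> 'I_M}) w :
  stream_event a w <-> forall k : 'I_K, gridcell M (a k) (Y k w).
Proof.
split=> [h k|h i].
  have := h k; rewrite mem_iota ltn_ord /= /stream_box valK; exact.
rewrite mem_iota add0n => /= iK; rewrite /stream_box insubT/=; exact: (h (Ordinal iK)).
Qed.

Lemma pr_stream_event K M (a : {ffun 'I_K -> 'I_M}) :
  pr P' (stream_event a) = \prod_k pr mu0 (gridcell M (a k)).
Proof.
rewrite (pr_cylinder Y_iid) ?iota_uniq//; last exact: measurable_stream_box.
have -> : iota 0 K = index_iota 0 K by rewrite /index_iota subn0.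
rewrite big_mkord.
by apply: eq_bigr => k _; rewrite /stream_box valK.
Qed.

(** Both means are compared with the same sum of [F a * q a], where [q a] is a common lower bound
    for the probability of the types [a] in the sample and in the sequence. *)
Lemma expectation_dist k (vs : 'I_k -> word) (f : 'rV[R]_k -> R) (C eps : R) :
  continuous f -> 0 < C -> (forall x, `|f x| <= C) -> 0 < eps ->
  exists n0, forall n, (n0 <= n)%N ->
  forall d (T : measurableType d) (P : probability T R) (Z : 'I_n -> {RV P >-> (R * R)%type}),
    iid Z mu -> exists x y,
   [/\ ('E_P[fun w => f (\row_(i < k) subtree_ratio (bst_points (random_points Z w)) (vs i))] = x%:E)%E,
       ('E_P'[fun w => f (\row_(i < k) tree_gap (bst_stream (fun i => Y i w)) (vs i))] = y%:E)%E
     & `|x - y| <= eps].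
Proof.
move=> cf C0 fC eps0.
(* Each mean will be within [eps / 8 + C e + 2 C e], at most [eps / 2], of the common sum. *)
pose e := Num.min 1 (eps / (8 * C)).
have e0 : 0 < e by rewrite lt_min ltr01 divr_gt0// mulr_gt0.
have e1 : e <= 1 by rewrite ge_min lexx.
have eC : C * e <= eps / 8.
  have : e <= eps / (8 * C) by rewrite ge_min lexx orbT.
  rewrite ler_pdivlMr ?mulr_gt0//; lra.
have e30 : 0 < e / 3 by rewrite divr_gt0.
have eps80 : 0 < eps / 8 by rewrite divr_gt0.
have [delta delta0 Hf] := heine cf eps80.
have [K [M1 HKM]] := stream_types mu0_unit mu0_atomless Y_iid vs e30.
have [M2 HM2] := natr_above (4 / delta).
pose M := (M1 + M2).+1; have M0 : (0 < M)%N by [].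
have M0R : 0 < M%:R :> R by rewrite ltr0n.
have Md : M%:R^-1 < delta / 4.
  rewrite invf_plt ?posrE ?divr_gt0// invf_div; apply: HM2.
  by rewrite /M -addnS (leq_trans _ (leq_addl _ _))//.
have [N' [mN' pN' HN']] := HKM M (leq_trans (leq_addr _ _) (leqnSn _)) M0.
pose A := #|{ffun 'I_K -> 'I_M}|.
(* The loss [K eta] of [prod_max_ge] is incurred for each of at most [A] type assignments. *)
pose eta := e / 3 / (A * K).+1%:R.
have eta0 : 0 < eta by rewrite divr_gt0.
have AKeta : A%:R * (K%:R * eta) <= e / 3.
  rewrite mulrA -natrM /eta mulrCA ler_piMr// ?ltW//.
  by rewrite ltr_pdivrMr// mul1r ltr_nat.
have [n1 Hn1] := pr_leftmost_types mu_permuton mu0_unit mu0_atomless mu_strip K M0 eta0 e30.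
pose delta' := delta / 8; have delta'0 : 0 < delta' by rewrite divr_gt0.
have [n2 Hn2] := natr_above (M.+1%:R / (delta' ^+ 2 * e)).
exists (n1 + n2).+1 => n nn d T P Z Z_iid.
have n0 : (0 < n)%N by apply: leq_trans nn.
have n0R : 0 < n%:R :> R by rewrite ltr0n.
have [E [mE disjE prE HE]] := Hn1 n (leq_trans (leq_trans (leq_addr _ _) (leqnSn _)) nn) _ _ _ Z Z_iid.
have [N [mN pN HN]] := pr_irregular mu_permuton Z_iid M0 n0 delta'0.
have {}pN : pr P N <= e.
  apply: (le_trans pN).
  have : M.+1%:R / (delta' ^+ 2 * e) < n%:R.
    by apply: Hn2; apply: leq_trans nn; apply: leq_trans (leqnSn _); rewrite leq_addl.
  rewrite ltr_pdivrMr ?mulr_gt0 ?exprn_gt0// => h.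
  rewrite ler_pdivrMr ?mulr_gt0 ?exprn_gt0//; lra.
(* A condition on [a] alone, so the same assignments are summed on both sides. *)
pose ok (a : {ffun 'I_K -> 'I_M}) : bool :=
  `[< injective a /\ forall i, ancestors (bst (type_seq a : seq R)) (vs i) >].
pose F (a : {ffun 'I_K -> 'I_M}) := f (\row_(i < k) tree_gap (bst (type_seq a : seq R)) (vs i)).
pose p j := pr mu0 (gridcell M j).
pose q (a : {ffun 'I_K -> 'I_M}) := (1 - e / 3) * \prod_k Num.max 0 (p (a k) - eta).
have p01 j : 0 <= p j <= 1 by rewrite pr_ge0 pr_le1//; exact: measurable_gridcell.
have e3 : 0 <= 1 - e / 3 by lra.
have mS (a : {ffun 'I_K -> 'I_M}) : measurable (stream_event a).
  by apply: measurable_cylinder; exact: measurable_stream_box.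
have prod01 (a : {ffun 'I_K -> 'I_M}) : 0 <= \prod_k Num.max 0 (p (a k) - eta) <= \prod_k p (a k).
  rewrite prodr_ge0 => [|j _]; last by rewrite le_max lexx.
  rewrite ler_prod// => j _; rewrite le_max lexx /= ge_max.
  by have /andP[-> _] := p01 (a j); rewrite lerBlDr lerDl ltW.
have dS w (a b : {ffun 'I_K -> 'I_M}) : ok a -> ok b ->
    stream_event a w -> stream_event b w -> a = b.
  move=> _ _ /stream_eventP ha /stream_eventP hb; apply/ffunP => j; apply: val_inj => /=.
  by rewrite -(gridcellP M0 (ha j)) -(gridcellP M0 (hb j)).
have Sok_le1 : \sum_(a | ok a) \prod_k p (a k) <= 1.
  rewrite (eq_bigr (fun a => pr P' (stream_event a))); last by move=> a _; rewrite pr_stream_event.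
  by rewrite -(prT P'); apply: sum_pr_le.
have Sok : 1 - e / 3 <= \sum_(a | ok a) \prod_k p (a k).
  rewrite (eq_bigr (fun a => pr P' (stream_event a))); last by move=> a _; rewrite pr_stream_event.
  apply: (@le_trans _ _ (pr P' (~` N'))); first by rewrite pr_setC// lerB.
  apply: pr_bigU => //; first exact: measurableC.
  move=> w /HN'[Y01 anc inj].
  have yM (j : 'I_K) : (gridpos M (Y j w) < M)%N.
    by apply: gridpos_lt => //; have /andP[/ltW -> ->] := Y01 j.
  pose a : {ffun 'I_K -> 'I_M} := [ffun j => Ordinal (yM j)].
  have aw : stream_event a w.
    apply/stream_eventP => j; rewrite ffunE; apply: gridcell_pos => //.
    by have /andP[/ltW] := Y01 j.
  exists a => //.
  have ainj : injective a.
    by move=> i j; rewrite !ffunE => /(congr1 val) /= /inj.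
  apply/asboolP; split => // i.
  have ht : has_types a (mkseq (Y ^~ w) K).
    by split; [rewrite size_mkseq|move=> j; rewrite nth_mkseq//; move/stream_eventP: aw; apply].
  rewrite -(has_types_grid M0 ht); apply/ancestors_map; last exact: anc.
  exact: grid_mono (has_types_inj M0 ht ainj).
(* Three losses of [e / 3]: assignments that are not [ok], the [eta] in the products, and the factor
   [1 - e / 3]. *)
have Qge : 1 - e <= \sum_(a | ok a) q a.
  rewrite -mulr_sumr.
  have : \sum_(a | ok a) \prod_k p (a k) - e / 3 <= \sum_(a | ok a) \prod_k Num.max 0 (p (a k) - eta).
    apply: (@le_trans _ _ (\sum_(a | ok a) (\prod_k p (a k) - K%:R * eta))); last first.
      by apply: ler_sum => a _; apply: prod_max_ge => //; exact: ltW.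
    rewrite sumrB lerD2l lerN2 (le_trans _ AKeta)// sumr_const -[leLHS]mulr_natl.
    by rewrite ler_wpM2r ?ler_nat ?max_card// mulr_ge0// ltW.
  have : \sum_(a | ok a) \prod_k Num.max 0 (p (a k) - eta) <= 1.
    apply: le_trans Sok_le1; apply: ler_sum => a _; by have /andP[] := prod01 a.
  move: (\sum_(a | ok a) \prod_k Num.max 0 _) => s s1 s2.
  have : 0 <= e / 3 * (1 - s) by rewrite mulr_ge0 ?subr_ge0 ?(ltW e30).
  lra.
have FC a : ok a -> `|F a| <= C by move=> _; exact: fC.
have [x Ex Hx] : exists2 x, ('E_P[fun w => f (\row_(i < k) subtree_ratio (bst_points (random_points Z w)) (vs i))] = x%:E)%E &
    `|x - \sum_(a | ok a) F a * q a| <= eps / 8 + C * (1 - \sum_(a | ok a) q a) + 2 * C * pr P N.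
  apply: (step_expectation mE) => //.
  - by move=> w a b _ _; exact: disjE.
  - exact: ltW.
  - move=> a _; rewrite prE mulr_ge0//; by have /andP[] := prod01 a.
  - move=> a w /asboolP[ainj anc] aw /HN reg.
    have [idx [sK sidx gap types]] := HE a w aw.
    have ht : has_types a [seq (Z i w).2 | i <- idx].
      split; first by rewrite size_map.
      by move=> j; rewrite (nth_map (Ordinal n0)) ?sK.
    have us : unit_seq [seq (Z i w).2 | i <- idx].
      by move=> y /mapP[i _ ->]; case: reg.
    rewrite distrC; apply: Hf => i; rewrite !mxE.
      by have [_] := tree_gap_types_dist M0 us ainj ht (anc i).
    rewrite distrC; apply: le_lt_trans (subtree_ratio_types_dist M0 n0 (ltW delta'0) reg sidx gap ainj ht (anc i)) _.
    by rewrite /delta'; lra.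
have [y Ey Hy] : exists2 y, ('E_P'[fun w => f (\row_(i < k) tree_gap (bst_stream (fun i => Y i w)) (vs i))] = y%:E)%E &
    `|y - \sum_(a | ok a) F a * q a| <= eps / 8 + C * (1 - \sum_(a | ok a) q a) + 2 * C * pr P' N'.
  apply: (step_expectation mS dS) => //.
  - exact: ltW.
  - move=> a _; rewrite pr_stream_event /q; have /andP[h1 h2] := prod01 a.
    rewrite mulr_ge0//=; apply: le_trans h2.
    by rewrite ler_piMl//; lra.
  - move=> a w /asboolP[ainj anc] /stream_eventP aw /HN'[Y01 ancw _].
    have ht : has_types a (mkseq (Y ^~ w) K).
      by split; [rewrite size_mkseq|move=> j; rewrite nth_mkseq].
    have us : unit_seq (mkseq (Y ^~ w) K) by move=> z /mapP[i _ ->].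
    rewrite distrC; apply: Hf => i; rewrite !mxE; have [_ h1 h2] := tree_gap_types_dist M0 us ainj ht (anc i).
      exact: h1.
    rewrite distrC (tree_gap_stream (ancw i)); apply: le_lt_trans h2 _.
    by lra.
exists x, y; split => //.
have h1 : C * (1 - \sum_(a | ok a) q a) <= eps / 8.
  by apply: le_trans eC; rewrite ler_pM2l//; lra.
have h2 : C * pr P N <= eps / 8 by apply: le_trans eC; rewrite ler_pM2l.
have h3 : C * pr P' N' <= eps / 8 by apply: le_trans eC; rewrite ler_pM2l//; lra.
move: Hx Hy h1 h2 h3; rewrite !ler_norml.
move: (\sum_(a | ok a) F a * q a) (C * (1 - _)) => s u.
rewrite -!mulrA; move: (C * pr P N) (C * pr P' N') => u1 u2.
by clear => /andP[? ?] /andP[? ?] ? ? ?; apply/andP; split; lra.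
Qed.

Theorem cvg_subtree_size_stream (dd : nat -> measure_display)
    (T : forall n, measurableType (dd n)) (P : forall n, probability (T n) R)
    (Z : forall n, 'I_n -> {RV (P n) >-> (R * R)%type}) :
  (forall n, iid (Z n) mu) ->
  cvg_subtree_size P (fun n w => bst_points (random_points (Z n) w))
    P' (fun w => tree_gap (bst_stream (fun i => Y i w))).
Proof.
move=> Z_iid; split.
  split; first by move=> v; apply: measurable_tree_gap_stream.
  apply: filterS (ae_stream_full mu0_atomless Y_iid mu0_unit) => w [Y01 full].
  exact: Psi_tree_gap.
move=> k vs f cf [C0 [_ bf]].
pose C := Num.max 1 (C0 + 1).
have Cgt0 : 0 < C by rewrite lt_max ltr01.
have fC x : `|f x| <= C.
  by apply: (bf C) => //; rewrite lt_max ltrDl ltr01 orbT.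
(* The tolerance 1 is arbitrary: this instance only shows that the expectations are finite. *)
have [n0 Hn0] := expectation_dist vs cf Cgt0 fC ltr01.
have [_ [y [_ Ey _]]] := Hn0 n0 (leqnn _) _ _ _ _ (Z_iid n0).
rewrite Ey; apply/fine_cvgP; split.
  by exists n0 => // n /= nn; have [x [_ [-> _ _]]] := Hn0 n nn _ _ _ _ (Z_iid n).
apply/cvgrPdist_le => eps eps0.
have [n1 Hn1] := expectation_dist vs cf Cgt0 fC eps0.
exists n1 => // n /= nn; have [x [y' [-> Ey' h]]] := Hn1 n nn _ _ _ _ (Z_iid n).
by rewrite Ey in Ey'; move: Ey' h => [->] h; rewrite /= distrC.
Qed.

End convergence.

(** * Means of bounded functions *)

Section mean.
Context d (T : measurableType d) {R : realType} (P : probability T R).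
Implicit Types F G H : T -> R.

Definition bdd F := measurable_fun setT F /\ exists C, forall x, `|F x| <= C.

Definition mean F : R := (\int[P]_x F x)%R.

Lemma bdd_integrable F : bdd F -> P.-integrable setT (EFin \o F).
Proof.
move=> [mF [C FC]]; apply: measurable_bounded_integrable => //.
  by apply: le_lt_trans (probability_le1 P measurableT) (ltry _).
by exists C; split; [exact: num_real|move=> M CM x _ /=; rewrite (le_trans (FC x))// ltW].
Qed.

Lemma meanE F : bdd F -> (\int[P]_x (F x)%:E)%E = (mean F)%:E.
Proof.
move=> bF; rewrite /mean /Rintegral fineK//.
by apply: integrable_fin_num => //; exact: bdd_integrable.
Qed.

Lemma bdd_cst (c : R) : bdd (fun=> c).
Proof. by split; [exact: measurable_cst | exists `|c|]. Qed.

Lemma bddD F G : bdd F -> bdd G -> bdd (fun x => F x + G x).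
Proof.
move=> [mF [C FC]] [mG [D GD]]; split; first exact: measurable_funD.
by exists (C + D) => x; rewrite (le_trans (ler_normD _ _))// lerD.
Qed.

Lemma bddM F G : bdd F -> bdd G -> bdd (fun x => F x * G x).
Proof.
move=> [mF [C FC]] [mG [D GD]]; split; first exact: measurable_funM.
by exists (C * D) => x; rewrite normrM ler_pM.
Qed.

Lemma bddZ (c : R) F : bdd F -> bdd (fun x => c * F x).
Proof. by move=> bF; apply: bddM => //; exact: bdd_cst. Qed.

Lemma bddN F : bdd F -> bdd (fun x => - F x).
Proof.
move=> bF; rewrite (_ : (fun x => - F x) = (fun x => (- 1) * F x)); first exact: bddZ.
by apply/funext => x; rewrite mulN1r.
Qed.

Lemma bddB F G : bdd F -> bdd G -> bdd (fun x => F x - G x).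
Proof. by move=> bF bG; apply: bddD => //; exact: bddN. Qed.

Lemma bddX F n : bdd F -> bdd (fun x => F x ^+ n).
Proof.
move=> bF; elim: n => [|n IH].
  by rewrite (_ : (fun x => F x ^+ 0) = fun=> 1); [exact: bdd_cst|apply/funext => x; rewrite expr0].
rewrite (_ : (fun x => F x ^+ n.+1) = fun x => F x * F x ^+ n); first exact: bddM.
by apply/funext => x; rewrite exprS.
Qed.

Lemma bdd_indic (A : set T) : measurable A -> bdd (\1_A : T -> R).
Proof.
move=> mA; split; first exact: measurable_indic.
by exists 1 => x; rewrite indicE ger0_norm// lern1 leq_b1.
Qed.

Lemma bdd_sum (I : Type) (r : seq I) (F : I -> T -> R) :
  (forall i, bdd (F i)) -> bdd (fun x => \sum_(i <- r) F i x).
Proof.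
move=> bF; elim: r => [|i r IH].
  rewrite (_ : (fun x => _) = fun=> 0); first exact: bdd_cst.
  by apply/funext => x; rewrite big_nil.
rewrite (_ : (fun x => _) = fun x => F i x + \sum_(j <- r) F j x); first exact: bddD.
by apply/funext => x; rewrite big_cons.
Qed.

Lemma mean_cst (c : R) : mean (fun=> c) = c.
Proof. by rewrite /mean Rintegral_cst// [fine _](prT P) mulr1. Qed.

Lemma meanD F G : bdd F -> bdd G -> mean (fun x => F x + G x) = mean F + mean G.
Proof. by move=> bF bG; rewrite /mean RintegralD//; exact: bdd_integrable. Qed.

Lemma meanB F G : bdd F -> bdd G -> mean (fun x => F x - G x) = mean F - mean G.
Proof. by move=> bF bG; rewrite /mean RintegralB//; exact: bdd_integrable. Qed.

Lemma meanZ (c : R) F : bdd F -> mean (fun x => c * F x) = c * mean F.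
Proof. by move=> bF; rewrite /mean RintegralZl//; exact: bdd_integrable. Qed.

Lemma mean_le F G : bdd F -> bdd G -> (forall x, F x <= G x) -> mean F <= mean G.
Proof.
by move=> bF bG FG; rewrite /mean le_Rintegral//; exact: bdd_integrable.
Qed.

Lemma mean_norm_le F G : bdd F -> bdd G -> (forall x, `|F x| <= G x) -> `|mean F| <= mean G.
Proof.
move=> bF bG FG; rewrite ler_norml; apply/andP; split; last first.
  by apply: mean_le => // x; apply: le_trans (FG x); exact: ler_norm.
rewrite -mulN1r -meanZ//; apply: mean_le => //; first exact: bddZ.
by move=> x; rewrite mulN1r; have := FG x; rewrite ler_norml => /andP[].
Qed.

Lemma mean_indic (A : set T) : measurable A -> mean (\1_A : T -> R) = pr P A.
Proof.
by move=> mA; rewrite /mean /Rintegral integral_indic// setIT.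
Qed.

Lemma mean_sum (I : Type) (r : seq I) (F : I -> T -> R) :
  (forall i, bdd (F i)) -> mean (fun x => \sum_(i <- r) F i x) = \sum_(i <- r) mean (F i).
Proof.
move=> bF; elim: r => [|i r IH].
  rewrite big_nil (_ : (fun x => _) = fun=> 0) ?mean_cst//.
  by apply/funext => x; rewrite big_nil.
rewrite big_cons -IH -meanD//; last exact: bdd_sum.
by congr mean; apply/funext => x; rewrite big_cons.
Qed.

End mean.

(** * Clipping to the unit interval *)

Section clip.
Context {R : realType}.

Definition clip (y : R) : R := Num.max 0 (Num.min 1 y).

Lemma clip_itv y : 0 <= clip y <= 1.
Proof. by rewrite /clip le_max lexx /= ge_max ler01 /= ge_min lexx. Qed.

Lemma clip_id y : 0 <= y <= 1 -> clip y = y.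
Proof. by move=> /andP[y0 y1]; rewrite /clip min_r// max_r. Qed.

Lemma clip_dist x y : `|clip x - clip y| <= `|x - y|.
Proof.
have clipE u : clip u = if u < 0 then 0 else if 1 < u then 1 else u.
  rewrite /clip; case: (ltP u 0) => u0.
    by rewrite min_r ?max_l//; lra.
  by case: (ltP 1 u) => u1; rewrite max_r.
wlog xy : x y / x <= y.
  by move=> H; case/orP: (le_total x y) => h; [exact: H|rewrite distrC [leRHS]distrC H].
rewrite distrC [leRHS]distrC [leRHS]ger0_norm ?subr_ge0//.
have : clip x <= clip y.
  rewrite !clipE; case: (ltP x 0) => ?; case: (ltP y 0) => ?; case: (ltP 1 x) => ?;
    case: (ltP 1 y) => ?; lra.
move=> h; rewrite ger0_norm ?subr_ge0//.
rewrite !clipE; case: (ltP x 0) => ?; case: (ltP y 0) => ?; case: (ltP 1 x) => ?;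
  case: (ltP 1 y) => ?; lra.
Qed.

Lemma clip_continuous : continuous clip.
Proof.
have cid : continuous (fun y : R => y) by move=> ?; exact: cvg_id.
have c1 := min_fun_continuous (@cst_continuous R R 1) cid.
exact: (max_fun_continuous (@cst_continuous R R 0) c1).
Qed.

Lemma measurable_clip : measurable_fun setT clip.
Proof. by apply: continuous_measurable_fun; exact: clip_continuous. Qed.

(* Test functions are given on [0,1] only; composing with [clip] extends them. *)
Lemma comp_clip_continuous (g : R -> R) :
  {within `[0%R, 1%R], continuous g} -> continuous (g \o clip).
Proof.
move=> cg x; apply/cvgrPdist_le => e e0 /=.
have cI : `[0%R, 1%R]%classic (clip x) by rewrite /= in_itv /= clip_itv.
have := cg (clip x); move=> /cvgrPdist_le/(_ e e0).
rewrite /nbhs /= -nbhs_subspace_in//.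
move=> /nbhs_ballP[r /= r0 Hr]; apply/nbhs_ballP; exists r => //= z xz.
apply: Hr; last by rewrite /= in_itv /= clip_itv.
by move: xz; rewrite /ball /=; apply: le_lt_trans; exact: clip_dist.
Qed.

Lemma comp_clip_bounded (g : R -> R) : {within `[0%R, 1%R], continuous g} ->
  exists C, forall x, `|g (clip x)| <= C.
Proof.
move=> cg.
have := continuous_compact cg (@segment_compact _ 0 1) => /compact_bounded[C [_ HC]].
exists (C + 1) => x; apply: (HC (C + 1)); first by rewrite ltrDl.
by exists (clip x) => //; rewrite /= in_itv /= clip_itv.
Qed.

End clip.

Section clip_mean.
Context {R : realType}.

Lemma bdd_clip_fst (f : R -> R) (C : R) : measurable_fun setT f ->
  (forall t, 0 <= t <= 1 -> `|f t| <= C) -> bdd (fun p : R * R => f (clip p.1)).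
Proof.
move=> mf fC; split; last by exists C => p; apply: fC; exact: clip_itv.
by apply: measurableT_comp => //; apply: measurableT_comp; [exact: measurable_clip|exact: measurable_fst].
Qed.

Lemma bdd_indic_clip_fst (A : set R) : measurable A -> bdd (fun p : R * R => \1_A (clip p.1) : R).
Proof.
move=> mA; apply: (bdd_clip_fst (C := 1)); first exact: measurable_indic.
by move=> t _; rewrite indicE ger0_norm// lern1 leq_b1.
Qed.

Lemma bdd_weight n : bdd (fun p : R * R => (1 - clip p.1) ^+ n).
Proof.
apply: bddX; apply: (bdd_clip_fst (f := fun t => 1 - t) (C := 1)).
  exact: measurable_funB.
by move=> t /andP[? ?]; rewrite ger0_norm; lra.
Qed.

Lemma bdd_comp_snd (G : R -> R) : bdd G -> bdd (fun p : R * R => G p.2).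
Proof.
move=> [mG [C GC]]; split; last by exists C => p; exact: GC.
by apply: (measurableT_comp mG); exact: measurable_snd.
Qed.

End clip_mean.

Section strip_mean.
Context {R : realType} (mu : probability (R * R)%type R).
Hypothesis mu_permuton : permuton mu.

(** The strip measure is [|x|^-1] times the image under [snd] of [mu] restricted to [[0, x] x R]. *)
Lemma ge0_integral_strip (x : R) (f : R -> \bar R) : measurable_fun setT f ->
  (forall y, (0 <= f y)%E) ->
  (\int[strip mu x]_(y in `[0%R, 1%R]) f y =
   (`|x|^-1)%:E * \int[mu]_(p in `[0%R, x] `*` `[0%R, 1%R]) f p.2)%E.
Proof.
move=> mf f0.
have mD : measurable (`[0%R, x] `*` setT : set (R * R)) by exact: measurableX.
have k0 : 0 <= `|x|^-1 by rewrite invr_ge0.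
have ms : measurable_fun [set: R * R] (snd : R * R -> R) by exact: measurable_snd.
have mI : measurable (`[0%R, 1%R]%classic : set R) by exact: measurable_itv.
pose nu := @measure_function_pushforward__canonical__measure_function_Measure
  _ _ _ _ _ (mrestr mu mD) _ ms.
rewrite (eq_measure_integral (mscale (NngNum k0) nu)); last first.
  move=> A mA AI; rewrite /mscale /= /pushforward /mrestr /strip; congr (_ * mu _)%E.
  by apply/seteqP; split=> p; [case=> ? ?; split=> //; split|case=> ? [? _]; split].
have mfI : measurable_fun (`[0%R, 1%R]%classic : set R) f by exact: measurable_funTS.
rewrite ge0_integral_mscale//=; congr (_ * _)%E.
rewrite ge0_integral_pushforward//=.
have mSI : measurable (snd @^-1` `[0%R, 1%R] : set (R * R)).
  by rewrite -[X in measurable X]setTI; exact: measurable_snd.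
have mfs : measurable_fun setT (f \o (snd : R * R -> R)) by apply: measurableT_comp => //; exact: measurable_snd.
have mC := measurableC mD.
rewrite (@ge0_negligible_integral _ _ _ _ _ (~` (`[0%R, x] `*` setT)))//; last 2 first.
- exact: measurable_funTS.
- by rewrite /= /mrestr setICl measure0.
rewrite setDE setCK.
rewrite (_ : snd @^-1` `[0%R, 1%R] `&` (`[0%R, x] `*` setT) = `[0%R, x] `*` `[0%R, 1%R]); last first.
  by apply/seteqP; split=> p; [case=> ? []|case].
apply: eq_measure_integral => A mA AD; rewrite /= /mrestr setIidl//.
by apply: subset_trans AD _ => p [].
Qed.

Lemma integral_strip (x : R) (g : R -> R) : 0 < x -> x <= 1 ->
  {within `[0%R, 1%R], continuous g} ->
  (\int[strip mu x]_(y in `[0%R, 1%R]) (g y)%:E)%E =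
  (x^-1 * mean mu (fun p => \1_(`[0%R, x]%classic : set R) (clip p.1) * g (clip p.2)))%:E.
Proof.
move=> x0 x1 cg.
have cG := comp_clip_continuous cg.
have mG : measurable_fun setT (g \o clip) by exact: continuous_measurable_fun.
rewrite (eq_integral (fun y => ((g \o clip) y)%:E)); last first.
  by move=> y; rewrite inE /= in_itv /= => /clip_id ->.
have bG : bdd (fun p : R * R => g (clip p.2)).
  by apply: (bdd_comp_snd (G := g \o clip)); split=> //; exact: comp_clip_bounded.
have mI1 : measurable (`[0%R, x] `*` `[0%R, 1%R] : set (R * R)) by exact: measurableX.
have bF : bdd (fun p : R * R => \1_(`[0%R, x]%classic : set R) (clip p.1) * g (clip p.2)).
  by apply: bddM => //; apply: bdd_indic_clip_fst; exact: measurable_itv.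
rewrite EFinM -meanE//.
transitivity ((x^-1)%:E * \int[mu]_(p in `[0%R, x] `*` `[0%R, 1%R]) (g (clip p.2))%:E)%E.
  have mE : measurable_fun setT (fun y : R => ((g \o clip) y)%:E) by exact/measurable_EFinP.
  have pos := ge0_integral_strip x (measurable_funepos mE) (fun y => funepos_ge0 _ y).
  have neg := ge0_integral_strip x (measurable_funeneg mE) (fun y => funeneg_ge0 _ y).
  pose D : set (R * R) := `[0%R, x] `*` `[0%R, 1%R].
  pose h (p : R * R) := (g (clip p.2))%:E.
  have {}pos : (\int[strip mu x]_(y in `[0%R, 1%R]) (fun y => ((g \o clip) y)%:E)^\+ y =
      (x^-1)%:E * \int[mu]_(p in D) h^\+ p)%E.
    rewrite pos gtr0_norm//; congr (_ * _)%E.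
    by apply: eq_integral => p _; rewrite !funeposE.
  have {}neg : (\int[strip mu x]_(y in `[0%R, 1%R]) (fun y => ((g \o clip) y)%:E)^\- y =
      (x^-1)%:E * \int[mu]_(p in D) h^\- p)%E.
    rewrite neg gtr0_norm//; congr (_ * _)%E.
    by apply: eq_integral => p _; rewrite !funenegE.
  have bpos := integrable_funepos mI1 (integrableS measurableT mI1 (@subsetT _ _) (bdd_integrable mu bG)).
  rewrite [LHS]integralE pos neg.
  have -> : (\int[mu]_(p in D) h p = \int[mu]_(p in D) h^\+ p - \int[mu]_(p in D) h^\- p)%E.
    by rewrite [LHS]integralE.
  have fp : (\int[mu]_(p in D) h^\+ p)%E \is a fin_num by exact: (@integrable_fin_num _ _ _ mu D mI1 (h^\+)%E bpos).
  by rewrite (muleBr _ (fin_num_adde_defr _ fp)).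
congr (_ * _)%E.
have mQ : measurable (`[0%R, 1%R] `*` `[0%R, 1%R] : set (R * R)) by exact: measurableX.
rewrite integral_mkcond; apply: ae_eq_integral => //.
- apply/(measurable_restrictT _ mI1); apply: measurable_funTS.
  by apply/measurable_EFinP; exact: bG.1.
- by apply/measurable_EFinP; exact: bF.1.
exists (~` (`[0%R, 1%R] `*` `[0%R, 1%R])); split.
- exact: measurableC.
- by apply: etrans (probability_setC mu mQ) _; rewrite mu_permuton.1 subee.
move=> p np [xp yp]; apply: np => _ /=.
rewrite patchE; move: xp yp; rewrite /= !in_itv /= => xp yp.
rewrite (clip_id xp).
have [xx|xx] := leP p.1 x.
  rewrite indic1 ?mul1r; last by rewrite /= in_itv /=; case/andP: xp => ->.
  by case: ifPn => //; rewrite notin_setE; case; split; rewrite /= in_itv //=; case/andP: xp => ->.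
rewrite indic0 ?mul0r; last by rewrite /= in_itv /= => /andP[_]; rewrite leNgt xx.
by case: ifPn => //; rewrite inE => -[/= + _]; rewrite in_itv /= => /andP[_]; rewrite leNgt xx.
Qed.

End strip_mean.

(** * The leftmost point *)

Section first_point.
Context {R : realType} (mu : probability (R * R)%type R).
Hypothesis mu_permuton : permuton mu.

Lemma exprn_dist (u v : R) m : 0 <= u <= 1 -> 0 <= v <= 1 ->
  `|u ^+ m - v ^+ m| <= m%:R * `|u - v|.
Proof.
move=> /andP[u0 u1] /andP[v0 v1]; elim: m => [|m IH]; first by rewrite !expr0 subrr normr0 mul0r.
have -> : u ^+ m.+1 - v ^+ m.+1 = u ^+ m * (u - v) + (u ^+ m - v ^+ m) * v.
  by rewrite !exprSr; ring.
apply: (le_trans (ler_normD _ _)); rewrite !normrM -natr1 mulrDl mul1r addrC lerD//.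
  by rewrite (ger0_norm v0) (le_trans _ IH)// ler_piMr.
rewrite (@ger0_norm _ (u ^+ m)) ?exprn_ge0// ler_piMl//.
exact: exprn_ile1.
Qed.

Lemma heine1 (G : R -> R) (eps : R) : continuous G -> 0 < eps ->
  exists2 delta, 0 < delta & forall a b, 0 <= a <= 1 -> `|a - b| < delta -> `|G a - G b| <= eps.
Proof.
move=> cG eps0.
have cf : continuous (fun x : 'rV[R]_1 => G (x ord0 ord0)).
  by move=> x; apply: continuous_comp; [exact: coord_continuous|exact: cG].
have [delta delta0 H] := heine cf eps0; exists delta => // a b a01 ab.
have := H (\row_(i < 1) a) (\row_(i < 1) b); rewrite !mxE; apply => i; rewrite !mxE//.
Qed.

Section boxes.
Context (n L M : nat) d (T : measurableType d) (P : probability T R).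
Context (Z : 'I_n -> {RV P >-> (R * R)%type}).
Hypothesis Z_iid : iid Z mu.
Hypotheses (L0 : (0 < L)%N) (M0 : (0 < M)%N).

Definition cell2 (la : 'I_L * 'I_M) : set (R * R) := gridcell L la.1 `*` gridcell M la.2.

Definition beyond (l : nat) : R := 1 - l.+1%:R / L%:R.

Definition first_box (i : 'I_n) (la : 'I_L * 'I_M) (j : 'I_n) : set (R * R) :=
  if j == i then cell2 la else `[(la.1.+1%:R / L%:R), 1%R[ `*` setT.

(* The leftmost point is point [i], its cell is [la], and every other point
   lies to the right of that column. *)
Definition first_event (k : 'I_n * ('I_L * 'I_M)) : set T :=
  cylinder Z (enum 'I_n) (first_box k.1 k.2).

Lemma measurable_cell2 la : measurable (cell2 la).
Proof. by apply: measurableX; exact: measurable_gridcell. Qed.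

Lemma measurable_first_box i la j : measurable (first_box i la j).
Proof.
rewrite /first_box; case: ifP => _; first exact: measurable_cell2.
by apply: measurableX => //; exact: measurable_itv.
Qed.

Lemma measurable_first_event k : measurable (first_event k).
Proof. by apply: measurable_cylinder; exact: measurable_first_box. Qed.

Lemma beyond_itv (l : 'I_L) : 0 <= beyond l <= 1.
Proof.
rewrite /beyond subr_ge0 ler_pdivrMr ?ltr0n// mul1r ler_nat ltn_ord /= lerBlDr lerDl.
by rewrite divr_ge0.
Qed.

Lemma pr_first_event k :
  pr P (first_event k) = pr mu (cell2 k.2) * beyond k.2.1 ^+ n.-1.
Proof.
case: k => i la; rewrite /first_event (pr_cylinder Z_iid) ?enum_uniq//; last exact: measurable_first_box.
rewrite big_enum /= (bigD1 i)//= {1}/first_box eqxx; congr (_ * _).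
rewrite (eq_bigr (fun=> beyond la.1)); last first.
  move=> j ji; rewrite /first_box (negPf ji) (pr_permuton_itv_fst mu_permuton)//.
  by rewrite ler_pdivrMr ?ltr0n// mul1r ler_nat.
rewrite (eq_bigl (fun j => j \in predC1 i))// prodr_const cardC1 card_ord.
by case: (n) i => [[]|].
Qed.

Lemma cell2_inj p la la' : cell2 la p -> cell2 la' p -> la = la'.
Proof.
case: la la' => l a [l' a'] [/= /(gridcellP L0) h1 /(gridcellP M0) h2] [/= /(gridcellP L0) h3 /(gridcellP M0) h4].
by congr (_, _); apply: val_inj => /=; rewrite -?h1 -?h2 -?h3 -?h4.
Qed.

(** Two different leftmost points would each lie to the right of the column of the other. *)
Lemma first_event_inj w k k' : first_event k w -> first_event k' w -> k = k'.
Proof.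
case: k k' => i la [i' la'] h h'.
have ci : cell2 la (Z i w) by have := h i (mem_enum _ _); rewrite /first_box /= eqxx.
have ci' : cell2 la' (Z i' w) by have := h' i' (mem_enum _ _); rewrite /first_box /= eqxx.
have [ii|ii] := eqVneq i i'.
  by rewrite -ii in ci' *; rewrite (cell2_inj ci ci').
have [/= h1 _] : (`[(la.1.+1%:R / L%:R), 1%R[ `*` setT)%classic (Z i' w).
  by have := h i' (mem_enum _ _); rewrite /first_box /= eq_sym (negPf ii).
have [/= h2 _] : (`[(la'.1.+1%:R / L%:R), 1%R[ `*` setT)%classic (Z i w).
  by have := h' i (mem_enum _ _); rewrite /first_box /= (negPf ii).
case: ci ci' => [+ _] [+ _]; move: h1 h2; rewrite /gridcell /= !in_itv /=.
move=> /andP[h1 _] /andP[h2 _] /andP[h3 h4] /andP[h5 h6].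
have lt1 : (la.1.+1%:R / L%:R : R) < la'.1.+1%:R / L%:R by exact: le_lt_trans h1 h6.
have lt2 : (la'.1.+1%:R / L%:R : R) < la.1.+1%:R / L%:R by exact: le_lt_trans h2 h4.
by have := lt_trans lt1 lt2; rewrite ltxx.
Qed.

Lemma first_event_points k w : first_event k w ->
  [/\ cell2 k.2 (Z k.1 w),
      sorted (fun i j => (Z i w).1 < (Z j w).1) [:: k.1]
    & forall i j, i \notin [:: k.1] -> j \in [:: k.1] -> (Z j w).1 < (Z i w).1].
Proof.
case: k => i la h.
have ci : cell2 la (Z i w) by have := h i (mem_enum _ _); rewrite /first_box /= eqxx.
split => // j k; rewrite !inE /= => ji /eqP ->.
have [/= h1 _] : (`[(la.1.+1%:R / L%:R), 1%R[ `*` setT)%classic (Z j w).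
  by have := h j (mem_enum _ _); rewrite /first_box /= (negPf ji).
case: ci => [+ _]; move: h1; rewrite /gridcell /= !in_itv /= => /andP[h1 _] /andP[_ h2].
exact: lt_le_trans h2 h1.
Qed.

(** In a regular sample a leftmost point exists, and its column contains no other point unless two
    points share a column. *)
Lemma first_event_cover delta (N : set T) : measurable N -> (0 < n)%N ->
  (forall w, ~ N w -> regular M delta (fun i => Z i w)) ->
  1 - (pr P N + n%:R ^+ 2 / L%:R) <= \sum_k pr P (first_event k).
Proof.
move=> mN n0 reg.
pose C (l : 'I_L) : set (R * R) := gridcell L l `*` setT.
have mC l : measurable (C l) by apply: measurableX => //; exact: measurable_gridcell.
pose U2 := shared Z id C.
have mU2 : measurable U2 by exact: measurable_shared.
have pU2 : pr P U2 <= n%:R ^+ 2 / L%:R.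
  apply: (@le_trans _ _ (n%:R ^+ 2 * (pr mu setT * L%:R^-1))); last by rewrite prT mul1r.
  apply: (pr_shared Z_iid) => //.
  - by move=> [x y] a b [/= /(gridcellP L0) ax _] [/= /(gridcellP L0) bx _]; apply: val_inj; rewrite /= -ax -bx.
  - move=> l; rewrite /C /gridcell (pr_permuton_itv_fst mu_permuton).
    + by rewrite -natr1 mulrDl mul1r addrAC subrr add0r.
    + by rewrite divr_ge0.
    + by rewrite ler_pM2r ?invr_gt0 ?ltr0n// ler_nat.
    + by rewrite ler_pdivrMr ?ltr0n// mul1r ler_nat.
apply: (@le_trans _ _ (pr P (~` (N `|` U2)))).
  rewrite pr_setC; last exact: measurableU.
  by rewrite lerB// (le_trans (pr_setU_le P mN mU2))// lerD2l.
apply: (@pr_bigU _ _ _ P _ predT) => //.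
- exact: measurable_first_event.
- by apply: measurableC; exact: measurableU.
move=> w /not_orP[/reg[injx injy x01 y01 _] nU2].
pose i := [arg min_(i < Ordinal n0) (Z i w).1]%O.
have imin j : (Z i w).1 <= (Z j w).1 by rewrite /i; case: arg_minP => // k _; exact.
have pos (z : R) (D : nat) : (0 < D)%N -> 0 < z < 1 -> (gridpos D z < D)%N /\ gridcell D (gridpos D z) z.
  by move=> D0 /andP[z0 z1]; split; [apply: gridpos_lt => //; rewrite (ltW z0)|apply: gridcell_pos => //; exact: ltW].
have [lL lcell] := pos _ _ L0 (x01 i); have [aM acell] := pos _ _ M0 (y01 i).
exists (i, (Ordinal lL, Ordinal aM)) => // j _; rewrite /first_box /=.
case: eqVneq => [->|ji]; first by split.
split => //=; rewrite in_itv /=; have /andP[xj0 ->] := x01 j; rewrite andbT.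
have [jL jcell] := pos _ _ L0 (x01 j).
have : (gridpos L (Z i w).1 < gridpos L (Z j w).1)%N.
  rewrite ltn_neqAle gridpos_le ?imin// andbT; apply/negP => /eqP e.
  apply: nU2; exists j, i, (Ordinal lL); split=> //; split=> //=; by rewrite e.
move=> lt; have /andP[h _] := grid_itv L0 (ltW xj0); apply: le_trans h.
by rewrite /grid ler_pM2r ?invr_gt0 ?ltr0n// ler_nat.
Qed.

End boxes.

Lemma tree_gap_singleton (x : R) : tree_gap (bst [:: x]) [:: false] = x.
Proof. by rewrite /tree_gap /tree_right /tree_left /last_turn /= subr0. Qed.

(** The factor [n] counts the choices of the leftmost point, and the weight [(1 - t) ^+ n.-1] is the
    probability that all others lie to its right. The cells give a Riemann sum for this formula. *)
Lemma expectation_first_point (G : R -> R) (C eps : R) :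
  continuous G -> 0 < C -> (forall y, `|G y| <= C) -> 0 < eps ->
  exists n0, forall n, (n0 <= n)%N ->
  forall d (T : measurableType d) (P : probability T R) (Z : 'I_n -> {RV P >-> (R * R)%type}),
    iid Z mu ->
  exists2 x, ('E_P[fun w => G (subtree_ratio (bst_points (random_points Z w)) [:: false])] = x%:E)%E
    & `|x - n%:R * mean mu (fun p => (1 - clip p.1) ^+ n.-1 * G p.2)| <= eps.
Proof.
move=> cG C0 GC eps0.
have eps80 : 0 < eps / 8 by rewrite divr_gt0.
have [delta delta0 HG] := heine1 cG eps80.
have [M1 HM1] := natr_above (4 / delta).
pose M := M1.+1; have M0 : (0 < M)%N by [].
have M0R : 0 < M%:R :> R by rewrite ltr0n.
have Md : M%:R^-1 < delta / 4.
  by rewrite invf_plt ?posrE ?divr_gt0// invf_div; apply: HM1.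
pose delta' := delta / 8; have delta'0 : 0 < delta' by rewrite divr_gt0.
pose e := eps / (8 * C); have e0 : 0 < e by rewrite divr_gt0// mulr_gt0.
have eC : C * e = eps / 8 by rewrite /e; field; rewrite gt_eqF.
have de0 : 0 < delta' ^+ 2 * e by rewrite mulr_gt0 ?exprn_gt0.
clearbody e.
have [n2 Hn2] := natr_above (M.+1%:R / (delta' ^+ 2 * e)).
exists n2.+1 => n nn d T P Z Z_iid.
have n0 : (0 < n)%N by apply: leq_trans nn.
have n0R : 0 < n%:R :> R by rewrite ltr0n.
have [N [mN pN] HN] := pr_irregular mu_permuton Z_iid M0 n0 delta'0.
have {}pN : pr P N <= e.
  apply: (le_trans pN).
  have : M.+1%:R / (delta' ^+ 2 * e) < n%:R by apply: Hn2; exact: ltnW.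
  rewrite ltr_pdivrMr// => h.
  rewrite ler_pdivrMr; first by lra.
  by rewrite mulr_gt0// exprn_gt0.
(* The columns depend on [n], since they must separate all [n] points. *)
have [L1 HL1] := natr_above (n%:R ^+ 2 / e); pose L := L1.+1; have L0 : (0 < L)%N by [].
have L0R : 0 < L%:R :> R by rewrite ltr0n.
have nL : n%:R ^+ 2 / L%:R <= e.
  have : n%:R ^+ 2 / e < L%:R by apply: HL1.
  by rewrite ltr_pdivrMr// ler_pdivrMr// mulrC => /ltW.
pose Gc (k : 'I_L * 'I_M) : R := G (k.2%:R / M%:R).
pose q (k : 'I_n * ('I_L * 'I_M)) := pr P (first_event Z k).
have Q1 : \sum_k q k <= 1.
  rewrite -(prT P); apply: sum_pr_le => //.
  - exact: measurable_first_event.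
  - by move=> w k k' _ _; exact: first_event_inj.
have Qge : 1 - 2 * e <= \sum_k q k.
  have := first_event_cover Z_iid L0 M0 mN n0 HN; rewrite -/q; lra.
have [x Ex Hx] : exists2 x, ('E_P[fun w => G (subtree_ratio (bst_points (random_points Z w)) [:: false])] = x%:E)%E &
    `|x - \sum_k Gc k.2 * q k| <= eps / 8 + C * (1 - \sum_k q k) + 2 * C * pr P N.
  apply: (@step_expectation _ _ _ P _ predT (first_event Z)) => //.
  - exact: measurable_first_event.
  - by move=> w k k' _ _; exact: first_event_inj.
  - exact: ltW.
  - by move=> k _; exact: GC.
  - by move=> k _; rewrite pr_ge0 lexx.
  - move=> k w _ /first_event_points[[ck1 ck2] sk gap] /HN reg.
    pose a : {ffun 'I_1 -> 'I_M} := [ffun=> k.2.2].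
    have ts : type_seq a = [:: k.2.2%:R / M%:R] :> seq R.
      by rewrite /type_seq enum_ordSl enum_ord0 /= ffunE.
    have ainj : injective a by move=> i j _; rewrite !ord1.
    have ht : has_types a [seq (Z i w).2 | i <- [:: k.1]].
      by split => // j; rewrite ord1 /= ffunE.
    have anc : ancestors (bst (type_seq a : seq R)) [:: false] by rewrite ts; case.
    have := subtree_ratio_types_dist M0 n0 (ltW delta'0) reg sk gap ainj ht anc.
    rewrite ts tree_gap_singleton => h; rewrite distrC; apply: HG.
      by rewrite divr_ge0//= ler_pdivrMr// mul1r ler_nat ltnW.
    by rewrite distrC; apply: le_lt_trans h _; rewrite /delta'; lra.
exists x => //.
pose b (l : nat) : R := beyond L l ^+ n.-1.
pose st (c : 'I_L * 'I_M -> R) (p : R * R) : R := \sum_k c k * \1_(cell2 k) p.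
have mc := @measurable_cell2 L M.
have bst_ c : bdd (st c) by apply: bdd_sum => k; apply: bddZ; exact: bdd_indic.
have mean_st c : mean mu (st c) = \sum_k c k * pr mu (cell2 k).
  rewrite /st mean_sum; last by move=> k; apply: bddZ; exact: bdd_indic.
  by apply: eq_bigr => k _; rewrite meanZ ?mean_indic//; exact: bdd_indic.
have sumE c : \sum_k c k.2 * q k = n%:R * mean mu (st (fun la => c la * b la.1)).
  rewrite mean_st -(pair_big predT predT (fun i la => c la * q (i, la))) /=.
  rewrite (eq_bigr (fun=> \sum_la c la * b la.1 * pr mu (cell2 la))).
    by rewrite sumr_const card_ord -[LHS]mulr_natl.
  move=> i _; apply: eq_bigr => la _; rewrite /q (pr_first_event Z_iid L0)/= /b.
  by rewrite -mulrA [pr mu _ * _]mulrC.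
pose F (p : R * R) := (1 - clip p.1) ^+ n.-1 * G p.2.
have mG : measurable_fun setT G by exact: continuous_measurable_fun.
have bG : bdd (fun p : R * R => G p.2) by apply: bdd_comp_snd; split=> //; exists C.
have bF : bdd F by apply: bddM => //; exact: bdd_weight.
pose out : set (R * R) := ~` (`[0%R, 1%R[ `*` `[0%R, 1%R[).
have mI : measurable (`[0%R, 1%R[%classic : set R) by exact: measurable_itv.
have mout : measurable out by apply: measurableC; exact: measurableX.
have pout : pr mu out = 0 by exact: (pr_permuton_square mu_permuton true true).
(* Errors from rounding the second coordinate in [G], from rounding the first in the weight (by
   [exprn_dist]), and from points in no cell. *)
pose H (p : R * R) := eps / 8 * st (fun la => b la.1) p + C * (n%:R / L%:R) + C * \1_out p.
have pw p : `|st (fun la => Gc la * b la.1) p - F p| <= H p.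
  have [po|pno] := pselect (out p).
    have no (la : 'I_L * 'I_M) : ~ cell2 la p.
      move=> [c1 c2]; apply: po; split; rewrite /= in_itv /=.
        move: c1; rewrite /gridcell /= in_itv /= => /andP[h1 h2]; apply/andP; split.
          by apply: le_trans h1; rewrite divr_ge0.
        by apply: (lt_le_trans h2); rewrite ler_pdivrMr// mul1r ler_nat.
      move: c2; rewrite /gridcell /= in_itv /= => /andP[h1 h2]; apply/andP; split.
        by apply: le_trans h1; rewrite divr_ge0.
      by apply: (lt_le_trans h2); rewrite ler_pdivrMr// mul1r ler_nat.
    rewrite /H /st !sum_indic0// sub0r normrN mulr0 add0r indic1// mulr1.
    apply: (@le_trans _ _ C); last by rewrite lerDr mulr_ge0 ?(ltW C0)// divr_ge0.
    have w1 : `|1 - clip p.1| <= 1.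
      by have /andP[? ?] := clip_itv p.1; rewrite ger0_norm; lra.
    by rewrite /F normrM -[C]mul1r ler_pM// normrX exprn_ile1.
  move: pno => /contrapT[/=]; rewrite !in_itv /= => /andP[x0 x1] /andP[y0 y1].
  have lL : (gridpos L p.1 < L)%N by rewrite gridpos_lt// x0.
  have aM : (gridpos M p.2 < M)%N by rewrite gridpos_lt// y0.
  pose la := (Ordinal lL, Ordinal aM).
  have cla : cell2 la p by split; exact: gridcell_pos.
  have d2 w (i j : 'I_L * 'I_M) : predT i -> predT j -> cell2 i w -> cell2 j w -> i = j.
    by move=> _ _; exact: cell2_inj.
  rewrite /H /st !(sum_indic d2 _ _ cla)// indic0; last first.
    by move=> h; apply: h; split; rewrite /= in_itv /= ?x0 ?y0.
  rewrite mulr0 addr0 /F.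
  have -> : clip p.1 = p.1 by rewrite clip_id// x0 ltW.
  have -> : Gc la * b la.1 - (1 - p.1) ^+ n.-1 * G p.2 =
     (Gc la - G p.2) * b la.1 + G p.2 * (b la.1 - (1 - p.1) ^+ n.-1) by ring.
  have /andP[bl0 bl1] := beyond_itv L0 (Ordinal lL).
  have b0 : 0 <= b la.1 by rewrite exprn_ge0.
  have /andP[gx1 gx2] := grid_itv L0 x0.
  have /andP[gy1 gy2] := grid_itv M0 y0.
  apply: (le_trans (ler_normD _ _)); rewrite !normrM (ger0_norm b0) lerD//.
    rewrite ler_wpM2r//; apply: HG; first by rewrite -/(grid M p.2) (le_trans gy1 (ltW y1)) divr_ge0.
    rewrite -/(grid M p.2); move: (M%:R^-1) Md gy2 => u Md gy2; rewrite ltr_norml; clear - Md gy1 gy2 delta0; apply/andP; split; lra.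
  apply: ler_pM => //; apply: (le_trans (exprn_dist _ _ _)).
  - by rewrite bl0.
  - by clear - x0 x1; apply/andP; split; lra.
  - apply: ler_pM => //; first by rewrite ler_nat leq_pred.
    rewrite /beyond /= -natr1 mulrDl mul1r -/(grid L p.1).
    move: (L%:R^-1) gx2 => u gx2; rewrite ler_norml; clear - gx1 gx2; apply/andP; split; lra.
have bstb := bst_ (fun la => b la.1).
have bind : bdd (fun p => C * \1_out p : R) by apply: bddZ; exact: bdd_indic.
have bs1 : bdd (fun p => eps / 8 * st (fun la => b la.1) p) by exact: bddZ.
have bs2 : bdd (fun p => eps / 8 * st (fun la => b la.1) p + C * (n%:R / L%:R)).
  by apply: bddD => //; exact: bdd_cst.
have bH : bdd H by exact: bddD.
have meanH : mean mu H = eps / 8 * mean mu (st (fun la => b la.1)) + C * (n%:R / L%:R).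
  rewrite /H meanD// meanD//; last exact: bdd_cst.
  by rewrite meanZ// mean_cst meanZ ?mean_indic ?pout ?mulr0 ?addr0//; exact: bdd_indic.
have dist : `|mean mu (st (fun la => Gc la * b la.1)) - mean mu F| <= mean mu H.
  rewrite -meanB//; apply: mean_norm_le => //; exact: bddB.
have dist2 : `|n%:R * mean mu (st (fun la => Gc la * b la.1)) - n%:R * mean mu F| <= eps / 8 + eps / 8.
  rewrite -mulrBr normrM (ger0_norm (ltW n0R)).
  apply: (le_trans (ler_wpM2l (ltW n0R) dist)); rewrite meanH mulrDr lerD//.
    (* The factor [n] does not amplify this error: [n] times the mean weight is the total
       probability of disjoint events. *)
    rewrite mulrCA; have <- : \sum_k 1 * q k = n%:R * mean mu (st (fun la => b la.1)).
      rewrite (sumE (fun=> 1)); congr (_ * mean mu _); apply/funext => p.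
      by apply: eq_bigr => la _; rewrite mul1r.
    by under eq_bigr do rewrite mul1r; rewrite ler_piMr// ltW.
  rewrite mulrCA -eC ler_pM2l// (le_trans _ nL)// expr2 mulrA; lra.
move: Hx; rewrite (sumE Gc) -/F => Hx.
have h1 : C * (1 - \sum_k q k) <= C * (2 * e) by rewrite ler_pM2l//; lra.
have h2 : C * pr P N <= C * e by rewrite ler_pM2l.
move: Hx dist2 h1 h2; rewrite mulrCA eC -mulrA !ler_norml.
by clear - eps0 => /andP[? ?] /andP[? ?] ? ?; apply/andP; split; lra.
Qed.

End first_point.

(** * A Tauberian argument *)

Section power_bounds.
Context {R : realType}.

Lemma exprD_ge (y : R) m : 0 <= y -> 1 + m%:R * y <= (1 + y) ^+ m.
Proof.
move=> y0; elim: m => [|m IH]; first by rewrite mul0r addr0 expr0.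
rewrite exprSr; apply: (@le_trans _ _ ((1 + m%:R * y) * (1 + y))).
  rewrite -natr1 [leRHS](_ : _ = 1 + (m%:R + 1) * y + m%:R * y ^+ 2); last by ring.
  by rewrite lerDl mulr_ge0 ?exprn_ge0.
by rewrite ler_pM2r//; lra.
Qed.

(** A rational substitute for [exp (- m y)], from [(1 - y) (1 + y) <= 1] and Bernoulli's
    inequality. *)
Lemma exprB_mul_le1 (y : R) m : 0 <= y <= 1 -> (1 - y) ^+ m * (1 + m%:R * y) <= 1.
Proof.
move=> /andP[y0 y1].
apply: (@le_trans _ _ ((1 - y) ^+ m * (1 + y) ^+ m)).
  by rewrite ler_wpM2l ?exprD_ge// exprn_ge0//; lra.
rewrite -exprMn exprn_ile1//; first by rewrite mulr_ge0//; lra.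
rewrite (_ : _ * _ = 1 - y ^+ 2); last by ring.
by rewrite lerBlDr lerDl exprn_ge0.
Qed.

Lemma exprB_ge (y : R) m : 0 <= y <= 1 -> 1 - m%:R * y <= (1 - y) ^+ m.
Proof.
move=> /andP[y0 y1]; elim: m => [|m IH]; first by rewrite mul0r subr0 expr0.
rewrite exprSr -natr1.
have : (1 - m%:R * y) * (1 - y) <= (1 - y) ^+ m * (1 - y) by rewrite ler_wpM2r//; lra.
apply: le_trans; rewrite [leRHS](_ : _ = 1 - (m%:R + 1) * y + m%:R * y ^+ 2); last by ring.
by rewrite lerDl mulr_ge0 ?exprn_ge0.
Qed.

(* A polynomial divisible by [u ^+ j] that approaches the indicator of
   [1/2, 1] on [0, 1], away from 1/2, as [j] grows. *)
Definition cutoff j (u : R) : R := 1 - (1 - u ^+ j) ^+ (2 ^ j)%N.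

Lemma cutoff_itv j u : 0 <= u <= 1 -> 0 <= cutoff j u <= 1.
Proof.
move=> /andP[u0 u1]; rewrite /cutoff.
have a0 : 0 <= u ^+ j by exact: exprn_ge0.
have a1 : u ^+ j <= 1 by exact: exprn_ile1.
have b0 : 0 <= (1 - u ^+ j) ^+ (2 ^ j)%N by rewrite exprn_ge0//; lra.
have b1 : (1 - u ^+ j) ^+ (2 ^ j)%N <= 1 by rewrite exprn_ile1//; lra.
by apply/andP; split; lra.
Qed.

(** The error [(1 - u ^+ j) ^+ (2 ^ j)] is at most [1 / (1 + (2 u) ^+ j)], and [2 u >= 1 + e]. *)
Lemma cutoff_gt j (u e : R) : 0 <= e -> (1 + e) / 2 <= u <= 1 ->
  `|cutoff j u - 1| * (1 + j%:R * e) <= 1.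
Proof.
move=> e0 /andP[u0 u1]; have u00 : 0 <= u by lra.
have aitv : 0 <= u ^+ j <= 1 by rewrite exprn_ge0// exprn_ile1.
rewrite /cutoff addrAC subrr add0r normrN ger0_norm; last first.
  by rewrite exprn_ge0//; case/andP: aitv => *; lra.
apply: le_trans (exprB_mul_le1 (2 ^ j)%N aitv).
rewrite ler_wpM2l//; first by rewrite exprn_ge0//; case/andP: aitv => *; lra.
rewrite natrX -exprMn.
apply: (@le_trans _ _ ((1 + e) ^+ j)); last first.
  apply: (@le_trans _ _ ((2 * u) ^+ j)); last by rewrite lerDr.
  by rewrite lerXn2r ?nnegrE//; lra.
exact: exprD_ge.
Qed.

(** Bernoulli's inequality gives [(2 u) ^+ j.+1]. One factor [u] is kept so that the mean of the
    bound is again a moment, of order [1 / n]. *)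
Lemma cutoff_lt j (u e : R) : 0 <= u <= (1 - e) / 2 -> 0 <= e ->
  cutoff j.+1 u <= 2 * (1 - e) ^+ j * u.
Proof.
move=> /andP[u0 u1] e0.
have aitv : 0 <= u ^+ j.+1 <= 1 by rewrite exprn_ge0// exprn_ile1//; lra.
rewrite /cutoff; have := exprB_ge (2 ^ j.+1)%N aitv; rewrite natrX -exprMn => h.
apply: (@le_trans _ _ ((2 * u) ^+ j.+1)); first by lra.
rewrite exprS [leRHS]mulrAC ler_wpM2l//; first by lra.
by rewrite lerXn2r ?nnegrE//; lra.
Qed.

(** The least exponent at which the power drops below 1/2, found without logarithms; the bounds on
    powers locate it within constant factors of [1 / x]. *)
Lemma halving_time (x : R) : 0 < x <= 1 / 8 ->
  exists2 N, (1 - x) ^+ N.+1 < 1 / 2 <= (1 - x) ^+ N & 1 / 2 < N.+1%:R * x <= 2.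
Proof.
move=> /andP[x0 x1]; have x01 : 0 <= x <= 1 by apply/andP; split; lra.
have ex : exists N, (1 - x) ^+ N < 1 / 2.
  have [N HN] := natr_above (1 / x); exists N.
  have := exprB_mul_le1 N x01; have := HN N (leqnn _).
  rewrite ltr_pdivrMr// => Nx Nle.
  have p0 : 0 < (1 - x) ^+ N by rewrite exprn_gt0//; lra.
  have : (1 - x) ^+ N * 2 < (1 - x) ^+ N * (1 + N%:R * x) by rewrite ltr_pM2l//; lra.
  lra.
case: (ex_minnP ex) => -[|N] HN minN; first by exfalso; move: HN; rewrite expr0; lra.
have half_le : 1 / 2 <= (1 - x) ^+ N by rewrite leNgt; apply/negP => /minN; rewrite ltnn.
exists N; first by rewrite HN.
have h1 := exprB_ge N.+1 x01; have h2 := exprB_mul_le1 N x01.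
have Nx0 : 0 <= N%:R * x by rewrite mulr_ge0// ltW.
have h3 : 1 / 2 * (1 + N%:R * x) <= (1 - x) ^+ N * (1 + N%:R * x) by rewrite ler_wpM2r//; lra.
apply/andP; split; first by lra.
by rewrite -natr1 mulrDl mul1r; lra.
Qed.

(* [(1 - t) ^+ N.+1] crosses 1/2 where [t] crosses [x]. *)
Lemma cutoff_dist (x e t : R) N j : 0 <= t <= 1 -> 0 < e <= 1 / 4 -> 0 < x <= e / 2 ->
  (1 - x) ^+ N.+1 < 1 / 2 <= (1 - x) ^+ N ->
  `|\1_(`[0%R, x]%classic : set R) (t) - cutoff j.+1 ((1 - t) ^+ N.+1)| <=
  (1 + j.+1%:R * e)^-1 * \1_(`[0%R, x]%classic : set R) (t) +
  2 * (1 - 2 * e) ^+ j * (1 - t) ^+ N.+1 +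
  \1_(`[x - 4 * e / N.+1%:R, x + 4 * e / N.+1%:R]%classic : set R) (t).
Proof.
move=> /andP[t0 t1] /andP[e0 e1] /andP[x0 x1] /andP[N1 N2].
have w0 : 0 <= 1 - t by lra.
have w1 : 1 - t <= 1 by lra.
have uitv : 0 <= (1 - t) ^+ N.+1 <= 1 by rewrite exprn_ge0// exprn_ile1.
have /andP[u0 u1] := uitv; have /andP[c0 c1] := cutoff_itv j.+1 uitv.
have q0 : 0 <= 2 * (1 - 2 * e) ^+ j * (1 - t) ^+ N.+1.
  by rewrite !mulr_ge0// exprn_ge0//; lra.
have je0 : 0 < 1 + j.+1%:R * e by rewrite addr_gt0// mulr_gt0.
have inv0 : 0 <= (1 + j.+1%:R * e)^-1 by rewrite invr_ge0 ltW.
have NR0 : 0 < N.+1%:R :> R by rewrite ltr0n.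
have i1 (A : set R) z : 0 <= (\1_A z : R) <= 1 by rewrite indicE ler0n lern1 leq_b1.
have /andP[a0 a1] := i1 (`[0%R, x]%classic) (t).
(* Near the crossing nothing is claimed, and the last indicator pays for the error. *)
have [near|far] := pselect (`[x - 4 * e / N.+1%:R, x + 4 * e / N.+1%:R]%classic (t)).
  rewrite [X in _ <= _ + X]indic1//.
  have : 0 <= (1 + j.+1%:R * e)^-1 * \1_(`[0%R, x]%classic : set R) (t) by rewrite mulr_ge0.
  by move=> ?; rewrite ler_norml; apply/andP; split; lra.
rewrite [X in _ <= _ + X]indic0// addr0.
have {}far : 4 * e <= N.+1%:R * `|t - x|.
  rewrite leNgt; apply/negP; rewrite mulrC -ltr_pdivlMr// ltr_norml.
  move: far; move: (4 * e / N.+1%:R) => k far /andP[? ?].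
  by apply: far; rewrite /= in_itv /=; apply/andP; split; lra.
have [tx|xt] := leP (t) x.
  rewrite indic1 ?mulr1; last by rewrite /= in_itv /= t0.
  apply: (@le_trans _ _ (1 + j.+1%:R * e)^-1); last by rewrite lerDl.
  rewrite distrC -[leRHS]mul1r ler_pdivlMr//; apply: cutoff_gt; first exact: ltW.
  rewrite u1 andbT.
  have s0 : 0 <= x - t by lra.
  rewrite distrC ger0_norm// in far.
  (* The power at [t] is compared with the one at [x], which is at least [(1 - x) / 2]; being far
     from [x] brings a Bernoulli gain of [1 + 4 * e]. *)
  apply: (@le_trans _ _ ((1 - x) ^+ N.+1 * (1 + (x - t)) ^+ N.+1)); last first.
    rewrite -exprMn lerXn2r ?nnegrE//; first by rewrite mulr_ge0//; lra.
    rewrite [leLHS](_ : _ = 1 - t - x * (x - t)); last by ring.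
    by rewrite lerBlDr lerDl mulr_ge0// ltW.
  have b : 1 + 4 * e <= (1 + (x - t)) ^+ N.+1.
    have s1 : 0 <= x - t by lra.
    apply: (@le_trans _ _ (1 + N.+1%:R * (x - t))); first by lra.
    exact: exprD_ge.
  apply: (@le_trans _ _ ((1 / 2 * (1 - x)) * (1 + 4 * e))).
    have : 0 <= (e / 2 - x) * (1 + 4 * e) by rewrite mulr_ge0//; lra.
    have : 0 <= e * (1 / 4 - e) by rewrite mulr_ge0//; lra.
    lra.
  apply: ler_pM => //; [by rewrite mulr_ge0//; lra|by lra|].
  by rewrite exprSr ler_wpM2r//; lra.
rewrite indic0 ?mulr0 ?add0r; last by rewrite /= in_itv /= t0 leNgt xt.
rewrite normrN ger0_norm//; apply: cutoff_lt; last by lra.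
rewrite u0 /=.
have s0 : 0 <= t - x by lra.
rewrite ger0_norm// in far.
have s01 : 0 <= t - x <= 1 by rewrite s0; lra.
apply: (@le_trans _ _ ((1 - x) ^+ N.+1 * (1 - (t - x)) ^+ N.+1)).
  rewrite -exprMn lerXn2r ?nnegrE//; first by rewrite mulr_ge0//; lra.
  rewrite [leRHS](_ : _ = 1 - t + x * (t - x)); last by ring.
  by rewrite lerDl mulr_ge0// ltW.
rewrite mulrC; apply: ler_pM; rewrite ?exprn_ge0//; [lra|lra| |lra].
have := exprB_mul_le1 N.+1 s01.
have v0 : 0 <= (1 - (t - x)) ^+ N.+1 by rewrite exprn_ge0//; lra.
move: far v0; move: (N.+1%:R * (t - x)) ((1 - (t - x)) ^+ N.+1) => k v far v0 kv.
have h1 : v * (1 + 4 * e) <= 1.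
  by apply: le_trans kv; rewrite ler_wpM2l//; lra.
have h2 : 1 <= (1 - 2 * e) * (1 + 4 * e).
  have : 0 <= e * (1 / 4 - e) by rewrite mulr_ge0//; lra.
  lra.
by rewrite -(@ler_pM2r _ (1 + 4 * e)); [exact: le_trans h1 h2|lra].
Qed.

End power_bounds.

Section tauberian.
Context d (T : measurableType d) {R : realType} (mu : probability T R).
Context (t h : T -> R) (B : R).
Hypothesis t_measurable : measurable_fun setT t.
Hypothesis t_itv : forall p, 0 <= t p <= 1.
Hypothesis t_uniform : forall x, 0 <= x <= 1 ->
  mean mu (fun p => \1_(`[0%R, x]%classic : set R) (t p)) = x.
Hypothesis t_density : forall a b, a <= b ->
  mean mu (fun p => \1_(`[a, b]%classic : set R) (t p)) <= b - a.
Hypothesis h_measurable : measurable_fun setT h.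
Hypothesis B0 : 0 < B.
Hypothesis hB : forall p, `|h p| <= B.

Let w p := 1 - t p.

Let w_itv p : 0 <= w p <= 1.
Proof. by rewrite /w; have /andP[? ?] := t_itv p; apply/andP; split; lra. Qed.

Hypothesis moments_h : forall eps, 0 < eps ->
  exists n0, forall n, (n0 <= n)%N -> `|n.+1%:R * mean mu (fun p => w p ^+ n * h p)| <= eps.
Hypothesis moments_1 : exists n0, forall n, (n0 <= n)%N ->
  n.+1%:R * mean mu (fun p => w p ^+ n) <= 2.

Let bt : bdd t.
Proof. by split=> //; exists 1 => p; have /andP[? ?] := t_itv p; rewrite ger0_norm. Qed.

Let bw : bdd w. Proof. by apply: bddB => //; exact: bdd_cst. Qed.

Let bh : bdd h. Proof. by split=> //; exists B. Qed.

Let bind (A : set R) : measurable A -> bdd (fun p => \1_A (t p) : R).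
Proof.
move=> mA; split; first by apply: measurableT_comp => //; exact: measurable_indic.
by exists 1 => p; rewrite indicE ger0_norm// lern1 leq_b1.
Qed.

Definition vanishing (F : nat -> T -> R) := forall eps : R, 0 < eps ->
  exists n0, forall n, (n0 <= n)%N -> `|n%:R * mean mu (F n)| <= eps.

Lemma vanishingD F G : (forall n, bdd (F n)) -> (forall n, bdd (G n)) ->
  vanishing F -> vanishing G -> vanishing (fun n p => F n p + G n p).
Proof.
move=> bF bG vF vG eps eps0; have eps20 : 0 < eps / 2 by rewrite divr_gt0.
have [n1 H1] := vF _ eps20; have [n2 H2] := vG _ eps20.
exists (maxn n1 n2) => n; rewrite geq_max => /andP[/H1 h1 /H2 h2].
rewrite meanD// mulrDr (le_trans (ler_normD _ _))//; lra.
Qed.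

Lemma vanishingN F : (forall n, bdd (F n)) -> vanishing F -> vanishing (fun n p => -1 * F n p).
Proof.
move=> bF vF eps eps0; have [n1 H1] := vF _ eps0.
by exists n1 => n /H1; rewrite meanZ// mulN1r mulrN normrN.
Qed.

(** Expanding one factor [1 - u ^+ j] replaces the exponent [i] by [i] and [i + j]. Both stay
    positive, which the base case needs: it is a moment of order [n * i]. *)
Lemma vanishing_moment i j m : (0 < i)%N ->
  vanishing (fun n p => w p ^+ (n * i) * (1 - (w p ^+ n) ^+ j) ^+ m * h p).
Proof.
elim: m i => [|m IH] i i0.
  move=> eps /moments_h[n0 H]; exists n0 => n nn.
  have ni : (n <= n * i)%N by rewrite leq_pmulr.
  apply: le_trans (H (n * i)%N (leq_trans nn ni)).
  rewrite !normrM !normr_nat.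
  under [X in _ * `|mean mu X| <= _]eq_fun do rewrite expr0 mulr1.
  by rewrite ler_wpM2r// ler_nat (leq_trans ni).
have -> : (fun n p => w p ^+ (n * i) * (1 - (w p ^+ n) ^+ j) ^+ m.+1 * h p) =
  fun n p => w p ^+ (n * i) * (1 - (w p ^+ n) ^+ j) ^+ m * h p +
    -1 * (w p ^+ (n * (i + j)) * (1 - (w p ^+ n) ^+ j) ^+ m * h p).
  apply/funext => n; apply/funext => p.
  by rewrite mulnDr exprD (exprM _ n j) exprS; ring.
have b k n : bdd (fun p => w p ^+ (n * k) * (1 - (w p ^+ n) ^+ j) ^+ m * h p).
  apply: bddM => //; apply: bddM; first exact: bddX.
  by apply: bddX; apply: bddB; [exact: bdd_cst|do 2 apply: bddX].
apply: vanishingD => //; first by move=> n; apply: bddZ.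
- exact: IH.
- by apply: vanishingN => //; apply: IH; rewrite addn_gt0 i0.
Qed.

Let bdd_cutoff j n : bdd (fun p => cutoff j (w p ^+ n)).
Proof.
apply: bddB; first exact: bdd_cst.
by apply: bddX; apply: bddB; [exact: bdd_cst|do 2 apply: bddX].
Qed.

(** The cutoff is the telescoping sum of the terms [u ^+ j * (1 - u ^+ j) ^+ m] for [m < 2 ^ j]. *)
Lemma vanishing_cutoff j : (0 < j)%N -> vanishing (fun n p => cutoff j (w p ^+ n) * h p).
Proof.
move=> j0; rewrite /cutoff; elim: (2 ^ j)%N => [|m IH].
  move=> eps eps0; exists 0 => n _.
  under [X in mean mu X]eq_fun do rewrite expr0 subrr mul0r.
  by rewrite mean_cst mulr0 normr0 ltW.
have -> : (fun n p => (1 - (1 - (w p ^+ n) ^+ j) ^+ m.+1) * h p) =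
  fun n p => (1 - (1 - (w p ^+ n) ^+ j) ^+ m) * h p +
     w p ^+ (n * j) * (1 - (w p ^+ n) ^+ j) ^+ m * h p.
  apply/funext => n; apply/funext => p.
  by rewrite (exprM _ n j) exprS; ring.
have b n : bdd (fun p => (1 - (w p ^+ n) ^+ j) ^+ m).
  by apply: bddX; apply: bddB; [exact: bdd_cst|do 2 apply: bddX].
apply: vanishingD => //.
- by move=> n; apply: bddM => //; apply: bddB => //; exact: bdd_cst.
- by move=> n; apply: bddM => //; apply: bddM => //; exact: bddX.
- exact: vanishing_moment.
Qed.

Lemma tauberian (eps : R) : 0 < eps -> exists2 x0, 0 < x0 & forall x, 0 < x < x0 ->
  `|x^-1 * mean mu (fun p => \1_(`[0%R, x]%classic : set R) (t p) * h p)| <= eps.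
Proof.
move=> eps0.
(* The window around [x] has mass at most [8 * e / N.+1], and [x^-1 <= 2 * N.+1]: hence 16. *)
have [e [e0 e1 Be]] : exists e : R, [/\ 0 < e, e <= 1 / 4 & B * (16 * e) <= eps / 4].
  exists (Num.min (1 / 4) (eps / (64 * B))); split.
  - by rewrite lt_min !divr_gt0// mulr_gt0.
  - by rewrite ge_min lexx.
  - rewrite (@le_trans _ _ (B * (16 * (eps / (64 * B)))))//.
      by rewrite !ler_pM2l// ge_min lexx orbT.
    by rewrite le_eqVlt (_ : _ * _ = eps / 4) ?eqxx//; field; rewrite gt_eqF.
(* [36 = 4 * (1 + 8)], where [8 = 2 * 2 * 2] comes from [x^-1 <= 2 * N.+1], the coefficient in
   [cutoff_dist] and [moments_1]. *)
have [j Hj] := natr_above (36 * B / eps / e).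
have {}Hj : 36 * B < eps * (1 + j%:R * e).
  have := Hj j (leqnn _); rewrite ltr_pdivrMr// ltr_pdivrMr// mulrC => je; lra.
have je0 : 0 <= j%:R * e by rewrite mulr_ge0// ltW.
have tail : B * ((1 + j.+1%:R * e)^-1 + 8 * (1 - 2 * e) ^+ j) <= eps / 4.
  have p2 : (1 - 2 * e) ^+ j <= (1 + j%:R * e)^-1.
    rewrite -[leRHS]mul1r ler_pdivlMr; last by lra.
    have e2 : 0 <= 2 * e <= 1 by apply/andP; split; lra.
    apply: le_trans (exprB_mul_le1 j e2); rewrite ler_wpM2l//.
      by rewrite exprn_ge0//; lra.
    by rewrite mulrCA; lra.
  have p1 : (1 + j.+1%:R * e)^-1 <= (1 + j%:R * e)^-1.
    by rewrite lef_pV2 ?posrE -?natr1 ?mulrDl; lra.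
  apply: (@le_trans _ _ (B * (9 * (1 + j%:R * e)^-1))); first by rewrite ler_pM2l//; lra.
  by rewrite mulrA ler_pdivrMr; lra.
have eps40 : 0 < eps / 4 by rewrite divr_gt0.
have [n1 Hn1] := @vanishing_cutoff j.+1 (ltn0Sn _) _ eps40.
have [n2 Hn2] := moments_1.
pose n0 := (maxn n1 n2).+1.
(* [e / 2] is at most 1/8, as [halving_time] requires. Since [N.+1 * x > 1 / 2], the other bound
   forces [N.+1 >= n0]. *)
exists (Num.min (e / 2) (1 / (2 * n0%:R))).
  by rewrite lt_min !divr_gt0// mulr_gt0.
move=> x /andP[x0]; rewrite lt_min => /andP[xe xn].
have [N N12 /andP[Nx Nx2]] : exists2 N, (1 - x) ^+ N.+1 < 1 / 2 <= (1 - x) ^+ N & 1 / 2 < N.+1%:R * x <= 2.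
  by apply: halving_time; rewrite x0; lra.
have nN : (n0 <= N.+1)%N.
  rewrite -(ler_nat R) leNgt; apply/negP => lt.
  move: xn; rewrite ltr_pdivlMr ?mulr_gt0// => xn.
  have : N.+1%:R * x < n0%:R * x by rewrite ltr_pM2r.
  lra.
have {}Hn1 := Hn1 N.+1 (leq_trans (leq_trans (leq_maxl _ _) (leqnSn _)) nN).
have {Hn2} wN : N.+1%:R * mean mu (fun p => w p ^+ N.+1) <= 2.
  have nN2 : (n2 <= N.+1)%N by apply: leq_trans nN; rewrite ltnW// ltnS leq_maxr.
  apply: le_trans (Hn2 _ nN2); rewrite ler_wpM2r ?ler_nat//.
  rewrite -(mean_cst mu 0); apply: mean_le; [exact: bdd_cst|exact: bddX|].
  by move=> p; rewrite exprn_ge0//; have /andP[] := w_itv p.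
have NR0 : 0 < N.+1%:R :> R by rewrite ltr0n.
have mI (a b : R) : measurable (`[a, b]%classic : set R) by exact: measurable_itv.
pose I0 p : R := \1_(`[0%R, x]%classic : set R) (t p).
pose I1 p : R := \1_(`[x - 4 * e / N.+1%:R, x + 4 * e / N.+1%:R]%classic : set R) (t p).
have b0 : bdd I0 by exact: bind.
have b1 : bdd I1 by exact: bind.
have bc := bdd_cutoff j.+1 N.+1.
have bwN : bdd (fun p => w p ^+ N.+1) by exact: bddX.
pose K p := B * ((1 + j.+1%:R * e)^-1 * I0 p + 2 * (1 - 2 * e) ^+ j * w p ^+ N.+1 + I1 p).
have b2 : bdd (fun p => (1 + j.+1%:R * e)^-1 * I0 p + 2 * (1 - 2 * e) ^+ j * w p ^+ N.+1).
  by apply: bddD; exact: bddZ.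
have b3 := bddD b2 b1.
have bK : bdd K by exact: bddZ.
have dist : `|mean mu (fun p => I0 p * h p) - mean mu (fun p => cutoff j.+1 (w p ^+ N.+1) * h p)| <= mean mu K.
  rewrite -meanB; [|exact: bddM|exact: bddM].
  apply: mean_norm_le => //; first by apply: bddB; exact: bddM.
  move=> p; rewrite -mulrBl normrM mulrC /K ler_pM//.
  by apply: (@cutoff_dist _ x e (t p) N j (t_itv p)) => //; apply/andP; split=> //; exact: ltW.
have mK : mean mu K = B * ((1 + j.+1%:R * e)^-1 * x +
    2 * (1 - 2 * e) ^+ j * mean mu (fun p => w p ^+ N.+1) + mean mu I1).
  rewrite /K meanZ// meanD// meanD ?meanZ//; try exact: bddZ.
  by rewrite /I0 t_uniform//; apply/andP; split; lra.
have I1le : mean mu I1 <= 8 * e / N.+1%:R.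
  apply: le_trans (t_density _) _; last by rewrite le_eqVlt (_ : _ - _ = 8 * e / N.+1%:R) ?eqxx//; field.
  have : 0 <= 4 * e / N.+1%:R by rewrite divr_ge0// mulr_ge0// ltW.
  by move: (4 * e / N.+1%:R) => k; lra.
have x1 : x^-1 <= 2 * N.+1%:R by rewrite -[leLHS]mul1r ler_pdivrMr//; lra.
have q0 : 0 <= (1 - 2 * e) ^+ j by rewrite exprn_ge0//; lra.
have xi0 : 0 <= x^-1 by rewrite invr_ge0 ltW.
rewrite normrM (ger0_norm xi0).
have bnd : x^-1 * mean mu K <= eps / 4 + eps / 4.
  have s1 : x^-1 * (2 * (1 - 2 * e) ^+ j * mean mu (fun p => w p ^+ N.+1)) <= 8 * (1 - 2 * e) ^+ j.
    have m0 : 0 <= mean mu (fun p => w p ^+ N.+1).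
      rewrite -(mean_cst mu 0); apply: mean_le; [exact: bdd_cst|exact: bddX|].
      by move=> p; rewrite exprn_ge0//; have /andP[] := w_itv p.
    apply: (@le_trans _ _ (2 * N.+1%:R * (2 * (1 - 2 * e) ^+ j * mean mu (fun p => w p ^+ N.+1)))).
      by rewrite ler_wpM2r// mulr_ge0// mulr_ge0.
    rewrite [leLHS](_ : _ = 4 * (1 - 2 * e) ^+ j * (N.+1%:R * mean mu (fun p => w p ^+ N.+1))); last by ring.
    rewrite [leRHS](_ : _ = 4 * (1 - 2 * e) ^+ j * 2); last by ring.
    by rewrite ler_wpM2l// mulr_ge0.
  have s2 : x^-1 * mean mu I1 <= 16 * e.
    apply: (@le_trans _ _ (2 * N.+1%:R * (8 * e / N.+1%:R))); last first.
      by rewrite le_eqVlt (_ : _ * _ = 16 * e) ?eqxx//; field.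
    apply: ler_pM => //; rewrite -(mean_cst mu 0); apply: mean_le; [exact: bdd_cst|done|].
    by move=> p; rewrite /I1 indicE ler0n.
  have xx : x^-1 * x = 1 by rewrite mulVf// gt_eqF.
  move: tail s1 s2; rewrite {}mK.
  move: ((1 + _)^-1) (2 * _ * mean mu _) (mean mu I1) (8 * _) => a b c q' tail s1 s2.
  rewrite [leLHS](_ : _ = B * (a * (x^-1 * x) + x^-1 * b + x^-1 * c)); last by ring.
  rewrite xx mulr1; apply: (@le_trans _ _ (B * (a + q') + B * (16 * e))); last exact: lerD.
  by rewrite -mulrDr ler_pM2l// !lerD.
have bnd2 : x^-1 * `|mean mu (fun p => cutoff j.+1 (w p ^+ N.+1) * h p)| <= eps / 2.
  apply: (@le_trans _ _ (2 * N.+1%:R * `|mean mu (fun p => cutoff j.+1 (w p ^+ N.+1) * h p)|)).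
    by rewrite ler_wpM2r.
  by move: Hn1; rewrite normrM normr_nat -mulrA; lra.
set m1 := mean mu _ in dist *; set m2 := mean mu _ in dist bnd2.
have : `|m1| <= mean mu K + `|m2| by have := ler_normD (m1 - m2) m2; rewrite subrK; lra.
move=> /(ler_wpM2l xi0)/le_trans; apply; rewrite mulrDr.
by lra.
Qed.

End tauberian.

(** * The law of the root label *)

Section clipped_permuton.
Context {R : realType} (mu : probability (R * R)%type R).
Hypothesis mu_permuton : permuton mu.

Lemma mean_clip_fst (A : set R) : measurable A ->
  mean mu (fun p => \1_A (clip p.1)) = pr mu ((A `&` `[0%R, 1%R]) `*` setT).
Proof.
move=> mA.
have mI : measurable (`[0%R, 1%R]%classic : set R) by exact: measurable_itv.
have mB : measurable ((A `&` `[0%R, 1%R]) `*` setT : set (R * R)).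
  by apply: measurableX => //; exact: measurableI.
have mf : measurable_fun setT (fun p : R * R => clip p.1).
  by apply: measurableT_comp; [exact: measurable_clip|exact: measurable_fst].
have mC : measurable [set p : R * R | A (clip p.1)].
  by rewrite -[X in measurable X]setTI; exact: mf.
have -> : (fun p : R * R => \1_A (clip p.1) : R) = \1_[set p : R * R | A (clip p.1)].
  by apply/funext => p; rewrite !indicE; congr (nat_of_bool _)%:R; apply/idP/idP; rewrite !inE.
rewrite mean_indic// (pr_permuton_unit mu_permuton)// [RHS](pr_permuton_unit mu_permuton)//.
congr (pr mu _); apply/seteqP; split=> -[x y] /=.
  move=> [Ax [xI yI]]; split=> //; split=> //; split=> //.
  by move: Ax; rewrite clip_id//; move: xI; rewrite in_itv.
move=> [[[Ax xI] _] [_ yI]]; split=> //.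
by rewrite clip_id//; move: xI; rewrite in_itv.
Qed.

Lemma mean_clip_fst_prefix x : 0 <= x <= 1 ->
  mean mu (fun p => \1_(`[0%R, x]%classic : set R) (clip p.1)) = x.
Proof.
move=> /andP[x0 x1]; rewrite mean_clip_fst; last exact: measurable_itv.
rewrite setIidl; last first.
  by move=> z; rewrite /= !in_itv /= => /andP[-> zx]; exact: le_trans zx x1.
by rewrite (pr_permuton_itv_fst mu_permuton) ?subr0.
Qed.

Lemma mean_clip_fst_le a b : a <= b ->
  mean mu (fun p => \1_(`[a, b]%classic : set R) (clip p.1)) <= b - a.
Proof.
move=> ab; rewrite mean_clip_fst; last exact: measurable_itv.
rewrite (_ : _ `&` _ = `[Num.max a 0, Num.min b 1]%classic); last first.
  apply/seteqP; split=> z; rewrite /= !in_itv /= ge_max le_min.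
    by move=> [/andP[-> ->] /andP[-> ->]].
  by move=> /andP[/andP[-> ->] /andP[-> ->]].
have aM : a <= Num.max a 0 by rewrite le_max lexx.
have Mb : Num.min b 1 <= b by rewrite ge_min lexx.
have [le|lt] := leP (Num.max a 0) (Num.min b 1).
  rewrite (pr_permuton_itv_fst mu_permuton)//; [lra|by rewrite le_max lexx orbT|].
  by rewrite ge_min lexx orbT.
rewrite (_ : [set` _] = set0); first by rewrite set0X /pr measure0 subr_ge0.
by apply/seteqP; split=> z //=; rewrite in_itv /= => /andP[/le_trans h /h]; rewrite leNgt lt.
Qed.

End clipped_permuton.

Section converse.
Context {R : realType} (mu : probability (R * R)%type R) (mu0 : probability R R).
Hypothesis mu_permuton : permuton mu.

Lemma root_moments (dd : nat -> measure_display)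
    (T : forall n, measurableType (dd n)) (P : forall n, probability (T n) R)
    (Z : forall n, 'I_n -> {RV (P n) >-> (R * R)%type}) (G : R -> R) (C c eps : R) :
  (forall n, iid (Z n) mu) -> continuous G -> 0 < C -> (forall y, `|G y| <= C) ->
  ('E_(P n)[fun w => G (subtree_ratio (bst_points (random_points (Z n) w)) [:: false])]
     @[n --> \oo] --> c%:E)%E ->
  0 < eps -> exists n0, forall n, (n0 <= n)%N ->
    `|n.+1%:R * mean mu (fun p => (1 - clip p.1) ^+ n * G p.2) - c| <= eps.
Proof.
move=> Z_iid cG C0 GC /fine_cvgP[_ /cvgrPdist_le cvg_c] eps0.
have eps20 : 0 < eps / 2 by rewrite divr_gt0.
have [n1 Hn1] := expectation_first_point mu_permuton cG C0 GC eps20.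
have [n2 _ Hn2] := cvg_c _ eps20.
exists (maxn n1 n2) => n; rewrite geq_max => /andP[n1n n2n].
have [x Ex Hx] := Hn1 n.+1 (leqW n1n) _ _ _ _ (Z_iid n.+1).
have := Hn2 n.+1 (leqW n2n); rewrite /= Ex /=.
by move: Hx; rewrite /= !ler_norml => /andP[? ?] /andP[? ?]; apply/andP; split; lra.
Qed.

(** Used for [g] and for the constant 1, [moments] makes the moments of [h = g - c] vanish. The
    Tauberian lemma then disposes of the strip average of [h], while that of [c] is exact by
    uniformity of the first marginal. *)
Lemma strip_cvg_moments :
  on_unit mu0 ->
  (forall (G : R -> R) (C eps : R), continuous G -> 0 < C -> (forall y, `|G y| <= C) ->
    0 < eps -> exists n0, forall n, (n0 <= n)%N ->
    `|n.+1%:R * mean mu (fun p => (1 - clip p.1) ^+ n * G p.2) - mean mu0 G| <= eps) ->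
  strip_cvg mu mu0.
Proof.
move=> mu0_unit moments g cg.
have cG := comp_clip_continuous cg; have [C0 HC0] := comp_clip_bounded cg.
pose C := C0 + 1.
have C_gt0 : 0 < C by rewrite ltr_pwDr// (le_trans _ (HC0 0)).
have HC y : `|(g \o clip) y| <= C by rewrite (le_trans (HC0 y))// lerDl.
have mG : measurable_fun setT (g \o clip) by exact: continuous_measurable_fun.
have bG0 : bdd (g \o clip) by split=> //; exists C.
pose c := mean mu0 (g \o clip).
have -> : (\int[mu0]_(y in `[0%R, 1%R]) (g y)%:E)%E = c%:E.
  have mI : measurable (`[0%R, 1%R]%classic : set R) by exact: measurable_itv.
  rewrite (eq_integral (fun y => ((g \o clip) y)%:E)); last first.
    by move=> y; rewrite inE /= in_itv /= => /clip_id ->.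
  rewrite /c -meanE// integral_mkcond; apply: ae_eq_integral => //.
  - by apply/(measurable_restrictT _ mI); apply: measurable_funTS; apply/measurable_EFinP.
  - exact/measurable_EFinP.
  exists (~` `[0%R, 1%R]%classic); split; first exact: measurableC.
    by apply: etrans (probability_setC mu0 mI) _; rewrite mu0_unit subee.
  by move=> y ny yI; apply: ny => _ /=; rewrite patchE mem_set.
pose h (p : R * R) := g (clip p.2) - c.
have cbd : `|c| <= C.
  rewrite -(mean_cst mu0 C); apply: mean_norm_le => //; exact: bdd_cst.
have hB p : `|h p| <= C + C.
  by rewrite /h (le_trans (ler_normB _ _))// lerD// HC.
have bG : bdd (fun p : R * R => g (clip p.2)).
  exact: (bdd_comp_snd (G := g \o clip)).
have bh : bdd h by apply: bddB => //; exact: bdd_cst.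
have mom1 eps : 0 < eps -> exists n0, forall n, (n0 <= n)%N ->
    `|n.+1%:R * mean mu (fun p => (1 - clip p.1) ^+ n) - 1| <= eps.
  move=> eps0.
  have [||n0 Hn0] := moments (fun=> 1) 1 eps _ ltr01 _ eps0.
  - exact: cst_continuous.
  - by move=> _; rewrite normr1.
  exists n0 => n /Hn0; rewrite mean_cst.
  by under [X in mean mu X]eq_fun do rewrite mulr1.
have mom_h eps : 0 < eps -> exists n0, forall n, (n0 <= n)%N ->
    `|n.+1%:R * mean mu (fun p => (1 - clip p.1) ^+ n * h p)| <= eps.
  move=> eps0; have eps20 : 0 < eps / 2 by rewrite divr_gt0.
  have eC0 : 0 < eps / 2 / C by rewrite divr_gt0.
  have [n1 H1] := moments (g \o clip) C _ cG C_gt0 HC eps20.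
  have [n2 H2] := mom1 _ eC0.
  exists (maxn n1 n2) => n; rewrite geq_max => /andP[/H1 {}H1 /H2 {}H2].
  have -> : (fun p => (1 - clip p.1) ^+ n * h p) =
      (fun p : R * R => (1 - clip p.1) ^+ n * g (clip p.2) - c * (1 - clip p.1) ^+ n).
    by apply/funext => p; rewrite /h mulrBr [c * _]mulrC.
  rewrite meanB; [|by apply: bddM => //; exact: bdd_weight|by apply: bddZ; exact: bdd_weight].
  rewrite meanZ; last exact: bdd_weight.
  set a := mean mu _ in H1 *; set b := mean mu _ in H2 *.
  rewrite (_ : _ * _ = (n.+1%:R * a - c) - c * (n.+1%:R * b - 1)); last by ring.
  apply: (le_trans (ler_normB _ _)); rewrite [leRHS](_ : _ = eps / 2 + C * (eps / 2 / C)).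
    by rewrite lerD// normrM ler_pM.
  by field; rewrite gt_eqF.
have mom2 : exists n0, forall n, (n0 <= n)%N ->
    n.+1%:R * mean mu (fun p => (1 - clip p.1) ^+ n) <= 2.
  have [n0 Hn0] := mom1 1 ltr01; exists n0 => n /Hn0.
  by rewrite ler_norml => /andP[_]; lra.
have mclip : measurable_fun setT (fun p : R * R => clip p.1).
  by apply: (measurableT_comp (@measurable_clip R)); exact: measurable_fst.
have taub := @tauberian _ _ _ mu (fun p => clip p.1) h (C + C) mclip
  (fun p => clip_itv p.1) (mean_clip_fst_prefix mu_permuton) (mean_clip_fst_le mu_permuton)
  bh.1 (addr_gt0 C_gt0 C_gt0) hB mom_h mom2.
have stripE x : 0 < x -> x <= 1 -> (\int[strip mu x]_(y in `[0%R, 1%R]) (g y)%:E)%E =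
    (c + x^-1 * mean mu (fun p => \1_(`[0%R, x]%classic : set R) (clip p.1) * h p))%:E.
  move=> x0 x1; rewrite (integral_strip mu_permuton)//; congr EFin.
  have bI : bdd (fun p : R * R => \1_(`[0%R, x]%classic : set R) (clip p.1) : R).
    by apply: bdd_indic_clip_fst; exact: measurable_itv.
  have -> : (fun p => \1_(`[0%R, x]%classic : set R) (clip p.1) * h p) =
      (fun p : R * R => \1_(`[0%R, x]%classic : set R) (clip p.1) * g (clip p.2) -
         c * \1_(`[0%R, x]%classic : set R) (clip p.1)).
    by apply/funext => p; rewrite /h mulrBr [c * _]mulrC.
  rewrite meanB; [|exact: bddM|exact: bddZ].
  rewrite meanZ// (mean_clip_fst_prefix mu_permuton) ?(ltW x0)//.
  by rewrite mulrBr mulrCA mulVf ?gt_eqF// mulr1 addrC subrK.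
apply/fine_cvgP; split.
  near=> x.
  have xgt0 : 0 < x by near: x; exact: nbhs_right_gt.
  have xle1 : x <= 1 by near: x; exact: nbhs_right_le.
  by rewrite stripE.
apply/cvgrPdist_le => eps eps0; have [x0 x00 Hx0] := taub eps eps0.
near=> x.
have xgt0 : 0 < x by near: x; exact: nbhs_right_gt.
have xle1 : x <= 1 by near: x; exact: nbhs_right_le.
rewrite /= stripE//= opprD addrA subrr add0r normrN; apply: Hx0.
by rewrite xgt0 /=; near: x; exact: nbhs_right_lt.
Unshelve. all: by end_near. Qed.

End converse.

Section converse_theorem.
Context {R : realType} (mu : probability (R * R)%type R).
Hypothesis mu_permuton : permuton mu.

Theorem strip_cvg_subtree_size (dd : nat -> measure_display)
    (T : forall n, measurableType (dd n)) (P : forall n, probability (T n) R)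
    (Z : forall n, 'I_n -> {RV (P n) >-> (R * R)%type})
    (d' : measure_display) (T' : measurableType d') (P' : probability T' R)
    (psi : T' -> word -> R) :
  (forall n, iid (Z n) mu) ->
  cvg_subtree_size P (fun n w => bst_points (random_points (Z n) w)) P' psi ->
  exists mu0 : probability R R, on_unit mu0 /\ strip_cvg mu mu0.
Proof.
move=> Z_iid [[mpsi psi01] cvg_psi].
have fX : (psi ^~ [:: false]) \in @mfun _ _ T' R by rewrite inE; exact: mpsi.
pose X : {RV P' >-> R} := mfun_Sub fX.
pose mu0 : probability R R := distribution P' X.
exists mu0.
have unit0 : on_unit mu0.
  rewrite /on_unit.
  have mI : measurable (X @^-1` `[0%R, 1%R]).
    by rewrite -[X in measurable X]setTI; apply: measurable_funP => //; exact: measurable_itv.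
  have [N [mN N0 HN]] := psi01.
  have -> : (mu0 (`[0%R, 1%R]%classic : set R) = P' (~` ~` (X @^-1` `[0%R, 1%R])))%E by rewrite setCK.
  apply: etrans (probability_setC P' (measurableC mI)) _.
  rewrite (_ : P' _ = 0%E) ?sube0//; apply/eqP; rewrite eq_le measure_ge0 andbT -N0.
  apply: le_measure; rewrite ?inE//; first exact: measurableC.
  move=> w nw; apply: HN => -[+ _ _] => /(_ [:: false]) w01; apply: nw.
  by rewrite /= in_itv.
split=> //.
apply: strip_cvg_moments => // G C eps cG C0 GC eps0.
apply: (root_moments mu_permuton Z_iid cG C0 GC) => //.
have bf : bounded_fun (fun x : 'rV[R]_1 => G (x ord0 ord0)).
  by exists C; split; [exact: num_real|move=> M CM x _ /=; rewrite (le_trans (GC _))// ltW].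
have cf : continuous (fun x : 'rV[R]_1 => G (x ord0 ord0)).
  by move=> x; apply: continuous_comp; [exact: coord_continuous|exact: cG].
have := cvg_psi 1 (fun=> [:: false]) _ cf bf.
have -> : (fun n => 'E_(P n)[fun w =>
    G ((\row_(i < 1) subtree_ratio (bst_points (random_points (Z n) w)) [:: false]) ord0 ord0)])%E =
  (fun n => 'E_(P n)[fun w => G (subtree_ratio (bst_points (random_points (Z n) w)) [:: false])])%E.
  by apply/funext => n; congr expectation; apply/funext => w; rewrite mxE.
have -> : ('E_P'[fun w => G ((\row_(i < 1) psi w [:: false]) ord0 ord0)])%E = (mean mu0 G)%:E.
  have bG : bdd G by split; [exact: continuous_measurable_fun|exists C].
  rewrite -meanE// integral_distribution.
  - by rewrite unlock; apply: eq_integral => w _ /=; rewrite mxE.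
  - by apply/measurable_EFinP; exact: bG.1.
  - apply: (@bdd_integrable _ _ _ P' (G \o X)); split; last by exists C => w; exact: GC.
    by apply: measurableT_comp; [exact: bG.1|exact: mpsi].
by [].
Qed.

End converse_theorem.

Theorem theorem1p2 (R : realType)
    (mu : probability (R * R)%type R) (mu_permuton : permuton mu)
    (d : nat -> measure_display) (T : forall n, measurableType (d n))
    (P : forall n, probability (T n) R)
    (Z : forall n, 'I_n -> {RV (P n) >-> (R * R)%type})
    (Z_iid : forall n, iid (Z n) mu) :
  (forall mu0 : probability R R,
     on_unit mu0 -> atomless mu0 -> strip_cvg mu mu0 ->
     forall (d' : measure_display) (T' : measurableType d')
       (P' : probability T' R) (Y : nat -> {RV P' >-> R}),
       iid Y mu0 ->
       cvg_subtree_size P (fun n w => bst_points (random_points (Z n) w))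
         P' (fun w => tree_gap (bst_stream (fun i => Y i w))))
  /\
  ((exists (d' : measure_display) (T' : measurableType d')
      (P' : probability T' R) (psi : T' -> word -> R),
      cvg_subtree_size P (fun n w => bst_points (random_points (Z n) w))
        P' psi) ->
   exists mu0 : probability R R,
     on_unit mu0 /\ strip_cvg mu mu0).
Proof.
split=> [mu0 mu0_unit mu0_atomless mu_strip d' T' P' Y Y_iid|].
  exact: (cvg_subtree_size_stream mu_permuton mu0_unit mu0_atomless mu_strip Y_iid Z_iid).
move=> [d' [T' [P' [psi cvg_psi]]]].
exact: (strip_cvg_subtree_size mu_permuton Z_iid cvg_psi).
Qed.
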